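(* Let $N\ge3$, $\alpha\in\mathbb{R}$ and $\beta,p>0$. Then the equation $$-\Delta u=|x|^\alpha\log^\beta(1+|x|)\,u^{-p}\quad\text{in }\mathbb{R}^N\setminus\{0\}\qquad(\ast)$$ has positive solutions if and only if $$N+\alpha+\beta+p(N-2)>0\quad\text{and}\quad\alpha<-2.$$ Furthermore, if these two conditions hold, then: (i) the set of positive solutions of $(\ast)$ consists of a two-parameter family of radially symmetric functions: for any $a,b\ge0$ there exists a radially symmetric positive solution $u_{a,b}$ of $(\ast)$ such that $\lim_{|x|\to0}|x|^{N-2}u_{a,b}(x)=a$ and $\lim_{|x|\to\infty}u_{a,b}(x)=b$, and the set of positive solutions of $(\ast)$ consists only of $\{u_{a,b}:a,b\ge0\}$; (ii) the minimal solution of $(\ast)$ has a removable singularity at the origin if and only if $\alpha+\beta>-2$.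
   Context: Solutions are positive functions $u\in C^2(\mathbb{R}^N\setminus\{0\})$ satisfying the equation pointwise. $\log^\beta(1+|x|)=(\log(1+|x|))^\beta$. The minimal solution of $(\ast)$ is the positive solution $\xi$ with $\xi\le u$ in $\mathbb{R}^N\setminus\{0\}$ for every positive solution $u$ of $(\ast)$. ''Removable singularity at the origin'' means that the function extends to a positive continuous function on $\mathbb{R}^N$. *)

(* Defs.v *)
From HB Require Import structures.
From mathcomp Require Import all_boot all_order all_algebra.
From mathcomp Require Import all_classical all_reals all_analysis.

Set Implicit Arguments.
Unset Strict Implicit.
Unset Printing Implicit Defensive.

Import Order.TTheory GRing.Theory Num.Theory.
Import numFieldNormedType.Exports.

Local Open Scope classical_set_scope.
Local Open Scope ring_scope.

(* R^N is 'rV[R]_N.  Its library norm `|x| is the sup norm, which induces the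
   usual topology but is not the |x| of the equation; hence enorm. *)
Definition enorm (R : realType) (N : nat) (x : 'rV[R]_N) : R :=
  Num.sqrt (\sum_(i < N) x ord0 i ^+ 2).

(* The filter of the limits "as |x| --> oo". *)
Definition enorm_infty (R : realType) (N : nat) : set_system 'rV[R]_N :=
  filter_from [set: R] (fun M => [set x | M < enorm x]).

Global Instance enorm_infty_filter (R : realType) (N : nat) :
  Filter (@enorm_infty R N).
Proof.
apply: filter_from_filter; first by exists 0.
move=> M M' _ _; exists (Num.max M M') => // x /=.
by rewrite gt_max => /andP[].
Qed.

Definition partial (R : realType) (N : nat) (i : 'I_N) (u : 'rV[R]_N -> R) :
  'rV[R]_N -> R := 'D_(delta_mx ord0 i) u.

Definition has_partial (R : realType) (N : nat) (i : 'I_N) (u : 'rV[R]_N -> R)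
  (x : 'rV[R]_N) : Prop := derivable u x (delta_mx ord0 i).

(* Meant for an open D: then nothing depends on the values of u outside D. *)
Definition C2_on (R : realType) (N : nat) (D : set 'rV[R]_N)
    (u : 'rV[R]_N -> R) : Prop :=
  forall x, D x ->
    [/\ {for x, continuous u},
        forall i, has_partial i u x /\ {for x, continuous (partial i u)}
      & forall i j, has_partial j (partial i u) x /\
                    {for x, continuous (partial j (partial i u))}].

Definition laplacian (R : realType) (N : nat) (u : 'rV[R]_N -> R)
  (x : 'rV[R]_N) : R := \sum_(i < N) partial i (partial i u) x.

(* A function on R^N \ {0} is encoded as a total function whose value at 0 is
   irrelevant: all the predicates below only look at it away from 0. *)
Definition positive_solution (R : realType) (N : nat) (alpha beta p : R)
    (u : 'rV[R]_N -> R) : Prop :=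
  [/\ C2_on [set x | x != 0] u,
      forall x, x != 0 -> 0 < u x
    & forall x, x != 0 ->
        - laplacian u x =
        enorm x `^ alpha * ln (1 + enorm x) `^ beta * u x `^ (- p)].

Definition minimal_solution (R : realType) (N : nat) (alpha beta p : R)
    (xi : 'rV[R]_N -> R) : Prop :=
  positive_solution alpha beta p xi /\
  forall u, positive_solution alpha beta p u ->
    forall x, x != 0 -> xi x <= u x.

Definition radially_symmetric (R : realType) (N : nat) (u : 'rV[R]_N -> R) :
    Prop :=
  forall x y, x != 0 -> y != 0 -> enorm x = enorm y -> u x = u y.

Definition removable_singularity_at_origin (R : realType) (N : nat)
    (u : 'rV[R]_N -> R) : Prop :=
  exists v : 'rV[R]_N -> R,
    [/\ continuous v, forall x, 0 < v x & forall x, x != 0 -> v x = u x].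

(* Main.v *)
Require Import Defs.
From HB Require Import structures.
From mathcomp Require Import all_boot all_order all_algebra.
From mathcomp Require Import all_classical all_reals all_analysis.
From mathcomp Require Import ring lra.
Import Order.TTheory GRing.Theory Num.Theory.
Import numFieldNormedType.Exports.
Local Open Scope classical_set_scope.
Local Open Scope ring_scope.
Set Implicit Arguments.
Unset Strict Implicit.
Unset Printing Implicit Defensive.

(** Write [k = N - 2], let [f] be the weight, so that the equation is
    [- Delta u = f(|x|) u^-p], and let [C] stand for constants.  Everything rests
    on the weak maximum principle [max_principle].  The functions that it
    compares are built from powers of distances, from affine functions, and from
    solutions, possibly composed with reflections.  For these, second order jets
    along the coordinate axes are enough to speak of the Laplacian.

    The source decreases in [u], so the difference of two solutions is subharmonic
    where it is positive, and two solutions compare as soon as they do at the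
    origin and at infinity ([solution_compare]).  The classification therefore
    amounts to showing that every solution behaves in one of the prescribed ways
    at both ends.

    Upper bound.  Where [u] is small the equation makes it very concave; hence
    [|x|^2 f u^-p <= C u] ([source_le]), and [u] solves a linear inequality that
    is invariant under dilations.  Comparing [u] with its reflections gives an
    interior gradient bound, which applied around a well chosen peak bounds [u]
    from below on a ball.  Superharmonicity spreads this lower bound, and the
    result is a Harnack inequality weak enough to be elementary and strong enough
    to give [u <= C (1 + |x|^-k)] ([solution_bounded]).

    Symmetry.  If [sigma] is the reflection across a hyperplane through the
    origin, then [u - u \o sigma] vanishes on the hyperplane and is subharmonic
    where it is positive.  The upper bound makes it negligible, at both ends,
    against a positive superharmonic function of a half space; hence it is
    nonpositive there, and [u] is radial ([solution_radial]).

    Asymptotics. By the minimum principle inside and outside spheres, a radial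
    solution [u] is nonincreasing, and [|x|^k u] nondecreasing, in [|x|]. So
    both limits exist, and by comparison they determine the solution,
    monotonically ([asymptotics_le]). In particular the solution with [a = b =
    0] is the minimal one.

    Necessary conditions.  If [alpha >= -2], the source is at least of the order
    of [|x|^-2] at infinity and [u] would lie above the barriers
    [(|x|^-q - |x|^-k) / q] for all small [q > 0], up to a constant factor, which
    contradicts the upper bound ([solution_alpha]).  The other condition is
    obtained in the same way at the origin ([solution_exponent]), and so is the
    condition [alpha + beta > -2] for the existence of a bounded solution
    ([bounded_solution_exponent]).  Under the latter condition, a bounded
    supersolution near the origin shows that [a = 0] implies boundedness
    ([nonsingular_bounded]), and monotonicity provides the continuous extension.

    Existence.  With [s = ln |x|] a radial solution satisfies
    [- h'' - k h' = F h^-p], with [F = |x|^2 f].  The harmonic function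
    [b + a exp (- k s)] plus a supersolution made of two exponentials is a
    supersolution; a small multiple of [F^(1 / (1 + p))] is a subsolution.
    Between them the equation is solved by monotone iteration
    ([monotone_iteration]), adding [c h] to both sides, with [c] such that the
    operator on the left factors into two first order ones. *)


(** * Second order jets in one variable *)

Section OneVariable.
Variable R : realType.
Implicit Types (f g : R -> R) (a b : R).

Lemma is_derive_addf (V : normedModType R) (f g : V -> R) (x v : V) a b :
  is_derive x v f a -> is_derive x v g b ->
  is_derive x v (fun y => f y + g y) (a + b).
Proof. exact: is_deriveD. Qed.

Lemma is_derive_mulf (V : normedModType R) (f g : V -> R) (x v : V) a b :
  is_derive x v f a -> is_derive x v g b ->
  is_derive x v (fun y => f y * g y) (a * g x + f x * b).
Proof.
move=> fa gb; have := is_deriveM fa gb; rewrite addrC.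
by rewrite -![_ *: _]/(_ * _) [g x * a]mulrC.
Qed.

Lemma is_derive_scalef (V : normedModType R) (f : V -> R) (x v : V) (c a : R) :
  is_derive x v f a -> is_derive x v (fun y => c * f y) (c * a).
Proof. exact: is_deriveZ. Qed.

Lemma is_derive_oppf (V : normedModType R) (f : V -> R) (x v : V) a :
  is_derive x v f a -> is_derive x v (fun y => - f y) (- a).
Proof. exact: is_deriveN. Qed.

Lemma is_derive_sumf (V : normedModType R) n (f : 'I_n -> V -> R) (x v : V)
    (a : 'I_n -> R) :
  (forall i, is_derive x v (f i) (a i)) ->
  is_derive x v (fun y => \sum_(i < n) f i y) (\sum_(i < n) a i).
Proof.
move=> fa; rewrite (_ : (fun _ => _) = \sum_(i < n) f i); last first.
  by apply/funext => y; rewrite fct_sumE.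
exact: is_derive_sum.
Qed.

Lemma is_derive_compf f g (x : R) a b :
  is_derive (g x) 1 f a -> is_derive x 1 g b ->
  is_derive x 1 (fun y => f (g y)) (a * b).
Proof. exact: is_derive1_comp. Qed.

Lemma is_derive_invf f (x : R) a : is_derive x 1 f a -> f x != 0 ->
  is_derive x 1 (fun y => (f y)^-1) (- (f x) ^- 2 * a).
Proof. by move=> fa fx; exact: is_deriveV. Qed.

Lemma is_derive_continuous f (x : R) a : is_derive x 1 f a -> {for x, continuous f}.
Proof.
by move=> [fx _]; apply/differentiable_continuous/derivable1_diffP.
Qed.

Lemma is_derive_line (V : normedModType R) (f : V -> R) (x v : V) (s : R) a :
  is_derive (s *: v + x) v f a <-> is_derive s 1 (fun h : R => f (h *: v + x)) a.
Proof.
pose D (h : R) := h^-1 *: (f (h *: v + (s *: v + x)) - f (s *: v + x)).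
have E : (fun h : R => h^-1 *: (f ((h *: (1 : R) + s) *: v + x) -
    f (s *: v + x))) = D.
  by apply/funext => h; rewrite /D addrA -scalerDl [_%:A]mulr1.
split=> -[fx dfx]; apply: DeriveDef.
- by rewrite /derivable /comp /shift /= E.
- by rewrite -dfx /derive /comp /shift /= E.
- by move: fx; rewrite /derivable /comp /shift /= E.
- by rewrite -dfx /derive /comp /shift /= E.
Qed.

Lemma is_derive_affine_arg f (c d h a : R) :
  is_derive (c * h + d) 1 f a -> is_derive h 1 (fun s => f (c * s + d)) (a * c).
Proof.
move=> fa; apply: (@is_derive_compf _ (fun s => c * s + d)) => //.
have H := is_derive_addf (is_derive_scalef c (is_derive_id h 1))
  (is_derive_cst d h 1).
by apply: (is_derive_eq H); rewrite addr0 mulr1.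
Qed.

(** Second order jets along a line are all that the maximum principle needs;
    unlike the C^2 property of a function of N variables they are trivially
    stable under sums, products and compositions. *)
Definition jet2 (g : R -> R) (g1 g2 : R) : Prop :=
  exists g' : R -> R, [/\ \forall h \near (0 : R), is_derive (h : R) 1 g (g' h),
    g' 0 = g1 & is_derive (0 : R) 1 g' g2].

Lemma jet2_continuous g (g1 g2 : R) : jet2 g g1 g2 -> {for 0, continuous g}.
Proof.
by move=> [g' [/nbhs_singleton gd _ _]]; exact: (is_derive_continuous gd).
Qed.

Lemma jet2_eq g (g1 g2 : R) a b : jet2 g g1 g2 -> g1 = a -> g2 = b -> jet2 g a b.
Proof. by move=> H <- <-. Qed.

Lemma jet2_cst (c : R) : jet2 (fun=> c) 0 0.
Proof.
exists (fun=> 0); split=> //; last exact: is_derive_cst.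
by near=> h; exact: is_derive_cst.
Unshelve. all: by end_near. Qed.

Lemma jet2_id (c d : R) : jet2 (fun h => h * c + d) c 0.
Proof.
exists (fun=> c); split=> //; last exact: is_derive_cst.
near=> h; have H := is_derive_addf (is_derive_mulf (is_derive_id h 1)
  (is_derive_cst c h 1)) (is_derive_cst d h 1).
by apply: (is_derive_eq H); rewrite /= mul1r mulr0 !addr0.
Unshelve. all: by end_near. Qed.

Lemma jet2_add f g (f1 f2 g1 g2 : R) : jet2 f f1 f2 -> jet2 g g1 g2 ->
  jet2 (fun h => f h + g h) (f1 + g1) (f2 + g2).
Proof.
move=> [f' [df <- d2f]] [g' [dg <- d2g]].
exists (fun h => f' h + g' h); split=> //; last exact: is_derive_addf.
near=> h; have dfh : is_derive h 1 f (f' h) by near: h.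
have dgh : is_derive h 1 g (g' h) by near: h.
exact: is_derive_addf.
Unshelve. all: by end_near. Qed.

Lemma jet2_mul f g (f1 f2 g1 g2 : R) : jet2 f f1 f2 -> jet2 g g1 g2 ->
  jet2 (fun h => f h * g h) (f1 * g 0 + f 0 * g1)
    (f2 * g 0 + f 0 * g2 + 2 * (f1 * g1)).
Proof.
move=> [f' [df <- d2f]] [g' [dg <- d2g]].
exists (fun h => f' h * g h + f h * g' h); split=> //.
  near=> h; have dfh : is_derive h 1 f (f' h) by near: h.
  have dgh : is_derive h 1 g (g' h) by near: h.
  exact: is_derive_mulf.
have df0 := nbhs_singleton df; have dg0 := nbhs_singleton dg.
have H := is_derive_addf (is_derive_mulf d2f dg0) (is_derive_mulf df0 d2g).
by apply: (is_derive_eq H); ring.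
Unshelve. all: by end_near. Qed.

Lemma jet2_comp (psi psi1 : R -> R) (l2 : R) g (g1 g2 : R) :
  (\forall y \near g 0, is_derive (y : R) 1 psi (psi1 y)) ->
  is_derive (g 0) 1 psi1 l2 -> jet2 g g1 g2 ->
  jet2 (fun h => psi (g h)) (psi1 (g 0) * g1) (l2 * g1 ^+ 2 + psi1 (g 0) * g2).
Proof.
move=> dpsi d2psi jg; have cg := jet2_continuous jg.
move: jg => [g' [dg <- d2g]].
exists (fun h => psi1 (g h) * g' h); split=> //.
  near=> h; have dgh : is_derive h 1 g (g' h) by near: h.
  have dph : is_derive (g h) 1 psi (psi1 (g h)) by near: h; exact: (cg _ dpsi).
  exact: is_derive_compf.
have H := is_derive_mulf (is_derive_compf d2psi (nbhs_singleton dg)) d2g.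
by apply: (is_derive_eq H); ring.
Unshelve. all: by end_near. Qed.

(** The first derivative vanishes by Fermat's theorem.  If the second one were
    positive, the first would be positive just to the right of [0], and [g]
    would increase there. *)
Lemma jet2_max g (g1 g2 : R) :
  jet2 g g1 g2 -> (\forall h \near (0 : R), g h <= g 0) ->
  g1 = 0 /\ g2 <= 0.
Proof.
move=> [g' [dg g10 d2g]] gmax.
have [e e0 He] : exists2 e : R, 0 < e & forall h : R, `|h| < e ->
    is_derive h 1 g (g' h) /\ g h <= g 0.
  have H : nbhs (0 : R) [set h : R | is_derive h 1 g (g' h) /\ g h <= g 0].
    exact: filterI dg gmax.
  move/nbhs_ballP: H => [e /= e0 He].
  exists e => // h he; apply: He.
  by rewrite /ball /= sub0r normrN.
have g'0 : g' 0 = 0.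
  have ee : - e <= e by rewrite ge0_cp// ltW.
  have gdv t : t \in `]-e, e[%R -> derivable g t 1.
    by rewrite in_itv/= -ltr_norml => /He[[]].
  have gle t : t \in `]-e, e[%R -> g t <= g 0.
    by rewrite in_itv/= -ltr_norml => /He[].
  have oI : 0 \in `]-e, e[%R by rewrite in_itv/= oppr_lt0 e0.
  have h0 := derive1_at_max ee gdv oI gle.
  have [] := He 0; first by rewrite normr0.
  by move=> [_ <-] _; case: h0.
split; first by rewrite -g10.
rewrite leNgt; apply/negP => g2_gt0.
have := d2g => -[/derivable_nbhsP + D].
have d2cv : (fun h => h^-1 *: ((g' \o shift 0) (h *: 1) - g' 0)) @ 0^' --> g2.
  by have [dd <-] := d2g; exact: dd.
move=> _; have /nbhs_ballP[d /= d0 Hd] : \forall h \near (0 : R)^',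
    0 < (h^-1 *: ((g' \o shift 0) (h *: 1) - g' 0)).
  by apply: (cvgr_gt g2 d2cv).
pose h := Num.min e d / 2.
have m0 : 0 < Num.min e d by rewrite lt_min e0.
have h0 : 0 < h by rewrite divr_gt0.
have hm : h < Num.min e d by rewrite ltr_pdivrMr// ltr_pMr// ltr1n.
have /andP[he hd] : (h < e) && (h < d) by rewrite -lt_min.
have [||c cI Hc] := @MVT _ g g' 0 h h0.
- move=> x /[!in_itv]/= /andP[x0 xh].
  by have [] := He x => //; rewrite gtr0_norm// (lt_trans xh).
- apply: derivable_within_continuous => x /[!in_itv]/= /andP[x0 xh].
  have [] := He x; first by rewrite ger0_norm// (le_lt_trans xh).
  by move=> [].
move: cI; rewrite in_itv/= => /andP[c0 ch].
have : 0 < g' c.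
  have := Hd c; rewrite /ball /= sub0r normrN (gtr0_norm c0) (lt_trans ch)//.
  move=> /(_ isT (lt0r_neq0 c0)); rewrite g'0 subr0 addr0 [_%:A]mulr1.
  by rewrite pmulr_rgt0// invr_gt0.
move=> g'c; have : 0 < g' c * (h - 0) by rewrite subr0 mulr_gt0.
rewrite -Hc subr_gt0 ltNge.
by have [] := He h; rewrite ?gtr0_norm// => _ ->.
Unshelve. all: by end_near. Qed.

End OneVariable.


(** * Laplacians from jets along the coordinate axes *)

Section SecondOrder.
Variables (R : realType) (N : nat).
Implicit Types (w f g : 'rV[R]_N -> R) (x z e v : 'rV[R]_N).

(** [lap_at w x G L]: along the coordinate lines through [x], [w] has second
    order jets whose first derivatives form [G] and whose second derivatives
    add up to [L].  The gradient is recorded for the sake of the product rule. *)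
Definition lap_at w x (G : 'I_N -> R) (L : R) : Prop :=
  exists2 l : 'I_N -> R,
    forall i, jet2 (fun h : R => w (h *: delta_mx ord0 i + x)) (G i) (l i) &
    L = \sum_(i < N) l i.

Lemma lap_at_eq w x (G G' : 'I_N -> R) (L L' : R) :
  lap_at w x G L -> G =1 G' -> L = L' -> lap_at w x G' L'.
Proof.
move=> [l jl ->] GG <-; exists l => // i.
exact: jet2_eq (jl i) (GG i) erefl.
Qed.

Lemma lap_at_cst (c : R) x : lap_at (fun=> c) x (fun=> 0) 0.
Proof.
by exists (fun=> 0); [move=> i; exact: jet2_cst|rewrite big1].
Qed.

Lemma lap_at_add f g x (F G : 'I_N -> R) (K L : R) :
  lap_at f x F K -> lap_at g x G L ->
  lap_at (fun y => f y + g y) x (fun i => F i + G i) (K + L).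
Proof.
move=> [k jk ->] [l jl ->]; exists (fun i => k i + l i).
  by move=> i; exact: jet2_add.
by rewrite big_split.
Qed.

Lemma lap_at_mul f g x (F G : 'I_N -> R) (K L : R) :
  lap_at f x F K -> lap_at g x G L ->
  lap_at (fun y => f y * g y) x (fun i => F i * g x + f x * G i)
    (K * g x + f x * L + 2 * \sum_(i < N) F i * G i).
Proof.
move=> [k jk ->] [l jl ->].
exists (fun i => k i * g x + f x * l i + 2 * (F i * G i)).
  move=> i; have := jet2_mul (jk i) (jl i).
  by rewrite scale0r add0r.
by rewrite !big_split/= -mulr_suml -!mulr_sumr.
Qed.

Lemma lap_at_scale (c : R) f x (F : 'I_N -> R) (K : R) :
  lap_at f x F K -> lap_at (fun y => c * f y) x (fun i => c * F i) (c * K).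
Proof.
move=> fK; apply: lap_at_eq (lap_at_mul (lap_at_cst c x) fK) _ _.
  by move=> i; rewrite mul0r add0r.
by rewrite mul0r add0r big1 ?mulr0 ?addr0// => i _; rewrite mul0r.
Qed.

Lemma lap_at_sub f g x (F G : 'I_N -> R) (K L : R) :
  lap_at f x F K -> lap_at g x G L ->
  lap_at (fun y => f y - g y) x (fun i => F i - G i) (K - L).
Proof.
move=> fK gL; have := lap_at_add fK (lap_at_scale (-1) gL).
rewrite mulN1r (_ : (fun y => f y + -1 * g y) = (fun y => f y - g y)).
  by move=> H; apply: lap_at_eq H _ _ => // i; rewrite mulN1r.
by apply/funext => y; rewrite mulN1r.
Qed.

Lemma lap_at_comp (psi psi1 : R -> R) (l2 : R) f x (F : 'I_N -> R) (K : R) :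
  (\forall y \near f x, is_derive (y : R) 1 psi (psi1 y)) ->
  is_derive (f x) 1 psi1 l2 -> lap_at f x F K ->
  lap_at (fun y => psi (f y)) x (fun i => psi1 (f x) * F i)
    (l2 * \sum_(i < N) F i ^+ 2 + psi1 (f x) * K).
Proof.
move=> dpsi d2psi [k jk ->].
exists (fun i => l2 * F i ^+ 2 + psi1 (f x) * k i).
  move=> i; have E : f (0 *: delta_mx ord0 i + x) = f x.
    by rewrite scale0r add0r.
  by have := @jet2_comp _ psi psi1 l2 _ _ _ _ _ (jk i); rewrite E; apply.
by rewrite big_split/= !mulr_sumr.
Qed.

Lemma line_continuous x v : continuous (fun h : R => h *: v + x).
Proof.
move=> h; apply: cvgD; last exact: cvg_cst.
exact: scalel_continuous.
Qed.

Lemma lap_at_max w x (G : 'I_N -> R) (L : R) :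
  lap_at w x G L -> (\forall y \near x, w y <= w x) -> L <= 0.
Proof.
move=> [l jl ->] wmax; apply: sumr_le0 => i _; suff [] : G i = 0 /\ l i <= 0 by [].
apply: (jet2_max (jl i)).
rewrite scale0r add0r.
have := @line_continuous x (delta_mx ord0 i) 0 [set y | w y <= w x].
by rewrite scale0r add0r; exact.
Qed.

Definition sqdist z x : R := \sum_(j < N) (x ord0 j - z ord0 j) ^+ 2.

(** For a unit vector [e], the signed distance to the hyperplane through [z]
    orthogonal to [e]. *)
Definition affine e z x : R := \sum_(j < N) e ord0 j * (x ord0 j - z ord0 j).

Lemma line_coord (h : R) x (i j : 'I_N) :
  (h *: delta_mx ord0 i + x : 'rV[R]_N) ord0 j = h * (j == i)%:R + x ord0 j.
Proof. by rewrite !mxE eqxx. Qed.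

Lemma sum_pick (F : 'I_N -> R) (i : 'I_N) :
  \sum_(j < N) (j == i)%:R * F j = F i.
Proof.
rewrite (bigD1 i)//= eqxx mul1r big1 ?addr0// => j /negbTE->.
by rewrite mul0r.
Qed.

Lemma lap_at_sqdist z x :
  lap_at (sqdist z) x (fun i => 2 * (x ord0 i - z ord0 i)) (2 * N%:R).
Proof.
exists (fun=> 2); last by rewrite sumr_const card_ord mulr_natr.
move=> i; set c := 2 * (x ord0 i - z ord0 i).
have -> : (fun h : R => sqdist z (h *: delta_mx ord0 i + x)) =
    (fun h => (h * c + sqdist z x) + (h * 1 + 0) * (h * 1 + 0)).
  apply/funext => h; rewrite /sqdist.
  under eq_bigr => j _.
    rewrite line_coord (_ : _ ^+ 2 = (x ord0 j - z ord0 j) ^+ 2 +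
      (j == i)%:R * (h * (2 * (x ord0 j - z ord0 j)) + h * h)).
      over.
    by case: eqP => _ /=; rewrite ?mulr1 ?mulr0 ?mul1r ?mul0r; ring.
  rewrite big_split/= sum_pick -/c; ring.
have j1 := jet2_id (1 : R) 0.
apply: (jet2_eq (jet2_add (jet2_id c _) (jet2_mul j1 j1))); ring.
Qed.

Lemma lap_at_affine e z x : lap_at (affine e z) x (fun i => e ord0 i) 0.
Proof.
exists (fun=> 0); last by rewrite big1.
move=> i.
have -> : (fun h : R => affine e z (h *: delta_mx ord0 i + x)) =
    (fun h => h * e ord0 i + affine e z x).
  apply/funext => h; rewrite /affine.
  under eq_bigr => j _.
    rewrite line_coord (_ : _ * _ = e ord0 j * (x ord0 j - z ord0 j) +
      (j == i)%:R * (h * e ord0 j)).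
      over.
    ring.
  by rewrite big_split/= sum_pick addrC.
exact: jet2_id.
Qed.

Lemma near_gt0 (c : R) : 0 < c -> \forall y \near c, 0 < y.
Proof. by move=> c0; exact: lt_nbhsr. Qed.

Lemma lap_at_powR_sqdist (m : R) z x : 0 < sqdist z x ->
  lap_at (fun y => sqdist z y `^ (m / 2)) x
    (fun i => m * sqdist z x `^ (m / 2 - 1) * (x ord0 i - z ord0 i))
    (m * (m + N%:R - 2) * sqdist z x `^ (m / 2 - 1)).
Proof.
move=> q0; set q := sqdist z x in q0 *.
have d1 : \forall y \near q,
    is_derive (y : R) 1 (fun s : R => s `^ (m / 2)) (m / 2 * y `^ (m / 2 - 1)).
  near=> y; have y0 : 0 < y by near: y; exact: near_gt0.
  exact: (@is_derive1_powR R (m / 2) y y0).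
have d2 := is_derive_scalef (m / 2) (@is_derive1_powR R (m / 2 - 1) q q0).
apply: lap_at_eq (lap_at_comp d1 d2 (lap_at_sqdist z x)) _ _.
  by move=> i; rewrite -/q; field.
rewrite -/q; under eq_bigr do rewrite exprMn.
rewrite -mulr_sumr -/(sqdist z x) -/q.
have E : q `^ (m / 2 - 1) = q `^ (m / 2 - 1 - 1) * q.
  transitivity (q `^ (m / 2 - 1 - 1) * q `^ 1); last by rewrite powRr1 ?ltW.
  by rewrite -powRD ?subrK// (gt_eqF q0) implybT.
rewrite E; field.
Unshelve. all: by end_near. Qed.

End SecondOrder.


(** * Functions of class C^2 and reflections *)

Section Regularity.
Variables (R : realType) (N : nat).
Implicit Types (u : 'rV[R]_N -> R) (x y z e v : 'rV[R]_N).

(** The step [c] may have either sign, whence the parametrisation of the segment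
    by [0, 1]. *)
Lemma partial_MVT u y (k : 'I_N) (c : R) :
  (forall t : R, 0 <= t <= 1 -> has_partial k u ((t * c) *: delta_mx ord0 k + y)) ->
  exists2 t : R, 0 <= t <= 1 &
    u (c *: delta_mx ord0 k + y) - u y =
    c * partial k u ((t * c) *: delta_mx ord0 k + y).
Proof.
move=> hp; set E : 'rV[R]_N := delta_mx ord0 k.
have dg (t : R) : t \in `[0, 1]%R -> is_derive t 1
    (fun t : R => u ((t * c) *: E + y)) (partial k u ((t * c) *: E + y) * c).
  rewrite in_itv/= => /hp/derivableP H.
  have := (is_derive_line u y E (t * c) _).1 H => H1.
  have := @is_derive_affine_arg _ (fun s => u (s *: E + y)) c 0 t _ _.
  rewrite addr0 mulrC => /(_ _ H1).
  rewrite mulrC; congr (is_derive _ _ _ _).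
  by apply/funext => s; rewrite addr0 [s * c]mulrC.
have dgo (t : R) : t \in `]0, 1[%R -> is_derive t 1
    (fun t : R => u ((t * c) *: E + y)) (partial k u ((t * c) *: E + y) * c).
  by move=> tI; apply: dg; exact: subset_itv_oo_cc tI.
have [|t tI Ht] := @MVT_segment _ (fun t : R => u ((t * c) *: E + y)) _ 0 1
    ler01 dgo.
  by apply: derivable_within_continuous => t /dg[].
exists t; first by move: tI; rewrite in_itv.
by move: Ht; rewrite mul1r mul0r scale0r add0r subr0 mulr1 mulrC.
Qed.

(** Continuity of the partial derivatives is what makes directional
    derivatives linear in the direction: one walks from [x] to [x + h v] along
    the coordinate axes, and each leg is controlled by the mean value theorem. *)
Lemma is_derive_partials u x v :
  (forall i, \forall y \near x, has_partial i u y) ->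
  (forall i, {for x, continuous (partial i u)}) ->
  is_derive x v u (\sum_(i < N) v ord0 i * partial i u x).
Proof.
move=> hp cp; set S := \sum_(i < N) _.
suff H : (fun h : R => h^-1 *: ((u \o shift x) (h *: v) - u x)) @ 0^' --> S.
  apply: DeriveDef; first by apply/cvg_ex; exists S.
  exact: cvg_lim.
apply/cvgrPdist_le => eps eps0.
pose vv := \sum_(i < N) `|v ord0 i| + 1.
have vv0 : 0 < vv by rewrite ltr_pwDr// sumr_ge0.
pose ee := eps / vv; have ee0 : 0 < ee by rewrite divr_gt0.
have [d /= d0 Hd] : exists2 d : R, 0 < d & forall y, `|x - y| < d ->
    forall i, has_partial i u y /\ `|partial i u x - partial i u y| <= ee.
  have H : nbhs x [set y | forall i, has_partial i u y /\
      `|partial i u x - partial i u y| <= ee].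
    apply: (@filter_forall _ _ (fun i => [set y | has_partial i u y /\
      `|partial i u x - partial i u y| <= ee]) _ (nbhs_filter x)) => i.
    apply: filterI; first exact: hp.
    by move/cvgrPdist_le : (cp i) => /(_ _ ee0).
  move/nbhs_ballP: H => [d /= d0 Hd]; exists d => // y xy.
  by apply: Hd; rewrite -ball_normE.
(* The [k]-th vertex of the path from [x] to [x + h v] along the axes. *)
pose pth (h : R) (k : nat) : 'rV[R]_N :=
  \row_j (x ord0 j + if (j < k)%N then h * v ord0 j else 0).
have near_x (h : R) y : `|h| * vv < d ->
    (forall j, `|y ord0 j - x ord0 j| <= `|h| * `|v ord0 j|) -> `|x - y| < d.
  move=> hd Hy; apply: le_lt_trans hd; rewrite -normrN opprB.
  rewrite [leLHS]/Num.Def.normr /= mx_normrE; apply/bigmax_leP; split.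
    by rewrite mulr_ge0// ltW.
  move=> [i j] _ /=; rewrite ord1 !mxE (le_trans (Hy j))// ler_wpM2l//.
  rewrite /vv (bigD1 j)//= -addrA lerDl addr_ge0// sumr_ge0//.
have stepE (h : R) (k : 'I_N) : pth h k.+1 =
    (h * v ord0 k) *: delta_mx ord0 k + pth h k.
  apply/rowP => j; rewrite !mxE eqxx/= ltnS leq_eqVlt.
  have [->|jk] := eqVneq j k; first by rewrite ltnn eqxx /=; ring.
  by rewrite (negbTE (_ : j != k :> nat))//=; ring.
have main (h : R) : `|h| * vv < d -> forall k, (k <= N)%N ->
    `|u (pth h k) - u x - h * \sum_(i < N | (i < k)%N) v ord0 i * partial i u x|
      <= `|h| * \sum_(i < N | (i < k)%N) `|v ord0 i| * ee.
  move=> hd; elim=> [_|k IH kN].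
    rewrite !big_pred0// !mulr0 subr0 (_ : pth h 0 = x) ?subrr ?normr0//.
    by apply/rowP => j; rewrite mxE addr0.
  pose K := Ordinal kN.
  have inball (t : R) : 0 <= t <= 1 ->
      `|x - ((t * (h * v ord0 K)) *: delta_mx ord0 K + pth h k)| < d.
    move=> /andP[t0 t1]; apply: near_x hd _ => j; rewrite !mxE eqxx/=.
    have [->|jk] := eqVneq j K.
      rewrite /= ltnn mulr1 addr0 addrK normrM normrM ger0_norm//.
      by rewrite ler_piMl.
    rewrite mulr0 add0r addrC addKr.
    by case: ifP => _; rewrite ?normrM// normr0 mulr_ge0.
  have [|t tI Ht] := @partial_MVT u (pth h k) K (h * v ord0 K).
    by move=> t /inball /Hd/(_ K)[].
  have [_ Hc] := Hd _ (inball _ tI) K.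
  have splitS (F : 'I_N -> R) : \sum_(i < N | (i < k.+1)%N) F i =
      F K + \sum_(i < N | (i < k)%N) F i.
    rewrite (bigD1 K)//=; congr (_ + _); apply: eq_bigl => i.
    by rewrite ltnS ltn_neqAle andbC.
  rewrite !splitS.
  rewrite (_ : pth h k.+1 = (h * v ord0 K) *: delta_mx ord0 K + pth h k); last first.
    by rewrite -(stepE h K).
  set U1 := u (_ + _) in Ht *; set P := partial K u (_ + _) in Ht Hc.
  set S1 := \sum_(i < N | _) _; set S2 := \sum_(i < N | _) _.
  have -> : U1 - u x - h * (v ord0 K * partial K u x + S1) =
     (u (pth h k) - u x - h * S1) + - (h * v ord0 K * (partial K u x - P)).
    rewrite -[U1](subrK (u (pth h k))) Ht; ring.
  rewrite (le_trans (ler_normD _ _))// [leRHS]mulrDr addrC lerD//; last first.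
    by apply: IH; exact: ltnW.
  by rewrite normrN !normrM -mulrA !ler_wpM2l.
near=> h.
have h0 : h != 0 by near: h; exact: nbhs_dnbhs_neq.
have hd : `|h| * vv < d.
  rewrite -ltr_pdivlMr//; near: h; apply: nbhs_dnbhs.
  apply/nbhs_ballP; exists (d / vv); first by rewrite /= divr_gt0.
  by move=> s; rewrite /ball/= sub0r normrN.
have pN : pth h N = h *: v + x.
  by apply/rowP => j; rewrite !mxE ltn_ord addrC.
have := main h hd N (leqnn N).
have allN (F : 'I_N -> R) : \sum_(i < N | (i < N)%N) F i = \sum_(i < N) F i.
  by apply: eq_bigl => i; rewrite ltn_ord.
rewrite pN 2!allN -/S => H.
rewrite -(ler_pM2l (_ : 0 < `|h|)) ?normr_gt0// -normrM.
have -> : h * (S - h^-1 *: (u (h *: v + x) - u x)) =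
   - (u (h *: v + x) - u x - h * S).
  set A := u _ - u x; rewrite -[_ *: A]/(_ * A) mulrBr mulrA divff// mul1r.
  by rewrite [RHS]opprB.
rewrite normrN (le_trans H)// ler_wpM2l// -mulr_suml /ee.
rewrite mulrCA -[leRHS]mulr1 ler_wpM2l ?(ltW eps0)// ler_pdivrMr// mul1r /vv.
by rewrite ler_wpDr.
Unshelve. all: by end_near. Qed.

Lemma C2_on_is_derive (D : set 'rV[R]_N) u x v : open D -> C2_on D u -> D x ->
  is_derive x v u (\sum_(i < N) v ord0 i * partial i u x).
Proof.
move=> oD cu Dx; apply: is_derive_partials => i.
  by near=> y; have [|_ /(_ i)[]//] := cu y; near: y; exact: open_nbhs_nbhs.
by have [_ /(_ i)[]] := cu x Dx.
Unshelve. all: by end_near. Qed.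

Lemma C2_on_is_derive_partial (D : set 'rV[R]_N) u x v (i : 'I_N) :
  open D -> C2_on D u -> D x ->
  is_derive x v (partial i u)
    (\sum_(j < N) v ord0 j * partial j (partial i u) x).
Proof.
move=> oD cu Dx; apply: is_derive_partials => j.
  by near=> y; have [|_ _ /(_ i j)[]//] := cu y; near: y; exact: open_nbhs_nbhs.
by have [_ _ /(_ i j)[]] := cu x Dx.
Unshelve. all: by end_near. Qed.

(** All directions are needed, because reflections do not preserve the coordinate
    axes. *)
Lemma C2_on_jet2 (D : set 'rV[R]_N) u x v : open D -> C2_on D u -> D x ->
  jet2 (fun h : R => u (h *: v + x)) (\sum_(i < N) v ord0 i * partial i u x)
    (\sum_(i < N) v ord0 i *
      \sum_(j < N) v ord0 j * partial j (partial i u) x).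
Proof.
move=> oD cu Dx.
have DN : \forall h \near (0 : R), D (h *: v + x).
  apply: (@line_continuous R N x v 0 D); apply: open_nbhs_nbhs.
  by split=> //; rewrite scale0r add0r.
exists (fun h => \sum_(i < N) v ord0 i * partial i u (h *: v + x)); split.
- near=> h; have Dh : D (h *: v + x) by near: h.
  exact: (is_derive_line u x v h _).1 (C2_on_is_derive v oD cu Dh).
- by rewrite scale0r add0r.
- apply: is_derive_sumf => i; apply: is_derive_scalef.
  apply: (is_derive_line (partial i u) x v 0 _).1; rewrite scale0r add0r.
  exact: (C2_on_is_derive_partial v i oD cu Dx).
Unshelve. all: by end_near. Qed.

Lemma C2_on_lap_at (D : set 'rV[R]_N) u x : open D -> C2_on D u -> D x ->
  lap_at u x (fun i => partial i u x) (laplacian u x).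
Proof.
move=> oD cu Dx; exists (fun i => partial i (partial i u) x) => // i.
have Ei (F : 'I_N -> R) : \sum_(j < N) delta_mx ord0 i ord0 j * F j = F i.
  rewrite -[RHS](sum_pick F); apply: eq_bigr => j _.
  by rewrite mxE eqxx.
by apply: jet2_eq (C2_on_jet2 _ oD cu Dx) _ _; rewrite !Ei.
Qed.

(** For a unit vector [e], the reflection across the hyperplane through [z]
    orthogonal to [e]. *)
Definition reflection e z y : 'rV[R]_N := y - (2 * affine e z y) *: e.

Lemma reflection_line e z (h : R) y v :
  reflection e z (h *: v + y) = h *: reflection e 0 v + reflection e z y.
Proof.
apply/rowP => j; rewrite /reflection /affine !mxE.
under eq_bigr do rewrite !mxE.
set A := \sum_(i < N) _.
set B := \sum_(i < N) _ * (v _ _ - _).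
set C := \sum_(i < N) _ * (y _ _ - _).
have -> : A = h * B + C.
  rewrite /A /B /C mulr_sumr -big_split/=; apply: eq_bigr => i _.
  by rewrite mxE; ring.
ring.
Qed.

(** A reflection maps the coordinate axes to an orthonormal frame, and the
    trace of the Hessian can be computed in any such frame. *)
Lemma lap_at_reflection (D : set 'rV[R]_N) u e z x :
  open D -> C2_on D u -> D (reflection e z x) ->
  \sum_(i < N) e ord0 i ^+ 2 = 1 ->
  exists G, lap_at (fun y => u (reflection e z y)) x G
    (laplacian u (reflection e z x)).
Proof.
move=> oD cu Dx e1; set X := reflection e z x in Dx *.
pose v (i : 'I_N) := reflection e 0 (delta_mx ord0 i).
pose H i j := partial j (partial i u) X.
exists (fun i => \sum_(j < N) v i ord0 j * partial j u X).
exists (fun i => \sum_(j < N) v i ord0 j * \sum_(k < N) v i ord0 k * H j k).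
  move=> i; have := C2_on_jet2 (v i) oD cu Dx.
  by under [in X in _ -> X]eq_fun do rewrite reflection_line.
have vE i j : v i ord0 j = (i == j)%:R - 2 * e ord0 i * e ord0 j.
  rewrite /v /reflection /affine !mxE eqxx/=.
  rewrite (_ : \sum_(k < N) _ = e ord0 i) 1?eq_sym//.
  rewrite -[RHS](sum_pick (fun k => e ord0 k) i); apply: eq_bigr => k _.
  by rewrite !mxE eqxx/= subr0 mulrC.
have ortho j k : \sum_(i < N) v i ord0 j * v i ord0 k = (j == k)%:R.
  under eq_bigr => i _.
    rewrite !vE (_ : _ * _ = (i == j)%:R * (i == k)%:R -
      2 * e ord0 k * ((i == j)%:R * e ord0 i) -
      2 * e ord0 j * ((i == k)%:R * e ord0 i) +
      4 * e ord0 j * e ord0 k * e ord0 i ^+ 2); last by ring.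
    over.
  rewrite !big_split/= !sumrN -!mulr_sumr !sum_pick e1.
  ring.
transitivity (\sum_(j < N) \sum_(k < N) (j == k)%:R * H j k).
  apply: eq_bigr => j _; rewrite (eq_bigr (fun k => (k == j)%:R * H j k)).
    by rewrite sum_pick.
  by move=> k _; rewrite eq_sym.
under [RHS]eq_bigr => i _ do (under eq_bigr => j _ do rewrite mulr_sumr).
rewrite [RHS]exchange_big/=; apply: eq_bigr => j _.
rewrite [RHS]exchange_big/=; apply: eq_bigr => k _.
by rewrite -ortho mulr_suml; apply: eq_bigr => i _; rewrite mulrA.
Qed.

End Regularity.


(** * Euclidean geometry and the maximum principle *)

Section Euclidean.
Variables (R : realType) (N : nat).
Implicit Types (x y z e v : 'rV[R]_N).

Lemma sqdist_ge0 z x : 0 <= sqdist z x.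
Proof. by apply: sumr_ge0 => i _; exact: sqr_ge0. Qed.

Lemma enormE x z : enorm (x - z) = Num.sqrt (sqdist z x).
Proof.
by rewrite /enorm; congr Num.sqrt; apply: eq_bigr => i _; rewrite !mxE.
Qed.

Lemma enorm_sqdist x z : enorm (x - z) ^+ 2 = sqdist z x.
Proof. by rewrite enormE sqr_sqrtr// sqdist_ge0. Qed.

Lemma enorm_ge0 x : 0 <= enorm x.
Proof. exact: sqrtr_ge0. Qed.

Lemma coord_le_enorm x i : `|x ord0 i| <= enorm x.
Proof.
rewrite -sqrtr_sqr ler_sqrt; last by apply: sumr_ge0 => j _; exact: sqr_ge0.
by rewrite (bigD1 i)//= lerDl sumr_ge0// => j _; exact: sqr_ge0.
Qed.

Lemma enorm0 : enorm (0 : 'rV[R]_N) = 0.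
Proof. by rewrite /enorm big1 ?sqrtr0// => i _; rewrite mxE expr0n. Qed.

Lemma enorm_eq0 x : (enorm x == 0) = (x == 0).
Proof.
apply/eqP/eqP => [x0|->]; last exact: enorm0.
apply/rowP => i; rewrite mxE; apply/eqP; rewrite -normr_le0.
by rewrite -x0 coord_le_enorm.
Qed.

Lemma enorm_gt0 x : (0 < enorm x) = (x != 0).
Proof. by rewrite lt_neqAle enorm_ge0 andbT eq_sym enorm_eq0. Qed.

Lemma norm_le_enorm x : `|x| <= enorm x.
Proof.
rewrite [leLHS]/Num.Def.normr /= mx_normrE; apply/bigmax_leP.
split; first exact: enorm_ge0.
by move=> [i j] _ /=; rewrite ord1 coord_le_enorm.
Qed.

Lemma enormN x : enorm (- x) = enorm x.
Proof.
by rewrite /enorm; congr Num.sqrt; apply: eq_bigr => i _; rewrite mxE sqrrN.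
Qed.

Lemma enormZ (c : R) x : enorm (c *: x) = `|c| * enorm x.
Proof.
rewrite /enorm -sqrtr_sqr -sqrtrM ?sqr_ge0// mulr_sumr; congr Num.sqrt.
by apply: eq_bigr => i _; rewrite mxE exprMn.
Qed.

(** Lagrange's identity: the difference of the two sides is half a sum of
    squares. *)
Lemma cauchy_schwarz x y :
  (\sum_(i < N) x ord0 i * y ord0 i) ^+ 2 <=
  (\sum_(i < N) x ord0 i ^+ 2) * (\sum_(i < N) y ord0 i ^+ 2).
Proof.
set A := \sum_(i < N) x ord0 i ^+ 2; set C := \sum_(i < N) y ord0 i ^+ 2.
set B := \sum_(i < N) x ord0 i * y ord0 i.
have : 0 <= \sum_(i < N) \sum_(j < N)
    (x ord0 i * y ord0 j - x ord0 j * y ord0 i) ^+ 2.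
  by apply: sumr_ge0 => i _; apply: sumr_ge0 => j _; exact: sqr_ge0.
suff -> : \sum_(i < N) \sum_(j < N)
    (x ord0 i * y ord0 j - x ord0 j * y ord0 i) ^+ 2 = 2 * (A * C - B ^+ 2).
  by rewrite pmulr_rge0// subr_ge0.
have E i : \sum_(j < N) (x ord0 i * y ord0 j - x ord0 j * y ord0 i) ^+ 2 =
    x ord0 i ^+ 2 * C + y ord0 i ^+ 2 * A - 2 * (x ord0 i * y ord0 i) * B.
  rewrite /A /B /C !mulr_sumr -big_split/= -sumrB; apply: eq_bigr => j _; ring.
rewrite (eq_bigr _ (fun i _ => E i)) sumrB big_split/= -!mulr_suml -mulr_sumr.
rewrite -/A -/B -/C; ring.
Qed.

Lemma enorm_triangle x y : enorm (x + y) <= enorm x + enorm y.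
Proof.
rewrite -(@ler_pXn2r _ 2)// ?nnegrE ?addr_ge0 ?enorm_ge0//.
rewrite sqr_sqrtr; last by apply: sumr_ge0 => i _; exact: sqr_ge0.
have -> : \sum_(i < N) (x + y) ord0 i ^+ 2 = \sum_(i < N) x ord0 i ^+ 2 +
    2 * (\sum_(i < N) x ord0 i * y ord0 i) + \sum_(i < N) y ord0 i ^+ 2.
  rewrite mulr_sumr -!big_split/=; apply: eq_bigr => i _; rewrite mxE; ring.
rewrite sqrrD !sqr_sqrtr; try by apply: sumr_ge0 => i _; exact: sqr_ge0.
rewrite lerD2r lerD2l -[leRHS]mulr_natl ler_pM2l//.
apply: (le_trans (ler_norm _)).
rewrite -(@ler_pXn2r _ 2)// ?nnegrE ?mulr_ge0 ?enorm_ge0//.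
rewrite exprMn !sqr_sqrtr; try by apply: sumr_ge0 => i _; exact: sqr_ge0.
by rewrite real_normK ?num_real// cauchy_schwarz.
Qed.

Lemma coord_continuous1 (i : 'I_N) : continuous (fun x : 'rV[R]_N => x ord0 i).
Proof. exact: coord_continuous. Qed.

Lemma sum_continuous (T : topologicalType) n (F : 'I_n -> T -> R) (a : T) :
  (forall i, {for a, continuous (F i)}) ->
  {for a, continuous (fun t => \sum_(i < n) F i t)}.
Proof.
move=> cF; rewrite (_ : (fun _ => _) = \sum_(i < n) F i); last first.
  by apply/funext => t; rewrite fct_sumE.
elim/big_ind : _ => [|f g cf cg|i _]; last exact: cF.
  exact: (@cst_continuous T R 0).
exact: continuousD.
Qed.

Lemma coordB_continuous (i : 'I_N) (c : R) :
  continuous (fun x : 'rV[R]_N => x ord0 i - c).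
Proof.
move=> x; exact: (continuousB (@coord_continuous1 i x) (@cst_continuous _ _ c x)).
Qed.

Lemma sqdist_continuous z : continuous (sqdist z).
Proof.
move=> x; apply: sum_continuous => i.
rewrite (_ : (fun _ => _) =
  (fun y => (y ord0 i - z ord0 i) * (y ord0 i - z ord0 i))); last first.
  by apply/funext => y; rewrite expr2.
exact: (continuousM (@coordB_continuous i _ x) (@coordB_continuous i _ x)).
Qed.

Lemma affine_continuous e z : continuous (affine e z).
Proof.
move=> x; apply: sum_continuous => i.
exact: (continuousM (@cst_continuous _ _ _ x) (@coordB_continuous i _ x)).
Qed.

Lemma enormB_continuous z : continuous (fun x => enorm (x - z)).
Proof.
rewrite (_ : (fun _ => _) = Num.sqrt \o sqdist z); last first.
  by apply/funext => x; exact: enormE.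
by move=> x; apply: continuous_comp; [exact: sqdist_continuous|
  exact: sqrt_continuous].
Qed.

Lemma enorm_continuous : continuous (@enorm R N).
Proof.
rewrite (_ : @enorm R N = fun x => enorm (x - 0)).
  exact: enormB_continuous.
by apply/funext => x; rewrite subr0.
Qed.

Lemma reflection_continuous e z : continuous (reflection e z).
Proof.
move=> x; apply: (@continuousB _ _ _ id (fun y => (2 * affine e z y) *: e)).
  exact: cvg_id.
apply: (@continuousZr_tmp _ _ _ (fun y => 2 * affine e z y) e x).
exact: (continuousM (@cst_continuous _ _ _ x) (@affine_continuous e z x)).
Qed.

Lemma open_neq0 : open [set x : 'rV[R]_N | x != 0].
Proof.
rewrite (_ : [set x | _] = @enorm R N @^-1` [set t | 0 < t]).
  by apply: open_comp; [move=> x _; exact: enorm_continuous|exact: open_gt].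
by apply/seteqP; split=> x /=; rewrite enorm_gt0.
Qed.

(** The powers [0] and [2 - N] of the distance are harmonic; those in between are
    superharmonic, the other ones subharmonic.  All barriers are built from
    them. *)
Lemma lap_at_enormB (m : R) z x : x != z ->
  lap_at (fun y => enorm (y - z) `^ m) x
    (fun i => m * enorm (x - z) `^ (m - 2) * (x ord0 i - z ord0 i))
    (m * (m + N%:R - 2) * enorm (x - z) `^ (m - 2)).
Proof.
move=> xz.
have E y k : enorm (y - z) `^ k = sqdist z y `^ (k / 2).
  by rewrite enormE -powR12_sqrt ?sqdist_ge0// -powRrM mulrC.
have q0 : 0 < sqdist z x.
  by rewrite -enorm_sqdist exprn_gt0// enorm_gt0 subr_eq0.
rewrite (_ : (fun _ => _) = fun y => sqdist z y `^ (m / 2)); last first.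
  by apply/funext => y; exact: E.
have E2 : enorm (x - z) `^ (m - 2) = sqdist z x `^ (m / 2 - 1).
  by rewrite E; congr (_ `^ _); field.
rewrite E2; exact: lap_at_powR_sqdist.
Qed.

Lemma compact_enorm_bounded (K : set 'rV[R]_N) (M : R) :
  closed K -> (forall x, K x -> enorm x <= M) -> compact K.
Proof.
move=> cK bK; apply: bounded_closed_compact cK.
exists M; split; first exact: num_real.
move=> M' MM' x /bK xM; apply: le_trans (norm_le_enorm x) _.
exact: le_trans xM (ltW MM').
Qed.

(** The weak maximum principle.  Only the points where [w] is positive have to
    be interior, so that boundary values enter as non-strict inequalities; and
    asking for a strictly positive Laplacian there spares any perturbation
    argument, since the functions it is applied to satisfy this. *)
Lemma max_principle (K : set 'rV[R]_N) (w : 'rV[R]_N -> R) : compact K ->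
  (forall x, K x -> {for x, continuous w}) ->
  (forall x, K x -> 0 < w x ->
     nbhs x K /\ exists G L, lap_at w x G L /\ 0 < L) ->
  forall x, K x -> w x <= 0.
Proof.
move=> cK cw hw x Kx; rewrite leNgt; apply/negP => wx0.
have cwK : {within K, continuous w}.
  by apply: continuous_in_subspaceT => y; rewrite inE; exact: cw.
have [c cinK maxc] := compact_EVT_max (ex_intro _ x Kx) cK cwK.
rewrite inE in cinK.
have wc0 : 0 < w c by rewrite (lt_le_trans wx0)// maxc// inE.
have [nK [G [L [jL L0]]]] := hw c cinK wc0.
suff : L <= 0 by rewrite leNgt L0.
apply: lap_at_max jL _; near=> y; apply: maxc; rewrite inE; near: y.
exact: nK.
Unshelve. all: by end_near. Qed.

(** The domains on which functions get compared (balls, half balls, half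
    annuli, complements of two balls in a third one) are cut out by at most three
    continuous inequalities. *)
Lemma max_principle_ineq (c1 c2 c3 w : 'rV[R]_N -> R) (M : R) :
  continuous c1 -> continuous c2 -> continuous c3 ->
  (forall x, 0 <= c1 x -> 0 <= c2 x -> 0 <= c3 x ->
    [/\ enorm x <= M, {for x, continuous w} &
        c1 x = 0 \/ c2 x = 0 \/ c3 x = 0 -> w x <= 0]) ->
  (forall x, 0 < c1 x -> 0 < c2 x -> 0 < c3 x -> 0 < w x ->
    exists G L, lap_at w x G L /\ 0 < L) ->
  forall x, 0 <= c1 x -> 0 <= c2 x -> 0 <= c3 x -> w x <= 0.
Proof.
move=> cc1 cc2 cc3 hK hw x c1x c2x c3x.
pose K := [set y | 0 <= c1 y] `&` [set y | 0 <= c2 y] `&` [set y | 0 <= c3 y].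
have cl (c : 'rV[R]_N -> R) : continuous c -> closed [set y | 0 <= c y].
  by move=> cc; apply: (@closed_comp _ _ c [set t | 0 <= t]) => //;
    exact: closed_ge.
have op (c : 'rV[R]_N -> R) y : continuous c -> 0 < c y ->
    nbhs y [set y | 0 <= c y].
  move=> cc cy; apply: (cc y [set t | 0 <= t]).
  by apply: (filterS _ (lt_nbhsr cy)) => t; exact: ltW.
apply: (@max_principle K) => //.
- apply: (@compact_enorm_bounded _ M).
    by apply: closedI; [apply: closedI|]; exact: cl.
  by move=> y [[]] /= k1 k2 k3; have [] := hK _ k1 k2 k3.
- by move=> y [[]] /= k1 k2 k3; have [] := hK _ k1 k2 k3.
move=> y [[]] /= k1 k2 k3 wy; have [_ _ bd] := hK _ k1 k2 k3.
have p (c : 'rV[R]_N -> R) : 0 <= c y -> (c y = 0 -> w y <= 0) -> 0 < c y.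
  move=> cy cy0; rewrite lt_neqAle cy andbT; apply/eqP => /esym/cy0.
  by rewrite leNgt wy.
have p1 : 0 < c1 y by apply: p => // ?; apply: bd; left.
have p2 : 0 < c2 y by apply: p => // ?; apply: bd; right; left.
have p3 : 0 < c3 y by apply: p => // ?; apply: bd; right; right.
split; last exact: hw.
by apply: filterI; [apply: filterI|]; exact: op.
Qed.

Lemma max_principle_annulus (w : 'rV[R]_N -> R) (a b : R) :
  (forall x, a <= enorm x <= b -> {for x, continuous w}) ->
  (forall x, enorm x = a -> w x <= 0) -> (forall x, enorm x = b -> w x <= 0) ->
  (forall x, a < enorm x < b -> 0 < w x -> exists G L, lap_at w x G L /\ 0 < L) ->
  forall x, a <= enorm x <= b -> w x <= 0.
Proof.
move=> cw wa wb hw x /andP[ax xb].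
have c1 : continuous (fun y : 'rV[R]_N => enorm y - a).
  move=> y.
  exact: (continuousB (@enorm_continuous y) (@cst_continuous _ _ a y)).
have c2 : continuous (fun y : 'rV[R]_N => b - enorm y).
  move=> y.
  exact: (continuousB (@cst_continuous _ _ b y) (@enorm_continuous y)).
have c3 : continuous (fun _ : 'rV[R]_N => 1 : R) by exact: cst_continuous.
apply: (@max_principle_ineq _ _ (fun=> 1) _ b c1 c2 c3).
- move=> y; rewrite !subr_ge0 => ay yb _; split=> //; first by apply: cw; rewrite ay.
  move=> [|[|/eqP]]; last by rewrite oner_eq0.
    by move=> /eqP; rewrite subr_eq0 => /eqP/wa.
  by move=> /eqP; rewrite subr_eq0 => /eqP/esym/wb.
- by move=> y; rewrite !subr_gt0 => ay yb _ wy; apply: hw; rewrite ?ay.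
- by rewrite subr_ge0.
- by rewrite subr_ge0.
- exact: ler01.
Qed.

End Euclidean.


(** * Real powers and the weight *)

Section RealPowers.
Variable R : realType.
Implicit Types a b r s t x y : R.

Lemma ltr_powRN a b t : 0 < a -> a < b -> 0 < t -> b `^ (- t) < a `^ (- t).
Proof.
move=> a0 ab t0; rewrite !powRN ltf_pV2 ?posrE ?powR_gt0//; last exact: lt_trans ab.
by rewrite gt0_ltr_powR// ?nnegrE ltW// (lt_trans a0).
Qed.

Lemma ler_powRN a b t : 0 < a -> a <= b -> 0 < t -> b `^ (- t) <= a `^ (- t).
Proof.
rewrite le_eqVlt => a0 /predU1P[->//|ab] t0.
exact/ltW/ltr_powRN.
Qed.

Lemma powR_addr a r s : 0 < a -> a `^ (r + s) = a `^ r * a `^ s.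
Proof. by move=> a0; rewrite powRD// (gt_eqF a0) implybT. Qed.

Lemma powR_opp_mul a r : 0 < a -> a `^ (- r) * a `^ r = 1.
Proof. by move=> a0; rewrite powRN mulVf// gt_eqF// powR_gt0. Qed.

Lemma powR_sqr a : 0 <= a -> a `^ 2 = a ^+ 2.
Proof. by move=> a0; rewrite powR_mulrn. Qed.

Lemma powR_expR a r : 0 < a -> a `^ r = expR (r * ln a).
Proof. by move=> a0; rewrite /powR gt_eqF. Qed.

Lemma ln1D_gt0 r : 0 < r -> 0 < ln (1 + r).
Proof. by move=> r0; rewrite ln_gt0// ltrDl. Qed.

Lemma ln1D_ge r : 0 < r -> r / (1 + r) <= ln (1 + r).
Proof.
move=> r0; have r10 : 0 < 1 + r by rewrite addr_gt0.
rewrite -lerN2 -lnV ?posrE//.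
rewrite [X in ln X](_ : _ = 1 + - (r / (1 + r))); last first.
  by field; rewrite gt_eqF.
apply: le_ln1Dx; rewrite ltrN2 ltr_pdivrMr// mul1r.
by rewrite ltrDr.
Qed.

Definition weight (alpha beta r : R) : R := r `^ alpha * ln (1 + r) `^ beta.

Lemma weight_gt0 alpha beta r : 0 < r -> 0 < weight alpha beta r.
Proof. by move=> r0; rewrite mulr_gt0// powR_gt0// ln1D_gt0. Qed.

(** Within a factor two of the radius, the power varies by a factor [2 ^ |alpha|]
    at most, and the logarithm by a factor two, since [1 + 2 s <= (1 + s)^2]. *)
Lemma weight_doubling alpha beta r s : 0 < beta -> 0 < r -> r / 2 <= s <= 2 * r ->
  2 `^ (- (`|alpha| + beta)) * weight alpha beta r <= weight alpha beta s.
Proof.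
move=> b0 r0 /andP[rs sr].
have s0 : 0 < s by apply: lt_le_trans rs; rewrite divr_gt0.
rewrite opprD powR_addr// mulrACA.
apply: ler_pM; rewrite ?mulr_ge0 ?powR_ge0//.
  rewrite !powR_expR// -expRD ler_expR.
  rewrite -lerBrDr -mulrBr mulNr.
  have : `|alpha * (ln s - ln r)| <= `|alpha| * ln 2.
    rewrite normrM ler_wpM2l// ler_norml -ln_div ?posrE//.
    rewrite -lnV ?posrE// !ler_ln ?posrE ?divr_gt0 ?invr_gt0//.
    by rewrite ler_pdivrMr// ler_pdivlMr// sr mulrC rs.
  by rewrite ler_norml => /andP[].
have l1 : 0 < ln (1 + r) by exact: ln1D_gt0.
have <- : (2^-1 * ln (1 + r)) `^ beta = 2 `^ (- beta) * ln (1 + r) `^ beta.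
  rewrite powRM ?invr_ge0 ?(ltW l1)//; congr (_ * _).
  by rewrite -powR_inv1// -powRrM mulN1r.
apply: ge0_ler_powR; rewrite ?nnegrE ?(ltW b0)//.
- by rewrite mulr_ge0// ltW.
- by rewrite ltW// ln1D_gt0.
rewrite ler_pdivrMl// mulr_natl -lnXn ?addr_gt0//.
rewrite ler_ln ?posrE ?exprn_gt0 ?addr_gt0//.
rewrite sqrrD expr1n mul1r.
move: rs; rewrite ler_pdivrMr// => rs.
rewrite -addrA lerD2l mulr2n; have := sqr_ge0 s; lra.
Qed.

End RealPowers.

(** * First properties of solutions *)

Section Solutions.
Variables (R : realType) (N : nat) (alpha beta p : R).
Hypotheses (hN : (3 <= N)%N) (hbeta : 0 < beta) (hp : 0 < p).
Implicit Types (u v : 'rV[R]_N -> R) (x y z : 'rV[R]_N).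

Local Notation sol := (positive_solution alpha beta p).
Local Notation wt := (weight alpha beta).

Lemma dim_ge3 : 3 <= N%:R :> R.
Proof. by rewrite ler_nat. Qed.

Lemma solution_gt0 u x : sol u -> x != 0 -> 0 < u x.
Proof. by move=> [_ + _]; exact. Qed.

Lemma solution_continuous u x : sol u -> x != 0 -> {for x, continuous u}.
Proof. by move=> [cu _ _] x0; have [] := cu x x0. Qed.

Lemma solution_lap_at u x : sol u -> x != 0 ->
  exists G, lap_at u x G (- (wt (enorm x) * u x `^ (- p))).
Proof.
move=> [cu _ eu] x0; exists (fun i => partial i u x).
apply: lap_at_eq (C2_on_lap_at (@open_neq0 R N) cu x0) _ _ => //.
by rewrite /weight -eu// opprK.
Qed.

Lemma source_gt0 u x : sol u -> x != 0 -> 0 < wt (enorm x) * u x `^ (- p).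
Proof.
move=> su x0; rewrite mulr_gt0 ?weight_gt0 ?enorm_gt0//.
by rewrite powR_gt0// (solution_gt0 su).
Qed.

Definition slope_const : R := 8 * N%:R / 2 `^ (- (`|alpha| + beta)).

Lemma slope_const_gt0 : 0 < slope_const.
Proof.
rewrite divr_gt0 ?powR_gt0// mulr_gt0//.
by have := dim_ge3; lra.
Qed.

Lemma in_half_ball x y : enorm (y - x) <= enorm x / 2 ->
  enorm x / 2 <= enorm y <= 2 * enorm x.
Proof.
move=> yx; have := enorm_triangle (y - x) x; rewrite subrK => h1.
have := enorm_triangle (x - y) y; rewrite subrK -(enormN (x - y)) opprB => h2.
have h0 := enorm_ge0 x; apply/andP; split; lra.
Qed.

(** The source term cannot be large compared with [u / |x|^2]: where [u] is
    small, the equation makes it very concave, so that it dominates the bump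
    [L (1 - |y - x|^2 / rho^2)].  Thus [u] solves a linear inequality that is
    invariant under dilations, uniformly in [u]. *)
Lemma source_le u x : sol u -> x != 0 ->
  enorm x ^+ 2 * (wt (enorm x) * u x `^ (- p)) <= slope_const * u x.
Proof.
move=> su x0; set r := enorm x; have r0 : 0 < r by rewrite enorm_gt0.
pose rho := r / 2; have rho0 : 0 < rho by rewrite divr_gt0.
set c := 2 `^ (- (`|alpha| + beta)); have c0 : 0 < c by rewrite powR_gt0.
have p1 : 1 + p != 0 by rewrite gt_eqF// addr_gt0.
have N0 : 0 < N%:R :> R by have := dim_ge3; lra.
have w0 : 0 < wt r by exact: weight_gt0.
(* With [L^(1 + p) = A], the Laplacian of the bump is balanced by the source of
   a function that stays below [L]. *)
pose A := rho ^+ 2 * (c * wt r) / (2 * N%:R).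
have A0 : 0 < A.
  have h1 : 0 < c * wt r by exact: mulr_gt0.
  have h2 : 0 < rho ^+ 2 by exact: exprn_gt0.
  by rewrite /A; apply: divr_gt0 => //; exact: mulr_gt0.
pose L := A `^ (1 + p)^-1; have L0 : 0 < L by rewrite powR_gt0.
have LA : L `^ (1 + p) = A by rewrite -powRrM mulVf// powRr1// ltW.
have cr : c * wt r * L `^ (- p) = 2 * N%:R * L / rho ^+ 2.
  have -> : c * wt r = 2 * N%:R * A / rho ^+ 2.
    by rewrite /A; field; rewrite !gt_eqF.
  rewrite -LA powR_addr// powRr1 ?(ltW L0)//.
  have := powR_opp_mul p L0; set a := L `^ (- p); set b := L `^ p => ab.
  transitivity (2 * N%:R * L / rho ^+ 2 * (a * b)); last by rewrite ab mulr1.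
  by field; rewrite gt_eqF.
have Lu : L <= u x.
  pose w y := L - (L / rho ^+ 2 * sqdist x y + u y).
  have ball_y y : 0 <= rho ^+ 2 - sqdist x y -> enorm (y - x) <= enorm x / 2.
    rewrite subr_ge0 -enorm_sqdist ler_pXn2r ?nnegrE ?enorm_ge0//.
    exact: ltW.
  have yn0 y : 0 <= rho ^+ 2 - sqdist x y -> y != 0.
    move=> /ball_y/in_half_ball/andP[h _]; rewrite -enorm_gt0.
    by apply: lt_le_trans h.
  have cc (k : R) : continuous (fun _ : 'rV[R]_N => k).
    by exact: cst_continuous.
  have cq (k : R) : continuous (fun y : 'rV[R]_N => k * sqdist x y).
    move=> y; exact: (continuousM (cc k y) (@sqdist_continuous _ _ x y)).
  have cd : continuous (fun y : 'rV[R]_N => rho ^+ 2 - sqdist x y).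
    move=> y; exact: (continuousB (cc _ y) (@sqdist_continuous _ _ x y)).
  have := @max_principle_ineq _ _ _ (fun=> 1) (fun=> 1) w (2 * r) cd (cc 1)
    (cc 1) _ _ x.
  have sx0 : sqdist x x = 0.
    by rewrite /sqdist big1// => i _; rewrite subrr expr0n.
  rewrite /w sx0 mulr0 add0r subr0 subr_le0; apply.
  - move=> y hy _ _; split.
    + by have /andP[] := in_half_ball (ball_y y hy).
    + apply: (continuousB (cc _ y)); apply: continuousD (cq _ y) _.
      exact: (solution_continuous su (yn0 y hy)).
    + case=> [/eqP|]; last by case=> /eqP; rewrite oner_eq0.
      rewrite subr_eq0 => /eqP <-; rewrite divfK ?gt_eqF ?exprn_gt0//.
      by rewrite opprD addrA subrr sub0r oppr_le0 ltW// (solution_gt0 su)// yn0.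
  - move=> y hy _ _ wy.
    have y0 : y != 0 by apply: yn0; exact: ltW.
    have [G jG] := solution_lap_at su y0.
    eexists; eexists; split.
      apply: lap_at_sub (lap_at_cst _ _) (lap_at_add (lap_at_scale _ _) jG).
      exact: lap_at_sqdist.
    rewrite sub0r opprD opprK addrC subr_gt0.
    have uL : u y < L.
      move: wy; rewrite subr_gt0; apply: le_lt_trans.
      by rewrite lerDr mulr_ge0 ?sqdist_ge0// divr_ge0 ?exprn_ge0// ltW.
    have uy := solution_gt0 su y0.
    apply: (@le_lt_trans _ _ (c * wt r * L `^ (- p))).
      by rewrite cr le_eqVlt; apply/orP; left; apply/eqP; field; rewrite gt_eqF.
    apply: (@le_lt_trans _ _ (wt (enorm y) * L `^ (- p))).
      apply: ler_wpM2r; first exact: powR_ge0.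
      apply: (weight_doubling _ hbeta r0).
      by apply: in_half_ball; apply: ball_y; exact: ltW.
    by rewrite ltr_pM2l ?weight_gt0 ?enorm_gt0// ltr_powRN.
  - by rewrite exprn_ge0// ltW.
  - exact: ler01.
  - exact: ler01.
have ux := solution_gt0 su x0.
have uA : A <= u x * u x `^ p.
  have : L `^ (1 + p) <= u x `^ (1 + p).
    by apply: ge0_ler_powR => //; rewrite ?nnegrE ltW// addr_gt0.
  by rewrite LA powR_addr// powRr1// ltW.
have -> : r ^+ 2 * (wt r * u x `^ (- p)) = slope_const * (A * u x `^ (- p)).
  rewrite /A /slope_const -/c /rho; field; by rewrite !gt_eqF.
rewrite ler_pM2l ?slope_const_gt0//.
apply: (@le_trans _ _ (u x * u x `^ p * u x `^ (- p))).
  by rewrite ler_wpM2r// powR_ge0.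
by rewrite -mulrA [X in _ * X]mulrC powR_opp_mul// mulr1.
Qed.

End Solutions.


(** * Comparison across reflections and spreading of lower bounds *)

Section Harnack.
Variables (R : realType) (N : nat) (alpha beta p : R).
Hypotheses (hN : (3 <= N)%N) (hbeta : 0 < beta) (hp : 0 < p).
Implicit Types (u v : 'rV[R]_N -> R) (x y z e : 'rV[R]_N).

Local Notation sol := (positive_solution alpha beta p).
Local Notation wt := (weight alpha beta).
Local Notation k := (N%:R - 2 : R).

Lemma codim_gt0 : 0 < k.
Proof. by have := @dim_ge3 R N hN; lra. Qed.

Lemma le_of_eps (a b c : R) :
  0 <= c -> (forall t, 0 < t -> a <= b + t * c) -> a <= b.
Proof.
move=> c0 H; apply/ler_addgt0Pr => t t0.
have c1 : 0 < c + 1 by rewrite ltr_wpDl.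
apply: le_trans (H (t / (c + 1)) _) _; first by rewrite divr_gt0.
by rewrite lerD2l mulrAC ler_pdivrMr// ler_pM2l// lerDl.
Qed.

Lemma powR_large (q C : R) : 0 < q ->
  exists2 r0 : R, 0 < r0 & forall r, r0 <= r -> C <= r `^ q.
Proof.
move=> q0; pose D := Num.max C 1; have D0 : 0 < D by rewrite lt_max ltr01 orbT.
exists (D `^ q^-1); first by rewrite powR_gt0.
move=> r rr; apply: (@le_trans _ _ D); first by rewrite le_max lexx.
have -> : D = (D `^ q^-1) `^ q by rewrite -powRrM mulVf ?gt_eqF// powRr1// ltW.
apply: ge0_ler_powR; rewrite ?nnegrE ?powR_ge0// ?(ltW q0)//.
by apply: le_trans rr; rewrite powR_ge0.
Qed.

Lemma powR_small (q C : R) : 0 < q ->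
  exists2 d0 : R, 0 < d0 & forall d, 0 < d <= d0 -> C <= d `^ (- q).
Proof.
move=> q0; have [r0 r00 H] := powR_large C q0.
exists r0^-1; first by rewrite invr_gt0.
move=> d /andP[d0 dd]; apply: le_trans (H d^-1 _) _.
  by rewrite -[r0]invrK lef_pV2 ?posrE ?invr_gt0.
by rewrite -powR_inv1 ?(ltW d0)// -powRrM mulN1r.
Qed.

Lemma enormB_powR_continuous z (m : R) x : x != z ->
  {for x, continuous (fun y => enorm (y - z) `^ m)}.
Proof.
move=> xz; have x0 : 0 < enorm (x - z) by rewrite enorm_gt0 subr_eq0.
apply: (@continuous_comp _ _ _ (fun y => enorm (y - z)) (fun t => t `^ m)).
  exact: enormB_continuous.
exact: (is_derive_continuous (is_derive1_powR m x0)).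
Qed.

(** The fundamental solution is a lower barrier: a positive superharmonic
    function spreads a lower bound on a ball to the whole punctured space, the
    origin being negligible for bounded comparison functions. *)
Lemma spread_lower_bound u x1 (rho m : R) : sol u ->
  0 < rho -> rho < enorm x1 -> 0 <= m ->
  (forall y, enorm (y - x1) <= rho -> m <= u y) ->
  forall y, y != 0 -> rho <= enorm (y - x1) ->
  m * (rho `^ k * enorm (y - x1) `^ (- k)) <= u y.
Proof.
move=> su rho0 rx m0 mu y y0 ry; have k0 := codim_gt0.
apply: (@le_of_eps _ _ (1 + enorm y `^ (- k))).
  by rewrite addr_ge0// powR_ge0.
move=> t t0; set C := m * rho `^ k.
have [r0 r00 Hr] := powR_large (C / t) k0.
have [d0 d00 Hd] := powR_small (m / t) k0.
(* On the sphere of radius [r] around [x1] the constant [t] wins over the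
   barrier; on the sphere of radius [d] around the origin the term
   [t |y|^(- k)] does. *)
pose r := Num.max r0 (enorm (y - x1)).
pose d := Num.min d0 (enorm y).
have d_gt0 : 0 < d by rewrite lt_min d00 enorm_gt0.
pose w y := C * enorm (y - x1) `^ (- k) - (t * (1 + enorm (y - 0) `^ (- k)) + u y).
have cc (c : R) : continuous (fun _ : 'rV[R]_N => c) by exact: cst_continuous.
have c1 : continuous (fun y => enorm (y - x1) - rho).
  move=> z; exact: (continuousB (@enormB_continuous _ _ x1 z) (cc _ z)).
have c2 : continuous (fun y => r - enorm (y - x1)).
  move=> z; exact: (continuousB (cc _ z) (@enormB_continuous _ _ x1 z)).
have c3 : continuous (fun y : 'rV[R]_N => enorm y - d).
  move=> z; exact: (continuousB (@enorm_continuous _ _ z) (cc _ z)).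
have n1 z : 0 <= enorm (z - x1) - rho -> z != x1.
  rewrite subr_ge0 -subr_eq0 -enorm_gt0; exact: lt_le_trans.
have n0 z : 0 <= enorm z - d -> z != 0.
  rewrite subr_ge0 -enorm_gt0; exact: lt_le_trans.
have far z : rho <= enorm (z - x1) -> C * enorm (z - x1) `^ (- k) <= m.
  move=> rz; rewrite /C -mulrA -[leRHS]mulr1 ler_wpM2l//.
  rewrite -[leRHS](powR_opp_mul k rho0) mulrC ler_wpM2r ?powR_ge0//.
  exact: ler_powRN.
suff : w y <= 0 by rewrite /w subr_le0 subr0 /C -mulrA [leRHS]addrC.
apply: (@max_principle_ineq _ _ _ _ _ w (r + enorm x1) c1 c2 c3).
- move=> z h1 h2 h3; have z1 := n1 z h1; have z0 := n0 z h3.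
  have uz := solution_gt0 su z0.
  split.
  + have := enorm_triangle (z - x1) x1; rewrite subrK => H.
    by apply: le_trans H _; rewrite lerD2r -subr_ge0.
  + have e1 := continuousM (cc C z) (@enormB_powR_continuous x1 (- k) z z1).
    have e2 := continuousM (cc t z) (continuousD (cc 1 z)
      (@enormB_powR_continuous 0 (- k) z z0)).
    exact: (continuousB e1 (continuousD e2 (solution_continuous su z0))).
  + have P0 : 0 <= enorm (z - 0) `^ (- k) by rewrite powR_ge0.
    have tP0 := mulr_ge0 (ltW t0) P0.
    rewrite subr_le0 mulrDr mulr1; case=> [/eqP|[/eqP|/eqP]]; rewrite subr_eq0.
    * move=> /eqP zr; have := far z; rewrite zr => /(_ (lexx _)).
      have := mu z; rewrite zr => /(_ (lexx _)) h4 h5.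
      by rewrite (le_trans h5)// (le_trans h4)// lerDr addr_ge0// ltW.
    * move=> /eqP zr; have Ct : C * enorm (z - x1) `^ (- k) <= t.
        have z10 : 0 < enorm (z - x1) by rewrite enorm_gt0 subr_eq0.
        have rr : r0 <= enorm (z - x1) by rewrite -zr /r le_max lexx.
        have := Hr _ rr; rewrite ler_pdivrMr// => H.
        rewrite powRN ler_pdivrMr; first by rewrite mulrC.
        exact: powR_gt0.
      by rewrite (le_trans Ct)// -addrA lerDl addr_ge0// ltW.
    * move=> /eqP zd; have Hm : m <= t * enorm (z - 0) `^ (- k).
        have dd : 0 < d <= d0 by rewrite d_gt0 /d ge_min lexx.
        by have := Hd _ dd; rewrite ler_pdivrMr// subr0 zd mulrC.
      have h4 : C * enorm (z - x1) `^ (- k) <= m by apply: far; rewrite -subr_ge0.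
      by rewrite (le_trans h4)// (le_trans Hm)// addrAC lerDr addr_ge0// ltW.
- move=> z h1 h2 h3 _; have z1 := n1 z (ltW h1); have z0 := n0 z (ltW h3).
  have [G jG] := solution_lap_at su z0.
  have j1 := lap_at_scale C (lap_at_enormB (- k) z1).
  have j2 := lap_at_scale t (lap_at_add (lap_at_cst 1 z)
    (lap_at_enormB (- k) z0)).
  eexists; eexists; split; first exact: (lap_at_sub j1 (lap_at_add j2 jG)).
  have -> : - k * (- k + N%:R - 2) = 0 by ring.
  rewrite !mul0r !addr0 !mulr0 add0r sub0r opprK.
  exact: (source_gt0 su z0).
- by rewrite subr_ge0.
- by rewrite subr_ge0 le_max lexx orbT.
- by rewrite subr_ge0 ge_min lexx orbT.
Qed.

Lemma affine_le_enorm e z y : \sum_(i < N) e ord0 i ^+ 2 = 1 ->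
  affine e z y <= enorm (y - z).
Proof.
move=> e1; have := cauchy_schwarz e (y - z); rewrite e1 mul1r.
have -> : \sum_(i < N) (y - z) ord0 i ^+ 2 = enorm (y - z) ^+ 2.
  by rewrite sqr_sqrtr// sumr_ge0// => i _; exact: sqr_ge0.
have -> : \sum_(i < N) e ord0 i * (y - z) ord0 i = affine e z y.
  by apply: eq_bigr => i _; rewrite !mxE.
move=> H; apply: le_trans (ler_norm _) _.
by rewrite -(@ler_pXn2r _ 2)// ?nnegrE ?enorm_ge0// real_normK ?num_real.
Qed.

Lemma sqdist_reflection e z y : \sum_(i < N) e ord0 i ^+ 2 = 1 ->
  sqdist z (reflection e z y) = sqdist z y.
Proof.
move=> e1; set a := affine e z y.
have E i : (reflection e z y ord0 i - z ord0 i) ^+ 2 = (y ord0 i - z ord0 i) ^+ 2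
    - 4 * a * (e ord0 i * (y ord0 i - z ord0 i)) + 4 * a ^+ 2 * e ord0 i ^+ 2.
  by rewrite /reflection !mxE -/a; ring.
rewrite /sqdist (eq_bigr _ (fun i _ => E i)) big_split/= sumrB -!mulr_sumr e1.
by rewrite -/(affine e z y) -/a; ring.
Qed.

Lemma enorm_reflection e z y : \sum_(i < N) e ord0 i ^+ 2 = 1 ->
  enorm (reflection e z y - z) = enorm (y - z).
Proof. by move=> e1; rewrite !enormE sqdist_reflection. Qed.

(** The reflection across the perpendicular bisector of [x1] and [x]. *)
Lemma reflection_swap x1 x : x1 != x ->
  let e := (enorm (x1 - x))^-1 *: (x1 - x) in
  let z := 2^-1 *: (x1 + x) in
  [/\ \sum_(i < N) e ord0 i ^+ 2 = 1, reflection e z x1 = x &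
      affine e z x1 = enorm (x1 - x) / 2].
Proof.
move=> xx e z; set n := enorm (x1 - x).
have n0 : 0 < n by rewrite enorm_gt0 subr_eq0.
have nn : \sum_(i < N) (x1 ord0 i - x ord0 i) ^+ 2 = n ^+ 2.
  by rewrite /n enorm_sqdist.
have e1 : \sum_(i < N) e ord0 i ^+ 2 = 1.
  transitivity (\sum_(i < N) n ^- 2 * (x1 ord0 i - x ord0 i) ^+ 2).
    by apply: eq_bigr => i _; rewrite !mxE exprMn exprVn.
  by rewrite -mulr_sumr nn mulVf// expf_neq0// gt_eqF.
have a1 : affine e z x1 = n / 2.
  transitivity (\sum_(i < N) (n^-1 / 2) * (x1 ord0 i - x ord0 i) ^+ 2).
    by apply: eq_bigr => i _; rewrite /e /z !mxE -/n; field; rewrite gt_eqF.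
  by rewrite -mulr_sumr nn; field; rewrite gt_eqF.
split=> //; rewrite /reflection a1; apply/rowP => i; rewrite /e !mxE -/n.
by field; rewrite gt_eqF.
Qed.

(** Interior gradient bound by reflection: across the hyperplane that swaps
    [x1] and [x], the function [u - u \o sigma] vanishes on the hyperplane and is
    at most [M], so a quadratic barrier on the half ball makes it of the order
    of the distance to the hyperplane. *)
Lemma reflection_drop u x1 x (d M Gam : R) : sol u -> 0 < d -> 0 < Gam ->
  (forall y, enorm (y - x1) <= d / 2 -> [/\ y != 0, u y <= M &
     wt (enorm y) * u y `^ (- p) <= Gam * M / d ^+ 2]) ->
  enorm (x - x1) <= d / 4 ->
  u x1 - u x <= 2 * (N%:R + Gam) * M * enorm (x - x1) / d.
Proof.
move=> su d0 G0 hB xd; have N3 := @dim_ge3 R N hN.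
have [y0 uM1 _] : [/\ x1 != 0, u x1 <= M &
    wt (enorm x1) * u x1 `^ (- p) <= Gam * M / d ^+ 2].
  by apply: hB; rewrite subrr enorm0 divr_ge0// ltW.
have M0 : 0 < M by apply: lt_le_trans uM1; exact: (solution_gt0 su).
have [->|xx] := eqVneq x1 x; first by rewrite !subrr enorm0 mulr0 mul0r.
have := reflection_swap xx; set e := _ *: (x1 - x); set z := _ *: (x1 + x).
move=> /= [e1 sx ax].
pose rho := d / 4; have rho0 : 0 < rho by rewrite divr_gt0.
pose B := N%:R + Gam; have B0 : 0 < B by rewrite /B; lra.
(* On the half ball of radius [rho], [b] is nonnegative, at least [1] on the
   spherical part of the boundary, and its Laplacian is [- 2 Gam / rho^2], which
   outweighs the source. *)
pose tau y := affine e z y / rho.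
pose b y := sqdist z y / rho ^+ 2 + (B * tau y - B * (tau y * tau y)).
pose w y := u y - u (reflection e z y) - M * b y.
have zx : enorm (z - x1) = enorm (x - x1) / 2.
  rewrite (_ : z - x1 = 2^-1 *: (x - x1)) ?enormZ.
    by rewrite ger0_norm// mulrC.
  by apply/rowP => i; rewrite !mxE; field.
have inB y : enorm (y - z) <= rho -> enorm (y - x1) <= d / 2.
  move=> h; have := enorm_triangle (y - z) (z - x1).
  rewrite addrA subrK zx; move: h xd; rewrite /rho; lra.
have inBr y : enorm (y - z) <= rho -> enorm (reflection e z y - x1) <= d / 2.
  by move=> h; apply: inB; rewrite enorm_reflection.
have cc (c : R) : continuous (fun _ : 'rV[R]_N => c) by exact: cst_continuous.
have c1 : continuous (affine e z) by exact: affine_continuous.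
have c2 : continuous (fun y => rho - enorm (y - z)).
  move=> y; exact: (continuousB (cc _ y) (@enormB_continuous _ _ z y)).
have ctau : continuous tau.
  move=> y; exact: (continuousM (c1 y) (cc rho^-1 y)).
have cb : continuous b.
  move=> y; apply: (continuousD (continuousM (@sqdist_continuous _ _ z y)
    (cc _ y))).
  apply: (continuousB (continuousM (cc B y) (ctau y))).
  exact: (continuousM (cc B y) (continuousM (ctau y) (ctau y))).
have Ht y : 0 <= affine e z y -> enorm (y - z) <= rho -> 0 <= tau y <= 1.
  move=> h1 h2; rewrite divr_ge0 ?(ltW rho0)//= ler_pdivrMr// mul1r.
  by apply: le_trans h2; exact: affine_le_enorm.
have Hb y : 0 <= affine e z y -> enorm (y - z) <= rho ->
    0 <= B * tau y - B * (tau y * tau y).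
  move=> h1 h2; have /andP[t0 t1] := Ht y h1 h2.
  rewrite -mulrBr mulr_ge0 ?(ltW B0)//; nra.
have := @max_principle_ineq _ _ _ _ (fun=> 1) w (rho + enorm z) c1 c2 (cc 1)
  _ _ x1.
have wx1 : w x1 = u x1 - u x - M * b x1 by rewrite /w sx.
rewrite wx1 => H.
have {H} : u x1 - u x - M * b x1 <= 0.
  apply: H.
  - move=> y h1; rewrite subr_ge0 => h2 _; have [yn0 uyM _] := hB y (inB y h2).
    have [rn0 ryM _] := hB _ (inBr y h2).
    have ur := solution_gt0 su rn0; split.
    + have := enorm_triangle (y - z) z; rewrite subrK => H.
      by apply: le_trans H _; rewrite lerD2r.
    + have cr : {for y, continuous (fun y => u (reflection e z y))}.
        apply: (@continuous_comp _ _ _ (reflection e z) u).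
          exact: reflection_continuous.
        exact: (solution_continuous su rn0).
      have cu := solution_continuous su yn0.
      exact: (continuousB (continuousB cu cr) (continuousM (cc M y) (cb y))).
    + case=> [a0|[/eqP|/eqP]]; last by rewrite oner_eq0.
        rewrite /w /reflection a0 mulr0 scale0r subr0 subrr sub0r oppr_le0.
        rewrite mulr_ge0 ?(ltW M0)// /b /tau a0 !mul0r mulr0 !subr0 addr0.
        by rewrite divr_ge0 ?sqdist_ge0// exprn_ge0// ltW.
      rewrite subr_eq0 => /eqP yr.
      have b1 : 1 <= b y.
        rewrite /b -enorm_sqdist -yr divff ?expf_neq0 ?gt_eqF// lerDl.
        exact: Hb.
      rewrite /w; have : M <= M * b y by rewrite ler_peMr// ltW.
      lra.
  - move=> y h1; rewrite subr_gt0 => h2 _ _.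
    have [yn0 _ gy] := hB y (inB y (ltW h2)).
    have [rn0 _ _] := hB _ (inBr y (ltW h2)).
    have [G jG] := solution_lap_at su yn0.
    have [cu _ eu] := su.
    have [G' jG'] := lap_at_reflection (@open_neq0 R N) cu rn0 e1.
    have jt : lap_at tau y (fun i => rho^-1 * e ord0 i) 0.
      rewrite (_ : tau = fun y => rho^-1 * affine e z y); last first.
        by apply/funext => y'; rewrite /tau mulrC.
      rewrite -(mulr0 rho^-1).
      exact: lap_at_scale (lap_at_affine e z y).
    have jq : lap_at (fun y => sqdist z y / rho ^+ 2) y
        (fun i => rho ^- 2 * (2 * (y ord0 i - z ord0 i)))
        (rho ^- 2 * (2 * N%:R)).
      rewrite (_ : (fun y => _) = fun y => rho ^- 2 * sqdist z y); last first.
        by apply/funext => y'; rewrite mulrC.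
      exact: lap_at_scale (lap_at_sqdist z y).
    have jb := lap_at_add jq (lap_at_sub (lap_at_scale B jt)
      (lap_at_scale B (lap_at_mul jt jt))).
    eexists; eexists; split.
      exact: (lap_at_sub (lap_at_sub jG jG') (lap_at_scale M jb)).
    have -> : \sum_(i < N) rho^-1 * e ord0 i * (rho^-1 * e ord0 i) = rho ^- 2.
      transitivity (\sum_(i < N) rho ^- 2 * e ord0 i ^+ 2).
        by apply: eq_bigr => i _; field; rewrite gt_eqF.
      by rewrite -mulr_sumr e1 mulr1.
    have lr : laplacian u (reflection e z y) < 0.
      rewrite -oppr_gt0 eu// -/(wt _).
      exact: (source_gt0 su rn0).
    have E : Gam * M / d ^+ 2 = Gam * M / 16 * rho ^- 2.
      by rewrite /rho; field; rewrite gt_eqF.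
    rewrite E in gy.
    have r2 : 0 < rho ^- 2 by rewrite invr_gt0 exprn_gt0.
    have GM : 0 < Gam * M * rho ^- 2 by rewrite !mulr_gt0.
    set X := wt _ * _ in gy *; set Y := laplacian _ _ in lr *.
    set r2i := rho ^- 2 in gy GM *.
    match goal with |- is_true (0 < ?F) =>
      have -> : F = - X - Y + 2 * (Gam * M * r2i) by rewrite /B; ring end.
    move: gy GM; rewrite [Gam * M / 16 * _]mulrAC; lra.
  - by rewrite ax divr_ge0// enorm_ge0.
  - rewrite subr_ge0 -enormN opprB zx /rho.
    by have := enorm_ge0 (x - x1); lra.
  - exact: ler01.
rewrite subr_le0 => H; apply: le_trans H _.
have nE : enorm (x1 - x) = enorm (x - x1) by rewrite -enormN opprB.
rewrite /b /tau ax nE -enorm_sqdist.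
have -> : enorm (x1 - z) = enorm (x - x1) / 2 by rewrite -enormN opprB zx.
set n := enorm (x - x1) in xd *.
have -> : 2 * (N%:R + Gam) * M * n / d = M * (B * (n / 2 / rho)).
  by rewrite /rho /B; field; rewrite gt_eqF.
rewrite ler_pM2l// -expr2.
have -> : (n / 2) ^+ 2 / rho ^+ 2 = (n / 2 / rho) ^+ 2.
  by field; rewrite gt_eqF.
set s := n / 2 / rho; have := sqr_ge0 s.
have B1 : 1 <= B by rewrite /B; lra.
nra.
Qed.

End Harnack.


(** * The upper bound for solutions *)

Section UpperBound.
Variables (R : realType) (N : nat) (alpha beta p : R).
Hypotheses (hN : (3 <= N)%N) (hbeta : 0 < beta) (hp : 0 < p).
Implicit Types (u v : 'rV[R]_N -> R) (x y z e : 'rV[R]_N).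

Local Notation sol := (positive_solution alpha beta p).
Local Notation wt := (weight alpha beta).
Local Notation k := (N%:R - 2 : R).
Local Notation n := (N - 2)%N.

Lemma codimE : k = n%:R.
Proof. by rewrite natrB// (leq_trans _ hN). Qed.

Lemma powR_codim (a : R) : 0 <= a -> a `^ k = a ^+ n.
Proof. by move=> a0; rewrite codimE powR_mulrn. Qed.

Let B : R := N%:R + slope_const N alpha beta.
(* At distance [eps * d] the loss in [reflection_drop], applied with
   [M = 2 ^+ n * u x1], is at most [u x1 / 2]. *)
Let eps : R := (4 * B * 2 ^+ n)^-1.

(** On a ball around [x0], maximise [u] times the power [N - 2] of the distance
    to the boundary, say at [x1], at distance [d] from it.  This choice makes [u]
    comparable to [u x1] on a ball of radius [d / 2], hence bounded below by
    [u x1 / 2] on a smaller ball of radius [eps * d]. *)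
Lemma solution_peak u x0 : sol u -> x0 != 0 ->
  exists x1 d, [/\ 0 < d <= enorm x0 / 2, enorm (x1 - x0) <= enorm x0 / 2,
    u x0 * (enorm x0 / 2) ^+ n <= u x1 * d ^+ n &
    forall y, enorm (y - x1) <= eps * d -> u x1 / 2 <= u y].
Proof.
move=> su x00; set r := enorm x0; have r0 : 0 < r by rewrite enorm_gt0.
pose rho := r / 2; have rho0 : 0 < rho by rewrite divr_gt0.
have near0 y : enorm (y - x0) <= rho -> y != 0 /\ rho <= enorm y.
  move=> h; have /andP[h1 _] := in_half_ball h; split=> //.
  by rewrite -enorm_gt0; apply: lt_le_trans h1.
pose K : set 'rV[R]_N := [set y | enorm (y - x0) <= rho].
have cK : compact K.
  apply: (@compact_enorm_bounded _ _ _ (rho + enorm x0)).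
    apply: (@closed_comp _ _ (fun y => enorm (y - x0)) [set t | t <= rho]).
      by move=> y _; exact: enormB_continuous.
    exact: closed_le.
  move=> y yK; have := enorm_triangle (y - x0) x0; rewrite subrK => H.
  by apply: le_trans H _; rewrite lerD2r.
pose v y := u y * (rho - enorm (y - x0)) ^+ n.
have cv : {within K, continuous v}.
  apply: continuous_in_subspaceT => y; rewrite inE => yK.
  have [y0 _] := near0 y yK.
  have c1 : {for y, continuous (fun y => rho - enorm (y - x0))}.
    exact: (continuousB (@cst_continuous _ _ rho y)
      (@enormB_continuous _ _ x0 y)).
  have c2 : {for y, continuous (fun y => (rho - enorm (y - x0)) ^+ n)}.
    apply: (@continuous_comp _ _ _ (fun y => rho - enorm (y - x0))
      (fun t => t ^+ n)) => //.
    exact: exprn_continuous.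
  exact: (continuousM (solution_continuous su y0) c2).
have Kx0 : K x0 by rewrite /K /= subrr enorm0 ltW.
have [x1 /[!inE] Kx1 maxv] := compact_EVT_max (ex_intro _ x0 Kx0) cK cv.
have vx0 : v x0 = u x0 * rho ^+ n by rewrite /v subrr enorm0 subr0.
pose d := rho - enorm (x1 - x0).
have vx1 : u x0 * rho ^+ n <= u x1 * d ^+ n.
  by rewrite -vx0; apply: maxv; rewrite inE.
have d_ge0 : 0 <= d by rewrite subr_ge0.
have [x1n0 _] := near0 x1 Kx1.
have ux1 := solution_gt0 su x1n0.
have d0 : 0 < d.
  rewrite lt_neqAle d_ge0 andbT; apply/eqP => dE; move: vx1.
  rewrite -dE expr0n /= (_ : (n == 0)%N = false) ?mulr0; last first.
    by rewrite subn_eq0 leqNgt hN.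
  by rewrite leNgt mulr_gt0// ?exprn_gt0// (solution_gt0 su).
have drho : d <= rho by rewrite gerBl enorm_ge0.
exists x1, d; split=> //; first by rewrite d0.
have S0 := @slope_const_gt0 R N alpha beta hN.
have B0 : 0 < B by rewrite addr_gt0// ltr0n (leq_trans _ hN).
have B1 : 1 <= B.
  have := @dim_ge3 R N hN; move: S0; rewrite /B.
  by set s := slope_const _ _ _; lra.
have P1 : 1 <= 2 ^+ n :> R by rewrite exprn_ege1// ler1n.
have P0 : 0 < 2 ^+ n :> R by rewrite exprn_gt0.
have eps4 : eps <= 4^-1.
  rewrite /eps lef_pV2 ?posrE ?mulr_gt0// -[leLHS]mulr1 -mulrA ler_pM2l//.
  by rewrite mulr_ege1.
pose M := 2 ^+ n * u x1.
have hB y : enorm (y - x1) <= d / 2 -> [/\ y != 0, u y <= M &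
    wt (enorm y) * u y `^ (- p) <= slope_const N alpha beta * M / d ^+ 2].
  move=> yd; have yx0 : enorm (y - x0) <= rho - d / 2.
    have := enorm_triangle (y - x1) (x1 - x0); rewrite addrA subrK.
    move: yd; rewrite /d; set a := enorm _; set b := enorm _; set c := enorm _.
    lra.
  have yK : enorm (y - x0) <= rho.
    by apply: le_trans yx0 _; rewrite gerBl divr_ge0.
  have [y0 yrho] := near0 y yK.
  have uyM : u y <= M.
    have d2 : 0 < (d / 2) ^+ n by rewrite exprn_gt0// divr_gt0.
    rewrite -(ler_pM2r d2).
    have -> : M * (d / 2) ^+ n = u x1 * d ^+ n.
      rewrite /M expr_div_n; move: P0; set P := 2 ^+ n => P0.
      by set D := d ^+ n; field; rewrite gt_eqF.
    apply: (@le_trans _ _ (v y)); last by apply: maxv; rewrite inE.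
    rewrite /v ler_pM2l ?(solution_gt0 su)//.
    apply: lerXn2r; rewrite ?nnegrE ?divr_ge0//.
    - by rewrite subr_ge0.
    - by rewrite lerBrDr addrC -lerBrDr.
  split=> //.
  rewrite ler_pdivlMr ?exprn_gt0//.
  apply: (@le_trans _ _ (enorm y ^+ 2 * (wt (enorm y) * u y `^ (- p)))).
    rewrite mulrC ler_wpM2r//; first by rewrite ltW// (source_gt0 su).
    by rewrite lerXn2r ?nnegrE ?enorm_ge0// (le_trans drho).
  apply: le_trans (source_le hN hbeta hp su y0) _.
  by rewrite ler_pM2l.
move=> y yd.
have yd4 : enorm (y - x1) <= d / 4.
  by apply: le_trans yd _; rewrite mulrC ler_wpM2l.
have H := reflection_drop hN su d0 S0 hB yd4.
suff : u x1 - u y <= u x1 / 2.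
  by set a := u x1; set b := u y; lra.
apply: le_trans H _.
rewrite -/B ler_pdivrMr//.
apply: (@le_trans _ _ (2 * B * M * (eps * d))).
  by rewrite ler_pM2l// !mulr_gt0// exprn_gt0.
rewrite /eps /M le_eqVlt; apply/orP; left; apply/eqP.
by field; rewrite !gt_eqF.
Qed.

(** The lower bound around the peak spreads like the fundamental solution, hence
    with the power [N - 2] of its radius.  This is the power of [d] that the peak
    maximises, so that [d] cancels out and any two values of [u] can be
    compared. *)
Lemma solution_le u x0 y0 : sol u -> x0 != 0 -> y0 != 0 ->
  u x0 * (eps * enorm x0 / 2) ^+ n <= 2 * u y0 * (enorm y0 + 2 * enorm x0) ^+ n.
Proof.
move=> su x00 y00; have [x1 [d [/andP[d0 dr] x10 H Hlow]]] := solution_peak su x00.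
set r := enorm x0 in dr x10 H *; have r0 : 0 < r by rewrite enorm_gt0.
have uy0 := solution_gt0 su y00.
have /andP[x1r x1r2] := in_half_ball x10; rewrite -/r in x1r x1r2.
have x1n0 : x1 != 0 by rewrite -enorm_gt0; apply: lt_le_trans x1r; rewrite divr_gt0.
have ux1 := solution_gt0 su x1n0.
have S0 := @slope_const_gt0 R N alpha beta hN.
have N3 := @dim_ge3 R N hN.
have B4 : 1 < 4 * B by move: S0; rewrite /B; set s := slope_const _ _ _; lra.
have eps0 : 0 < eps.
  by rewrite invr_gt0 mulr_gt0 ?exprn_gt0//; move: B4; set b := B; lra.
have eps1 : eps < 1.
  have P1 : 1 <= 2 ^+ n :> R by rewrite exprn_ege1// ler1n.
  have H1 : 1 < 4 * B * 2 ^+ n.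
    by rewrite (lt_le_trans B4)// ler_peMr// ltW// (lt_trans _ B4).
  by rewrite /eps invf_lt1// (lt_trans _ H1).
set D := enorm y0 + 2 * r.
have D0 : 0 < D by rewrite addr_gt0 ?enorm_gt0// mulr_gt0.
have epsd : eps * d < enorm x1.
  apply: lt_le_trans x1r; apply: lt_le_trans dr.
  by rewrite gtr_pMl.
have key : u x1 / 2 * (eps * d) ^+ n <= u y0 * D ^+ n.
  have [yn|/ltW yn] := lerP (enorm (y0 - x1)) (eps * d).
    apply: ler_pM; rewrite ?divr_ge0 ?exprn_ge0 ?(ltW ux1) ?mulr_ge0 ?(ltW eps0) ?(ltW d0)//.
      exact: Hlow.
    apply: lerXn2r; rewrite ?nnegrE ?mulr_ge0 ?(ltW eps0) ?(ltW d0) ?(ltW D0)//.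
    apply: le_trans (ltW epsd) _; apply: le_trans x1r2 _.
    by rewrite lerDr enorm_ge0.
  have ed0 : 0 < eps * d by rewrite mulr_gt0.
  have := spread_lower_bound hN su ed0 epsd _ Hlow y00 yn.
  move=> /(_ (ltW (divr_gt0 ux1 (ltr0Sn _ 1)))).
  set m := enorm (y0 - x1) in yn *; have m0 : 0 < m by apply: lt_le_trans yn.
  rewrite powRN !powR_codim ?(ltW ed0) ?(ltW m0)// mulrA ler_pdivrMr ?exprn_gt0//.
  move=> h; apply: le_trans h _; rewrite ler_pM2l//.
  apply: lerXn2r; rewrite ?nnegrE ?(ltW m0) ?(ltW D0)//.
  rewrite /m /D; have := enorm_triangle y0 (- x1); rewrite enormN => h.
  by apply: le_trans h _; rewrite lerD2l.
have -> : (eps * r / 2) ^+ n = eps ^+ n * (r / 2) ^+ n.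
  by rewrite -mulrA exprMn.
rewrite mulrCA.
apply: (@le_trans _ _ (eps ^+ n * (u x1 * d ^+ n))).
  by rewrite ler_pM2l// exprn_gt0.
rewrite mulrCA -exprMn -mulrA -ler_pdivrMl// mulrA.
by rewrite [2^-1 * _]mulrC.
Qed.

Lemma solution_bounded u : sol u -> exists2 C, 0 < C &
  forall x, x != 0 -> u x <= C * (1 + enorm x `^ (- k)).
Proof.
move=> su.
have N0 : (0 < N)%N by rewrite (leq_trans _ hN).
pose y0 : 'rV[R]_N := delta_mx ord0 (Ordinal N0).
have y00 : y0 != 0.
  apply/eqP => /rowP/(_ (Ordinal N0)); rewrite !mxE !eqxx => /eqP.
  by rewrite oner_eq0.
have uy0 := solution_gt0 su y00.
set a := enorm y0; have a0 : 0 < a by rewrite enorm_gt0.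
have S0 := @slope_const_gt0 R N alpha beta hN.
have N3 := @dim_ge3 R N hN.
have eps0 : 0 < eps.
  rewrite invr_gt0 mulr_gt0 ?exprn_gt0//.
  by move: S0; rewrite /B; set s := slope_const _ _ _; lra.
pose b := a + 2; have b0 : 0 < b by rewrite addr_gt0.
pose q := (b / (eps / 2)) ^+ n.
have q0 : 0 < q by rewrite exprn_gt0// !divr_gt0.
exists (2 * u y0 * q); first by rewrite !mulr_gt0.
move=> x x0; set r := enorm x; have r0 : 0 < r by rewrite enorm_gt0.
have e2 : 0 < eps / 2 by rewrite divr_gt0.
have H := solution_le su x0 y00; rewrite -/r -/a mulrAC exprMn mulrA in H.
have {}H : u x <= 2 * u y0 * ((a + 2 * r) ^+ n / (eps / 2) ^+ n / r ^+ n).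
  rewrite mulrA ler_pdivlMr ?exprn_gt0// mulrA ler_pdivlMr ?exprn_gt0//.
  by rewrite mulrAC.
apply: le_trans H _; rewrite -[leRHS]mulrA ler_pM2l ?mulr_gt0//.
rewrite powRN powR_codim ?(ltW r0)// /q [(b / _) ^+ n]expr_div_n.
rewrite [leLHS]mulrAC [leRHS]mulrAC ler_pM2r ?invr_gt0 ?exprn_gt0//.
have [r1|r1] := lerP r 1.
  apply: (@le_trans _ _ (b ^+ n / r ^+ n)).
    rewrite ler_pM2r ?invr_gt0 ?exprn_gt0//.
    apply: lerXn2r; rewrite ?nnegrE ?(ltW b0) ?addr_ge0 ?mulr_ge0 ?(ltW a0) ?(ltW r0)//.
    by rewrite lerD2l -[leRHS]mulr1 ler_pM2l.
  by rewrite ler_wpM2l ?exprn_ge0 ?(ltW b0)// lerDr.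
apply: (@le_trans _ _ (b ^+ n)).
  rewrite ler_pdivrMr ?exprn_gt0// -exprMn.
  apply: lerXn2r; rewrite ?nnegrE ?mulr_ge0 ?addr_ge0 ?mulr_ge0 ?(ltW b0) ?(ltW a0) ?(ltW r0)//.
  rewrite /b [leRHS]mulrDl lerD2r ler_peMr ?(ltW a0)//.
  exact: ltW.
by rewrite ler_peMr ?exprn_ge0 ?(ltW b0)// lerDl invr_ge0 exprn_ge0// ltW.
Qed.

End UpperBound.


(** * Radial symmetry *)

Section RadialSymmetry.
Variables (R : realType) (N : nat) (alpha beta p : R).
Hypotheses (hN : (3 <= N)%N) (hbeta : 0 < beta) (hp : 0 < p).
Implicit Types (u v : 'rV[R]_N -> R) (x y z e : 'rV[R]_N).

Local Notation sol := (positive_solution alpha beta p).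
Local Notation wt := (weight alpha beta).
Local Notation k := (N%:R - 2 : R).

(** The perpendicular bisector of two points of a sphere around the origin passes
    through the origin. *)
Lemma reflection_swap0 x1 x : x1 != x -> enorm x1 = enorm x ->
  let e := (enorm (x1 - x))^-1 *: (x1 - x) in
  [/\ \sum_(i < N) e ord0 i ^+ 2 = 1, reflection e 0 x1 = x &
      0 <= affine e 0 x1].
Proof.
move=> xx nx e; have [] := reflection_swap xx; rewrite -/e.
set z := 2^-1 *: (x1 + x) => e1 rx ax.
have E : affine e 0 x1 = affine e z x1.
  apply/eqP; rewrite -subr_eq0 /affine -sumrB; apply/eqP.
  transitivity ((enorm (x1 - x))^-1 / 2 * (enorm (x1 - 0) ^+ 2 - enorm (x - 0) ^+ 2)).
    rewrite !enorm_sqdist /sqdist -sumrB mulr_sumr; apply: eq_bigr => i _.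
    by rewrite /e /z !mxE; set q := enorm _; ring.
  by rewrite !subr0 nx subrr mulr0.
split=> //; first by rewrite /reflection E.
by rewrite E ax divr_ge0// enorm_ge0.
Qed.

Let wedge e (q : R) y :=
  enorm (y - 0) `^ q + (3 * (affine e 0 y * enorm (y - 0) `^ (q - 1)) -
  affine e 0 y * affine e 0 y * enorm (y - 0) `^ (q - 2)).

Let wedge_continuous e q y : y != 0 -> {for y, continuous (wedge e q)}.
Proof.
move=> y0; have cp m := @enormB_powR_continuous _ _ 0 m y y0.
have ca := @affine_continuous _ _ e 0 y.
have c3 := @cst_continuous 'rV[R]_N R 3 y.
exact: (continuousD (cp q) (continuousB (continuousM c3 (continuousM ca
  (cp (q - 1)))) (continuousM (continuousM ca ca) (cp (q - 2))))).
Qed.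

Let affine_ratio e y : \sum_(i < N) e ord0 i ^+ 2 = 1 -> y != 0 ->
  0 <= affine e 0 y -> 0 <= affine e 0 y / enorm (y - 0) <= 1.
Proof.
move=> e1 y0 a0; have r0 : 0 < enorm (y - 0) by rewrite subr0 enorm_gt0.
by rewrite divr_ge0 ?(ltW r0)// ler_pdivrMr// mul1r affine_le_enorm.
Qed.

Let wedgeE e q y : y != 0 -> wedge e q y = enorm (y - 0) `^ q *
  (1 + 3 * (affine e 0 y / enorm (y - 0)) - (affine e 0 y / enorm (y - 0)) ^+ 2).
Proof.
move=> y0; have r0 : 0 < enorm (y - 0) by rewrite subr0 enorm_gt0.
rewrite /wedge !powR_addr// powR_inv1 ?(ltW r0)//.
rewrite powRN powR_sqr ?(ltW r0)//; set r := enorm _ in r0 *.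
by set s := affine _ _ _; set P := r `^ q; field; rewrite gt_eqF.
Qed.

Let wedge_ge e q y : \sum_(i < N) e ord0 i ^+ 2 = 1 -> y != 0 ->
  0 <= affine e 0 y -> enorm y `^ q <= wedge e q y.
Proof.
move=> e1 y0 a0; rewrite wedgeE// subr0 ler_peMr ?powR_ge0//.
have := affine_ratio e1 y0 a0; rewrite subr0.
by set s := affine _ _ _ / _ => /andP[s0 s1]; nra.
Qed.

(** [|y|^q (1 + 3 s - s^2)], where [s] is the cosine of the angle with [e], is
    superharmonic in the half space [s >= 0] even for exponents [q] slightly above
    [0] or slightly below [2 - N].  There it dominates bounded functions at
    infinity and multiples of [|y|^(2 - N)] at the origin. *)
Let wedge_superharmonic e q y : \sum_(i < N) e ord0 i ^+ 2 = 1 -> y != 0 ->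
  0 <= affine e 0 y -> q * (q + k) <= 2^-1 ->
  exists G L, lap_at (wedge e q) y G L /\ L < 0.
Proof.
move=> e1 y0 a0 qk; have r0 : 0 < enorm (y - 0) by rewrite subr0 enorm_gt0.
have jp m := @lap_at_enormB R N m 0 y y0.
have ja := lap_at_affine e 0 y.
eexists; eexists; split.
  exact: (lap_at_add (jp q) (lap_at_sub (lap_at_scale 3 (lap_at_mul ja
    (jp (q - 1)))) (lap_at_mul (lap_at_mul ja ja) (jp (q - 2))))).
have Ea (c : R) : \sum_(i < N) e ord0 i * (c * (y ord0 i - (0 : 'rV[R]_N) ord0 i))
    = c * affine e 0 y.
  by rewrite mulr_sumr; apply: eq_bigr => i _; ring.
have Ee (c : R) : \sum_(i < N) (e ord0 i * affine e 0 y +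
    affine e 0 y * e ord0 i) *
    (c * (y ord0 i - (0 : 'rV[R]_N) ord0 i)) =
    c * 2 * affine e 0 y * affine e 0 y.
  rewrite [X in _ * X]/affine mulr_sumr; apply: eq_bigr => i _.
  by set a := affine _ _ _; ring.
have E1 : \sum_(i < N) e ord0 i * e ord0 i = 1.
  by rewrite -[RHS]e1; apply: eq_bigr => i _; rewrite expr2.
rewrite Ea Ee E1.
have P1 : enorm (y - 0) `^ (q - 1 - 2) = enorm (y - 0) `^ (q - 2) / enorm (y - 0).
  by rewrite addrAC powR_addr// powR_inv1// ltW.
have P2 : enorm (y - 0) `^ (q - 2 - 2) = enorm (y - 0) `^ (q - 2) / enorm (y - 0) ^+ 2.
  by rewrite [LHS]powR_addr// powRN powR_sqr// ltW.
rewrite P1 P2.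
have := affine_ratio e1 y0 a0.
set s := affine e 0 y / _; set r := enorm (y - 0) in r0 s *.
set P := r `^ (q - 2).
have -> : affine e 0 y = s * r by rewrite /s divfK// gt_eqF.
move=> /andP[s0 s1].
match goal with |- is_true (?F < 0) =>
  have -> : F = P * (q * (q + k) * (1 + 3 * s - s ^+ 2) - 3 * s * (1 + k) - 2 +
    s ^+ 2 * (4 + 2 * k)) by field; rewrite gt_eqF end.
rewrite pmulr_rlt0 ?powR_gt0//.
have k1 : 1 <= k by have := @dim_ge3 R N hN; move: (N%:R : R) => n; lra.
have s2 : s ^+ 2 <= s by rewrite expr2 ler_piMr.
have H1 : q * (q + k) * (1 + 3 * s - s ^+ 2) <= 2^-1 * 3.
  have /andP[T0 T3] : 0 <= 1 + 3 * s - s ^+ 2 <= 3.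
    apply/andP; split; first by move: s2 s0; set T := s ^+ 2; lra.
    rewrite -subr_ge0 (_ : _ - _ = (1 - s) * (2 - s)); last by ring.
    by rewrite mulr_ge0// subr_ge0// (le_trans s1)// ler1n.
  apply: (@le_trans _ _ (2^-1 * (1 + 3 * s - s ^+ 2))); first by rewrite ler_wpM2r.
  by rewrite ler_wpM2l.
have H2 : s ^+ 2 * (4 + 2 * k) <= 3 * s * (1 + k).
  apply: (@le_trans _ _ (s * (4 + 2 * k))).
    by rewrite ler_wpM2r// addr_ge0// mulr_ge0// (le_trans _ k1).
  rewrite [leRHS]mulrAC [leRHS]mulrC ler_wpM2l//.
  by move: k1; set kk := k; lra.
move: H1 H2; set X := _ * (1 + 3 * s - _); set Y := s ^+ 2 * _.
by set Z := 3 * s * _; lra.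
Qed.

(** Across a hyperplane through the origin the equation is preserved, and by
    monotonicity of the nonlinearity the positive part of [u - u \o sigma] is
    subharmonic.  It vanishes on the hyperplane and grows too slowly at both
    ends not to vanish identically. *)
Theorem solution_radial u : sol u -> radially_symmetric u.
Proof.
move=> su.
suff H x y : x != 0 -> y != 0 -> enorm x = enorm y -> u x <= u y.
  by move=> x y x0 y0 xy; apply/le_anti; rewrite !H.
move=> x0 y0 xy; have [->//|xny] := eqVneq x y.
have := reflection_swap0 xny xy; set e := _ *: _ => /= -[e1 rx ax].
have k0 := @codim_gt0 R N hN.
have N3 := @dim_ge3 R N hN.
(* [q (q + k)] takes the same value at [q = dl] and at [q = - k - dl]. *)
pose dl : R := (2 * N%:R)^-1.
have dl0 : 0 < dl by rewrite invr_gt0 mulr_gt0// (lt_le_trans _ N3).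
have dlk : dl * (dl + k) <= 2^-1.
  have h : dl * (2 * N%:R) = 1 by rewrite mulVf// mulf_neq0// gt_eqF// (lt_le_trans _ N3).
  have : dl <= 1 by rewrite invf_le1 ?mulr_gt0// ?(lt_le_trans _ N3)//; move: N3; lra.
  by move: N3 dl0 h; move: (N%:R : R) dl => n dd; nra.
have q2 : (- k - dl) * (- k - dl + k) <= 2^-1.
  by rewrite (_ : _ * _ = dl * (dl + k))//; ring.
have [C C0 uC] := solution_bounded hN hbeta hp su.
pose bar y := wedge e dl y + wedge e (- k - dl) y.
apply: (@le_of_eps _ _ _ (bar x)).
  by rewrite addr_ge0// (le_trans _ (wedge_ge _ e1 x0 ax))// powR_ge0.
move=> t t0.
have [r0 r00 Hr] := powR_large (2 * C / t) dl0.
have [d0 d00 Hd] := powR_small (2 * C / t) dl0.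
pose r := Num.max 1 (Num.max r0 (enorm x)).
pose d := Num.min 1 (Num.min d0 (enorm x)).
have d_gt0 : 0 < d by rewrite !lt_min ltr01 d00 enorm_gt0.
pose w y := u y - u (reflection e 0 y) - t * bar y.
suff : w x <= 0 by rewrite /w rx subr_le0 lerBlDl.
have cc (c : R) : continuous (fun _ : 'rV[R]_N => c) by exact: cst_continuous.
have c1 : continuous (affine e 0) by exact: affine_continuous.
have c2 : continuous (fun y : 'rV[R]_N => enorm y - d).
  move=> z; exact: (continuousB (@enorm_continuous _ _ z) (cc _ z)).
have c3 : continuous (fun y : 'rV[R]_N => r - enorm y).
  move=> z; exact: (continuousB (cc _ z) (@enorm_continuous _ _ z)).
have n0 z : 0 <= enorm z - d -> z != 0.
  rewrite subr_ge0 -enorm_gt0; exact: lt_le_trans.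
have nr z : enorm (reflection e 0 z) = enorm z.
  by have := enorm_reflection 0 z e1; rewrite !subr0.
have rn0 z : z != 0 -> reflection e 0 z != 0 by rewrite -!enorm_gt0 nr.
have bar1 z : z != 0 -> 0 <= affine e 0 z -> enorm z `^ dl <= bar z.
  move=> z0 az; apply: le_trans (wedge_ge _ e1 z0 az) _.
  by rewrite lerDl (le_trans _ (wedge_ge _ e1 z0 az))// powR_ge0.
have bar2 z : z != 0 -> 0 <= affine e 0 z -> enorm z `^ (- k - dl) <= bar z.
  move=> z0 az; apply: le_trans (wedge_ge _ e1 z0 az) _.
  by rewrite lerDr (le_trans _ (wedge_ge _ e1 z0 az))// powR_ge0.
apply: (@max_principle_ineq _ _ _ _ _ w r c1 c2 c3) => //.
- move=> z h1 h2 h3; have z0 := n0 z h2; have uz := solution_gt0 su (rn0 z z0).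
  have rz : 0 < enorm z by rewrite enorm_gt0.
  split; first by rewrite -subr_ge0.
  + have cr : {for z, continuous (fun y => u (reflection e 0 y))}.
      apply: (@continuous_comp _ _ _ (reflection e 0) u).
        exact: reflection_continuous.
      exact: (solution_continuous su (rn0 z z0)).
    have cb : {for z, continuous bar}.
      exact: (continuousD (@wedge_continuous e dl z z0)
        (@wedge_continuous e (- k - dl) z z0)).
    exact: (continuousB (continuousB (solution_continuous su z0) cr)
      (continuousM (cc t z) cb)).
  + have bz0 : 0 <= t * bar z.
      rewrite mulr_ge0 ?(ltW t0)//.
      by apply: le_trans (bar1 z z0 h1); rewrite powR_ge0.
    have uuC := uC z z0.
    have enough : C * (1 + enorm z `^ (- k)) <= t * bar z -> w z <= 0.
      move=> h; rewrite /w lerBlDr add0r lerBlDr.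
      by rewrite (le_trans uuC)// (le_trans h)// lerDl ltW.
    case=> [a0|[/eqP|/eqP]].
    * by rewrite /w /reflection a0 mulr0 scale0r subr0 subrr sub0r oppr_le0.
    * rewrite subr_eq0 => /eqP zd; apply: enough.
      have dd : 0 < d <= d0 by rewrite d_gt0 /d ge_min ge_min lexx/= orbT.
      have := Hd _ dd; rewrite ler_pdivrMr// => H.
      apply: (@le_trans _ _ (2 * C * enorm z `^ (- k))).
        have T1 : 1 <= enorm z `^ (- k).
          rewrite zd -[leLHS](powRr0 d) ger_powR ?oppr_le0 ?(ltW k0)//.
          by rewrite d_gt0 /d ge_min lexx.
        set T := enorm z `^ _ in T1 *.
        have -> : 2 * C * T = C * (T + T) by ring.
        by rewrite ler_pM2l// lerD2r.
      apply: (@le_trans _ _ (t * enorm z `^ (- k - dl))); last first.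
        by rewrite ler_pM2l// bar2.
      rewrite powR_addr// mulrCA [leLHS]mulrC ler_pM2l ?powR_gt0//.
      by rewrite zd [leRHS]mulrC.
    * rewrite subr_eq0 => /eqP zr; apply: enough.
      have rr : r0 <= enorm z by rewrite -zr /r le_max le_max lexx/= orbT.
      have := Hr _ rr; rewrite ler_pdivrMr// => H.
      apply: (@le_trans _ _ (2 * C)).
        have T1 : enorm z `^ (- k) <= 1.
          rewrite -[leRHS](powRr0 (enorm z)) ler_powR// ?oppr_le0 ?(ltW k0)//.
          by rewrite -zr /r le_max lexx.
        have -> : 2 * C = C * (1 + 1) by ring.
        by rewrite ler_pM2l// lerD2l.
      apply: le_trans H _; rewrite mulrC ler_pM2l//.
      exact: bar1.
- move=> z h1 h2 h3 wz; have z0 := n0 z (ltW h2).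
  have [G jG] := solution_lap_at su z0.
  have [cu _ eu] := su.
  have [G' jG'] := lap_at_reflection (@open_neq0 R N) cu (rn0 z z0) e1.
  have [G1 [L1 [j1 L10]]] := wedge_superharmonic e1 z0 (ltW h1) dlk.
  have [G2 [L2 [j2 L20]]] := wedge_superharmonic e1 z0 (ltW h1) q2.
  eexists; eexists; split.
    exact: (lap_at_sub (lap_at_sub jG jG') (lap_at_scale t (lap_at_add j1 j2))).
  have L12 : 0 < - (t * (L1 + L2)).
    by rewrite oppr_gt0 pmulr_rlt0// -(addr0 0) ltrD.
  have EY : - laplacian u (reflection e 0 z) =
      wt (enorm z) * u (reflection e 0 z) `^ (- p) by rewrite (eu _ (rn0 z z0)) nr.
  rewrite ltr_wpDl// EY addrC subr_ge0.
  rewrite ler_pM2l ?weight_gt0 ?enorm_gt0//.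
  apply: ler_powRN => //; first exact: (solution_gt0 su (rn0 z z0)).
  rewrite -subr_ge0; apply: (@le_trans _ _ (w z)); first exact: ltW.
  rewrite /w gerBl mulr_ge0 ?(ltW t0)//.
  by apply: le_trans (bar1 z z0 (ltW h1)); rewrite powR_ge0.
- by rewrite subr_ge0 !ge_min lexx !orbT.
- by rewrite subr_ge0 !le_max lexx !orbT.
Qed.

End RadialSymmetry.


(** * Barriers, asymptotics and necessary conditions *)

Section RadialSolutions.
Variables (R : realType) (N : nat) (alpha beta p : R).
Hypotheses (hN : (3 <= N)%N) (hbeta : 0 < beta) (hp : 0 < p).
Implicit Types (u v : 'rV[R]_N -> R) (x y z e : 'rV[R]_N).

Local Notation sol := (positive_solution alpha beta p).
Local Notation wt := (weight alpha beta).
Local Notation k := (N%:R - 2 : R).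

Let enorm_neq0 x (a : R) : 0 < a -> a <= enorm x -> x != 0.
Proof. by move=> a0 ax; rewrite -enorm_gt0 (lt_le_trans a0). Qed.

(** The source is decreasing in the unknown, so where [u > v] the difference is
    strictly subharmonic. *)
Lemma solution_compare u v : sol u -> sol v ->
  (forall t : R, 0 < t -> exists d r : R, 0 < d /\
    forall y, y != 0 -> enorm y <= d \/ r <= enorm y ->
      u y - v y <= t * (1 + enorm y `^ (- k))) ->
  forall x, x != 0 -> u x <= v x.
Proof.
move=> su sv H x x0.
apply: (@le_of_eps _ _ _ (1 + enorm x `^ (- k))).
  by rewrite addr_ge0// powR_ge0.
move=> t t0; have [d [r [d0 Hdr]]] := H t t0.
have rx0 : 0 < enorm x by rewrite enorm_gt0.
pose a := Num.min d (enorm x); pose b := Num.max r (enorm x).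
have a0 : 0 < a by rewrite lt_min d0.
pose w y := u y - v y - t * (1 + enorm (y - 0) `^ (- k)).
suff : w x <= 0 by rewrite /w subr0 subr_le0 lerBlDl.
have ne y : a <= enorm y -> y != 0 by exact: enorm_neq0.
apply: (@max_principle_annulus _ _ w a b).
- move=> y /andP[ay _]; have y0 := ne y ay.
  have c1 := continuousB (solution_continuous su y0) (solution_continuous sv y0).
  have c2 := continuousD (@cst_continuous 'rV[R]_N R 1 y)
    (@enormB_powR_continuous _ _ 0 (- k) y y0).
  exact: (continuousB c1 (continuousM (@cst_continuous 'rV[R]_N R t y) c2)).
- move=> y ya; rewrite /w subr_le0 subr0; apply: Hdr.
    by apply: ne; rewrite ya.
  by left; rewrite ya /a ge_min lexx.
- move=> y yb; rewrite /w subr_le0 subr0; apply: Hdr.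
    by rewrite -enorm_gt0 yb (lt_le_trans rx0)// /b le_max lexx orbT.
  by right; rewrite yb /b le_max lexx.
- move=> y /andP[/ltW ay _] wy; have y0 := ne y ay.
  have [G jG] := solution_lap_at su y0; have [G' jG'] := solution_lap_at sv y0.
  have j1 := lap_at_scale t (lap_at_add (lap_at_cst 1 y)
    (lap_at_enormB (- k) y0)).
  eexists; eexists; split; first exact: (lap_at_sub (lap_at_sub jG jG') j1).
  have -> : - k * (- k + N%:R - 2) = 0 by ring.
  rewrite mul0r addr0 mulr0 subr0 opprK addrC subr_gt0.
  rewrite ltr_pM2l ?weight_gt0 ?enorm_gt0//.
  apply: ltr_powRN => //; first exact: (solution_gt0 sv y0).
  rewrite -subr_gt0; apply: (lt_le_trans wy); rewrite /w gerBl.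
  by rewrite mulr_ge0 ?(ltW t0)// addr_ge0// powR_ge0.
- by rewrite /a /b ge_min le_max !lexx !orbT.
Qed.

(** Comparison on an annulus with a combination of powers.  The exponents [l] and
    [j] are harmonic, so that the source only has to outweigh the Laplacian of the
    term in [A]. *)
Lemma power_barrier u (A B t m l j a b : R) : sol u -> 0 < a ->
  l * (l + k) = 0 -> j * (j + k) = 0 ->
  (forall y, enorm y = a \/ enorm y = b ->
     A * enorm y `^ m + B * enorm y `^ l <= t * enorm y `^ j + u y) ->
  (forall y, y != 0 -> enorm y < b ->
     0 < A * (m * (m + k) * enorm y `^ (m - 2)) + wt (enorm y) * u y `^ (- p)) ->
  forall x, a <= enorm x <= b ->
  A * enorm x `^ m + B * enorm x `^ l <= t * enorm x `^ j + u x.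
Proof.
move=> su a0 ll jj bd sub x axb.
pose w y := A * enorm (y - 0) `^ m + B * enorm (y - 0) `^ l -
  (t * enorm (y - 0) `^ j + u y).
suff : w x <= 0 by rewrite /w subr0 subr_le0.
have ne y : a <= enorm y -> y != 0 by exact: enorm_neq0.
apply: (@max_principle_annulus _ _ w a b) => //.
- move=> y /andP[ay _]; have y0 := ne y ay.
  have cp (c q : R) := continuousM (@cst_continuous 'rV[R]_N R c y)
    (@enormB_powR_continuous _ _ 0 q y y0).
  exact: (continuousB (continuousD (cp A m) (cp B l))
    (continuousD (cp t j) (solution_continuous su y0))).
- by move=> y ya; rewrite /w subr_le0 subr0; apply: bd; left.
- by move=> y yb; rewrite /w subr_le0 subr0; apply: bd; right.
move=> y /andP[/ltW ay yb] wy; have y0 := ne y ay.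
have [G jG] := solution_lap_at su y0.
have jp c q := lap_at_scale c (@lap_at_enormB R N q 0 y y0).
eexists; eexists; split.
  exact: (lap_at_sub (lap_at_add (jp A m) (jp B l)) (lap_at_add (jp t j) jG)).
have E (q : R) : q + N%:R - 2 = q + k by rewrite addrA.
rewrite !E ll jj !mul0r !mulr0 addr0 add0r opprK subr0.
exact: sub.
Qed.

(** A barrier less singular than the fundamental solution ignores the origin: the
    error [t |x|^(2 - N)], harmonic, absorbs it on small spheres. *)
Lemma inner_barrier u (A B m l r0 : R) : sol u -> l * (l + k) = 0 -> 0 < r0 ->
  (forall t : R, 0 < t -> exists2 d0 : R, 0 < d0 & forall d, 0 < d <= d0 ->
     A * d `^ m + B * d `^ l <= t * d `^ (- k)) ->
  (forall y, enorm y = r0 -> A * r0 `^ m + B * r0 `^ l <= u y) ->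
  (forall y, y != 0 -> enorm y < r0 ->
     0 < A * (m * (m + k) * enorm y `^ (m - 2)) + wt (enorm y) * u y `^ (- p)) ->
  forall x, x != 0 -> enorm x <= r0 ->
  A * enorm x `^ m + B * enorm x `^ l <= u x.
Proof.
move=> su ll r00 small bd sub x x0 xr.
apply: (@le_of_eps _ _ _ (enorm x `^ (- k))); first exact: powR_ge0.
move=> t t0; have [d0 d00 Hd] := small t t0.
have rx0 : 0 < enorm x by rewrite enorm_gt0.
pose a := Num.min d0 (enorm x).
have a0 : 0 < a by rewrite lt_min d00.
rewrite [leRHS]addrC; apply: (@power_barrier u _ _ _ m l (- k) a r0) => //.
- by ring.
- move=> y [ya|yb].
    rewrite ya; apply: le_trans (Hd a _) _.
      by rewrite a0 /a ge_min lexx.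
    by rewrite lerDl ltW// (solution_gt0 su)// (enorm_neq0 a0)// ya.
  rewrite yb; apply: le_trans (bd y yb) _.
  by rewrite lerDr mulr_ge0 ?powR_ge0// ltW.
- by rewrite xr andbT /a ge_min lexx orbT.
Qed.

(** The same at infinity, where constants play the role of the error term. *)
Lemma outer_barrier u (A B m l r0 : R) : sol u -> l * (l + k) = 0 -> 0 < r0 ->
  (forall t : R, 0 < t -> exists r1 : R, forall r, r1 <= r -> 0 < r ->
     A * r `^ m + B * r `^ l <= t) ->
  (forall y, enorm y = r0 -> A * r0 `^ m + B * r0 `^ l <= u y) ->
  (forall y, r0 <= enorm y ->
     0 < A * (m * (m + k) * enorm y `^ (m - 2)) + wt (enorm y) * u y `^ (- p)) ->
  forall x, r0 <= enorm x ->
  A * enorm x `^ m + B * enorm x `^ l <= u x.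
Proof.
move=> su ll r00 small bd sub x xr.
apply: (@le_of_eps _ _ _ 1) => // t t0; have [r1 Hr] := small t t0.
pose b := Num.max r1 (enorm x).
have b0 : 0 < b by rewrite (lt_le_trans r00)// (le_trans xr)// /b le_max lexx orbT.
pose w y := A * enorm (y - 0) `^ m + B * enorm (y - 0) `^ l - (t * 1 + u y).
suff : w x <= 0 by rewrite /w subr0 subr_le0 [leRHS]addrC.
have ne y : r0 <= enorm y -> y != 0 by exact: enorm_neq0.
apply: (@max_principle_annulus _ _ w r0 b) => //.
- move=> y /andP[ay _]; have y0 := ne y ay.
  have cp (c q : R) := continuousM (@cst_continuous 'rV[R]_N R c y)
    (@enormB_powR_continuous _ _ 0 q y y0).
  exact: (continuousB (continuousD (cp A m) (cp B l))
    (continuousD (@cst_continuous 'rV[R]_N R (t * 1) y)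
      (solution_continuous su y0))).
- move=> y ya; rewrite /w subr_le0 subr0 ya; apply: le_trans (bd y ya) _.
  by rewrite lerDr mulr1 ltW.
- move=> y yb; rewrite /w subr_le0 subr0 yb.
  apply: le_trans (Hr b _ b0) _; first by rewrite /b le_max lexx.
  by rewrite mulr1 lerDl ltW// (solution_gt0 su)// -enorm_gt0 yb.
- move=> y /andP[/ltW ay _] _; have y0 := ne y ay.
  have [G jG] := solution_lap_at su y0.
  have jp c q := lap_at_scale c (@lap_at_enormB R N q 0 y y0).
  eexists; eexists; split.
    exact: (lap_at_sub (lap_at_add (jp A m) (jp B l))
      (lap_at_add (lap_at_cst (t * 1) y) jG)).
  have E (q : R) : q + N%:R - 2 = q + k by rewrite addrA.
  by rewrite !E ll !mul0r !mulr0 addr0 add0r opprK subr0; exact: sub.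
- by rewrite xr /b le_max lexx orbT.
Qed.

(** Minimum principle in a punctured ball, on the boundary of which a solution is
    constant by symmetry. *)
Lemma solution_nonincreasing u x y : sol u -> x != 0 ->
  enorm x <= enorm y -> u y <= u x.
Proof.
move=> su x0 xy; have rx0 : 0 < enorm x by rewrite enorm_gt0.
have y0 : y != 0 by exact: enorm_neq0 xy.
have ry0 : 0 < enorm y by rewrite enorm_gt0.
suff : u y * enorm x `^ 0 + 0 * enorm x `^ 0 <= u x.
  by rewrite mul0r addr0 powRr0 mulr1.
apply: (@inner_barrier u (u y) 0 0 0 (enorm y)) => //.
- by rewrite mul0r.
- move=> t t0; have [d0 d00 Hd] := powR_small (u y / t) (@codim_gt0 R N hN).
  exists d0 => // d /Hd; rewrite ler_pdivrMr// !powRr0 mulr1 mul0r addr0.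
  by rewrite mulrC.
- move=> z zy; rewrite !powRr0 mulr1 mul0r addr0.
  by rewrite (solution_radial hN hbeta hp su (x := z) (y := y))// -enorm_gt0 zy.
- by move=> z z0 _; rewrite !mul0r mulr0 add0r (source_gt0 su z0).
Qed.

(** Minimum principle outside a ball, against a multiple of the fundamental
    solution.  Up to inversion, [|x|^(N - 2) u] is the Kelvin transform of [u]. *)
Lemma solution_kelvin_nondecreasing u x y : sol u -> x != 0 ->
  enorm x <= enorm y -> enorm x `^ k * u x <= enorm y `^ k * u y.
Proof.
move=> su x0 xy; have rx0 : 0 < enorm x by rewrite enorm_gt0.
have k0 := @codim_gt0 R N hN.
have y0 : y != 0 by exact: enorm_neq0 xy.
have ry0 : 0 < enorm y by rewrite enorm_gt0.
have ux := solution_gt0 su x0.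
suff : enorm x `^ k * u x * enorm y `^ (- k) + 0 * enorm y `^ 0 <= u y.
  by rewrite mul0r addr0 powRN ler_pdivrMr ?powR_gt0// [X in _ <= X]mulrC.
apply: (@outer_barrier u (enorm x `^ k * u x) 0 (- k) 0 (enorm x)) => //.
- by rewrite mul0r.
- move=> t t0; have [r1 _ Hr] := powR_large (enorm x `^ k * u x / t) k0.
  exists r1 => r /Hr + r0; rewrite ler_pdivrMr// mul0r addr0 => H.
  by rewrite powRN ler_pdivrMr ?powR_gt0// [leRHS]mulrC.
- move=> z zx; rewrite mul0r addr0 mulrC mulrA powR_opp_mul// mul1r.
  by rewrite (solution_radial hN hbeta hp su (x := z) (y := x))// -enorm_gt0 zx.
- move=> z xz; rewrite addNr mulr0 mul0r mulr0 add0r.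
  exact: (source_gt0 su (enorm_neq0 rx0 xz)).
Qed.

(** The two parameters of a solution: the coefficient of its singularity at the
    origin, and its limit at infinity. *)
Definition asymptotics u (a b : R) : Prop :=
  (forall t : R, 0 < t -> exists2 d : R, 0 < d &
     forall x, x != 0 -> enorm x <= d -> `|enorm x `^ k * u x - a| <= t) /\
  (forall t : R, 0 < t -> exists r : R,
     forall x, x != 0 -> r <= enorm x -> `|u x - b| <= t).

Let inf_approach (f : 'rV[R]_N -> R) (t : R) :
  (exists x : 'rV[R]_N, x != 0) -> (forall x, x != 0 -> 0 < f x) -> 0 < t ->
  let c := inf (f @` [set x | x != 0]) in
  [/\ 0 <= c, forall x, x != 0 -> c <= f x & exists2 x, x != 0 & f x <= c + t].
Proof.
move=> [x0 hx0] fpos t0 c.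
have hlb : lbound (f @` [set x | x != 0]) 0.
  by move=> _ [x xn <-]; exact/ltW/fpos.
have hne : (f @` [set x | x != 0]) !=set0 by exists (f x0), x0.
have hi : has_inf (f @` [set x | x != 0]) by split=> //; exists 0.
split.
- by apply: lb_le_inf.
- by move=> x xn; apply: (ge_inf (ex_intro _ 0 hlb)); exists x.
- have [_ [x xn <-] fx] := inf_adherent t0 hi.
  by exists x => //; exact: ltW.
Qed.

Lemma exists_neq0 : exists x : 'rV[R]_N, x != 0.
Proof.
have N0 : (0 < N)%N by rewrite (leq_trans _ hN).
exists (delta_mx ord0 (Ordinal N0)).
apply/eqP => /rowP/(_ (Ordinal N0)); rewrite !mxE !eqxx => /eqP.
by rewrite oner_eq0.
Qed.

Lemma exists_enorm (r : R) : 0 < r -> exists x : 'rV[R]_N, enorm x = r.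
Proof.
move=> r0; have [z z0] := exists_neq0; exists ((r / enorm z) *: z).
rewrite enormZ ger0_norm ?divr_ge0 ?enorm_ge0 ?(ltW r0)//.
by rewrite divfK// enorm_eq0.
Qed.

(** By monotonicity the two limits are infima. *)
Lemma solution_asymptotics u : sol u ->
  exists a b, [/\ 0 <= a, 0 <= b & asymptotics u a b].
Proof.
move=> su; have upos x : x != 0 -> 0 < u x := solution_gt0 su.
have kpos x : x != 0 -> 0 < enorm x `^ k * u x.
  by move=> x0; rewrite mulr_gt0 ?upos// powR_gt0// enorm_gt0.
have Ha t := @inf_approach (fun x => enorm x `^ k * u x) t exists_neq0 kpos.
have Hb t := @inf_approach u t exists_neq0 upos.
exists (inf ((fun x => enorm x `^ k * u x) @` [set x | x != 0])).
exists (inf (u @` [set x | x != 0])).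
split; first by have [] := Ha 1 ltr01.
  by have [] := Hb 1 ltr01.
split=> t t0.
  have [_ lea [x x0 xt]] := Ha t t0.
  exists (enorm x); first by rewrite enorm_gt0.
  move=> y y0 yx; have h1 := lea y y0.
  rewrite ger0_norm ?subr_ge0// lerBlDl (le_trans _ xt)//.
  exact: solution_kelvin_nondecreasing.
have [_ leb [x x0 xt]] := Hb t t0.
exists (enorm x) => y y0 xy; have h1 := leb y y0.
rewrite ger0_norm ?subr_ge0// lerBlDl (le_trans _ xt)//.
exact: solution_nonincreasing.
Qed.

(** The parameters determine [u - v] at both ends up to [t (1 + |x|^(2 - N))],
    the error that [solution_compare] tolerates. *)
Lemma asymptotics_le u v (a b a' b' : R) : sol u -> sol v ->
  asymptotics u a b -> asymptotics v a' b' -> a <= a' -> b <= b' ->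
  forall x, x != 0 -> u x <= v x.
Proof.
move=> su sv [ua ub] [va vb] aa bb; apply: solution_compare => // t t0.
have t2 : 0 < t / 2 by rewrite divr_gt0.
have [d1 d10 H1] := ua _ t2; have [d2 d20 H2] := va _ t2.
have [r1 H3] := ub _ t2; have [r2 H4] := vb _ t2.
exists (Num.min d1 d2), (Num.max r1 r2); split; first by rewrite lt_min d10.
move=> y y0 [|]; rewrite ?le_min ?ge_max => /andP[h1 h2].
  have ry0 : 0 < enorm y by rewrite enorm_gt0.
  have K0 : 0 < enorm y `^ k by rewrite powR_gt0.
  have := H1 y y0 h1; have := H2 y y0 h2; rewrite !ler_norml.
  move=> /andP[h3 _] /andP[_ h4].
  apply: (@le_trans _ _ (t * enorm y `^ (- k))); last first.
    by rewrite ler_pM2l// lerDr.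
  rewrite powRN ler_pdivlMr// mulrC mulrBr; move: h3 h4 aa.
  set X := _ * u y; set Y := _ * v y; lra.
have := H3 y y0 h1; have := H4 y y0 h2; rewrite !ler_norml.
move=> /andP[h3 _] /andP[_ h4].
apply: (@le_trans _ _ t); last by rewrite ler_peMr ?(ltW t0)// lerDl powR_ge0.
by move: h3 h4 bb; lra.
Qed.

Lemma weight_ge_near0 (r : R) : 0 < r <= 1 ->
  2 `^ (- beta) * r `^ (alpha + beta) <= wt r.
Proof.
move=> /andP[r0 r1]; rewrite /weight powR_addr// mulrCA ler_pM2l ?powR_gt0//.
have -> : 2 `^ (- beta) * r `^ beta = (r / 2) `^ beta.
  rewrite powRM ?invr_ge0 ?(ltW r0)// [RHS]mulrC; congr (_ * _).
  by rewrite -powR_inv1// -powRrM mulN1r.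
apply: ge0_ler_powR; rewrite ?nnegrE ?(ltW hbeta)// ?divr_ge0 ?(ltW r0)//.
  by rewrite ltW// ln1D_gt0.
apply: (@le_trans _ _ (r / (1 + r))).
  by rewrite ler_pM2l// lef_pV2 ?posrE ?addr_gt0// -[leRHS]/(1 + 1) lerD2l.
exact: ln1D_ge.
Qed.

Lemma weight_le_near0 (r : R) : 0 < r -> wt r <= r `^ (alpha + beta).
Proof.
move=> r0; rewrite /weight powR_addr// ler_pM2l ?powR_gt0//.
apply: ge0_ler_powR; rewrite ?nnegrE ?(ltW hbeta) ?(ltW r0)//.
  by rewrite ltW// ln1D_gt0.
by rewrite le_ln1Dx// (lt_trans _ r0)// oppr_lt0.
Qed.

(** If [alpha >= -2] the source is at least of the order of [|x|^-2] at infinity,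
    which forces [u] above arbitrarily large multiples of
    [|x|^-q - |x|^-(N - 2)], as [q] tends to [0]. *)
Lemma solution_alpha u : sol u -> alpha < - 2.
Proof.
move=> su; rewrite ltNge; apply/negP => al.
have k0 := @codim_gt0 R N hN.
have [C C0 uC] := solution_bounded hN hbeta hp su.
have uC2 y : 1 <= enorm y -> u y <= 2 * C.
  move=> y1; have y0 := enorm_neq0 ltr01 y1.
  apply: le_trans (uC y y0) _; rewrite mulrC ler_pM2r//.
  rewrite -[leRHS]/(1 + 1) lerD2l -[leRHS](powRr0 (enorm y)).
  by rewrite ler_powR// oppr_le0 ltW.
have l2 : 0 < ln 2 :> R by rewrite ln_gt0// ltr1n.
pose c := ln 2 `^ beta * (2 * C) `^ (- p).
have c0 : 0 < c by rewrite mulr_gt0 ?powR_gt0// mulr_gt0.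
have gc y : 1 <= enorm y -> c * enorm y `^ (- 2) <= wt (enorm y) * u y `^ (- p).
  move=> y1; have y0 := enorm_neq0 ltr01 y1.
  rewrite /c mulrAC; apply: ler_pM; rewrite ?mulr_ge0 ?powR_ge0//; last first.
    by apply: ler_powRN => //; [exact: (solution_gt0 su)|exact: uC2].
  rewrite mulrC; apply: ler_pM; rewrite ?powR_ge0//; first by rewrite ler_powR.
  apply: ge0_ler_powR; rewrite ?nnegrE ?(ltW hbeta) ?(ltW l2)//.
    by rewrite ltW// ln1D_gt0// (lt_le_trans ltr01).
  by rewrite ler_ln ?posrE ?addr_gt0// ?(lt_le_trans ltr01)// -[leLHS]/(1 + 1) lerD2l.
pose kap : R := 2 `^ (- (k / 2)) - 2 `^ (- k).
have kap0 : 0 < kap.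
  rewrite subr_gt0 !powR_expR// ltr_expR ltr_pM2r// ltrN2 ltr_pdivrMr//.
  by rewrite ltr_pMr// ltr1n.
(* The coefficient [A] below makes the Laplacian of the barrier half the lower
   bound of the source.  It is of the order of [1 / q], so that for small [q] the
   barrier exceeds the upper bound [2 C] on the sphere of radius [2]. *)
pose q := Num.min (k / 2) (c * kap / (8 * C * k)).
have q0 : 0 < q.
  rewrite lt_min divr_gt0//=; apply: divr_gt0; first exact: mulr_gt0.
  by rewrite mulr_gt0// mulr_gt0.
have qk2 : q <= k / 2 by rewrite ge_min lexx.
have qk : q < k.
  by apply: le_lt_trans qk2 _; rewrite ltr_pdivrMr// ltr_pMr// ltr1n.
have qc : q * (8 * C * k) <= c * kap.
  by rewrite -ler_pdivlMr ?mulr_gt0// ge_min lexx orbT.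
pose A := c / (2 * (q * (k - q))).
have qkq : 0 < q * (k - q) by rewrite mulr_gt0// subr_gt0.
have A0 : 0 < A by rewrite divr_gt0// mulr_gt0.
have [x x2] := @exists_enorm 2 (ltr0Sn _ 1).
have H : A * enorm x `^ (- q) + - A * enorm x `^ (- k) <= u x.
  apply: (@outer_barrier u A (- A) (- q) (- k) 1) => //.
  - by rewrite addNr mulr0.
  - move=> t t0; have [r1 _ Hr] := powR_large (A / t) q0.
    exists r1 => r /Hr + r0; rewrite ler_pdivrMr// => H.
    apply: (@le_trans _ _ (A * r `^ (- q))).
      by rewrite gerDl mulNr oppr_le0 mulr_ge0 ?powR_ge0// ltW.
    by rewrite powRN ler_pdivrMr ?powR_gt0// [leRHS]mulrC.
  - move=> y y1; rewrite !powR1 !mulr1 subrr ltW// (solution_gt0 su)//.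
    by rewrite -enorm_gt0 y1.
  - move=> y y1; have y0 := enorm_neq0 ltr01 y1.
    have E : A * (- q * (- q + k)) = - (c / 2).
      by rewrite /A; field; rewrite !gt_eqF ?subr_gt0.
    rewrite mulrA E mulNr addrC subr_gt0.
    apply: lt_le_trans (gc y y1).
    apply: (@le_lt_trans _ _ (c / 2 * enorm y `^ (- 2))).
      rewrite ler_pM2l ?divr_gt0// ler_powR// gerDr oppr_le0.
      exact: ltW.
    by rewrite ltr_pM2r ?powR_gt0 ?enorm_gt0// ltr_pdivrMr// ltr_pMr// ltr1n.
  - by rewrite x2 ler1n.
have ux : u x <= 2 * C by apply: uC2; rewrite x2 ler1n.
have := le_trans H ux; rewrite x2 mulNr -mulrBr leNgt => /negP; apply.
apply: (@lt_le_trans _ _ (4 * C)).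
  by rewrite ltr_pM2r// ltr_nat.
apply: (@le_trans _ _ (A * kap)); last first.
  rewrite ler_pM2l// lerD2r !powR_expR// ler_expR ler_pM2r// lerN2.
  exact: qk2.
have den : 0 < 2 * (q * (k - q)) by exact: mulr_gt0.
rewrite /A mulrAC ler_pdivlMr//.
apply: le_trans qc.
have -> : q * (8 * C * k) = 4 * C * (2 * (q * k)) by ring.
rewrite ler_pM2l ?mulr_gt0// ler_pM2l// ler_pM2l// gerBl.
exact: ltW.
Qed.

(** Otherwise the bound [u <= C |x|^(2 - N)] near the origin makes the source at
    least of the order of [|x|^-N], and the previous argument applies in the unit
    ball with the barriers [|x|^-q - 1], as [q] tends to [N - 2]. *)
Lemma solution_exponent u : sol u -> 0 < N%:R + alpha + beta + p * k.
Proof.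
move=> su; rewrite ltNge; apply/negP => al.
have k0 := @codim_gt0 R N hN.
have [C C0 uC] := solution_bounded hN hbeta hp su.
have uC2 y : y != 0 -> enorm y <= 1 -> u y <= 2 * C * enorm y `^ (- k).
  move=> y0 y1; apply: le_trans (uC y y0) _.
  have T1 : 1 <= enorm y `^ (- k).
    rewrite -[leLHS](powRr0 (enorm y)) ger_powR ?oppr_le0 ?(ltW k0)//.
    by rewrite enorm_gt0 y0.
  set T := enorm y `^ _ in T1 *.
  have -> : 2 * C * T = C * (T + T) by ring.
  by rewrite ler_pM2l// lerD2r.
pose c := 2 `^ (- beta) * (2 * C) `^ (- p).
have c0 : 0 < c by rewrite mulr_gt0 ?powR_gt0// mulr_gt0.
have gc y : y != 0 -> enorm y <= 1 ->
    c * enorm y `^ (- N%:R) <= wt (enorm y) * u y `^ (- p).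
  move=> y0 y1; have r0 : 0 < enorm y by rewrite enorm_gt0.
  apply: (@le_trans _ _ ((2 `^ (- beta) * enorm y `^ (alpha + beta)) *
      (2 * C * enorm y `^ (- k)) `^ (- p))); last first.
    apply: ler_pM; rewrite ?mulr_ge0 ?powR_ge0//.
      by apply: weight_ge_near0; rewrite r0.
    by apply: ler_powRN => //; [exact: (solution_gt0 su)|exact: uC2].
  rewrite powRM ?powR_ge0 ?mulr_ge0 ?(ltW C0)// -powRrM mulrNN.
  rewrite mulrACA -/c -powR_addr// ler_pM2l//.
  rewrite ger_powR ?r0//; move: al; rewrite mulrC; set kk := _ * p.
  by move: (N%:R : R) => n; lra.
pose kap : R := 2 `^ (k / 2) - 1.
have kap0 : 0 < kap.
  by rewrite subr_gt0 powR_expR// expR_gt1 mulr_gt0 ?divr_gt0// ln_gt0// ltr1n.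
pose D := 2 * C * 2 `^ k; have D0 : 0 < D by rewrite mulr_gt0 ?powR_gt0// mulr_gt0.
(* The coefficient [A] is of the order of [1 / (k - q) = 1 / s], and [D] bounds
   [u] on the sphere of radius [1 / 2]. *)
pose s := Num.min (k / 2) (c * kap / (4 * D * k)).
have s0 : 0 < s.
  rewrite lt_min divr_gt0//=; apply: divr_gt0; first exact: mulr_gt0.
  by rewrite mulr_gt0// mulr_gt0.
have sk2 : s <= k / 2 by rewrite ge_min lexx.
have sc : s * (4 * D * k) <= c * kap.
  by rewrite -ler_pdivlMr ?mulr_gt0// ge_min lexx orbT.
have [q qE] : exists q, q = k - s by exists (k - s).
have q0 : 0 < q.
  by rewrite qE subr_gt0 (le_lt_trans sk2)// ltr_pdivrMr// ltr_pMr// ltr1n.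
have qk : q < k by rewrite qE gtrBl.
pose A := c / (2 * (q * (k - q))).
have qkq : 0 < q * (k - q) by rewrite mulr_gt0// subr_gt0.
have A0 : 0 < A by rewrite divr_gt0// mulr_gt0.
have [x x2] : exists x : 'rV[R]_N, enorm x = 2^-1.
  by apply: exists_enorm; rewrite invr_gt0.
have x0 : x != 0 by rewrite -enorm_gt0 x2 invr_gt0.
have x1 : enorm x <= 1 by rewrite x2 invf_le1// ler1n.
have H : A * enorm x `^ (- q) + - A * enorm x `^ 0 <= u x.
  apply: (@inner_barrier u A (- A) (- q) 0 1) => //.
  - by rewrite mul0r.
  - move=> t t0; have [d0 d00 Hd] := powR_small (A / t) s0.
    exists d0 => // d dd; have := Hd d dd; rewrite ler_pdivrMr// => H.
    have /andP[d_gt0 _] := dd.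
    rewrite powRr0 mulr1; apply: (@le_trans _ _ (A * d `^ (- q))).
      by rewrite gerDl oppr_le0 ltW.
    have -> : - k = - s - q by rewrite qE; ring.
    by rewrite powR_addr// mulrA ler_pM2r ?powR_gt0// mulrC.
  - move=> y y1; rewrite !powR1 !mulr1 subrr ltW// (solution_gt0 su)//.
    by rewrite -enorm_gt0 y1.
  - move=> y y0 /ltW y1; have r0 : 0 < enorm y by rewrite enorm_gt0.
    have E : A * (- q * (- q + k)) = - (c / 2).
      by rewrite /A; field; rewrite !gt_eqF ?subr_gt0.
    rewrite mulrA E mulNr addrC subr_gt0.
    apply: lt_le_trans (gc y y0 y1).
    apply: (@le_lt_trans _ _ (c / 2 * enorm y `^ (- N%:R))).
      rewrite ler_pM2l ?divr_gt0// ger_powR ?r0//.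
      by move: (ltW qk); rewrite -subr_ge0 => h; rewrite -subr_ge0; move: h;
        move: (N%:R : R) => n; lra.
    by rewrite ltr_pM2r ?powR_gt0// ltr_pdivrMr// ltr_pMr// ltr1n.
have ux : u x <= D.
  apply: le_trans (uC2 x x0 x1) _; rewrite x2 ler_pM2l ?mulr_gt0//.
  by rewrite -powR_inv1// -powRrM mulN1r opprK.
have := le_trans H ux; rewrite powRr0 mulr1 leNgt => /negP; apply.
apply: (@lt_le_trans _ _ (2 * D)); first by rewrite ltr_pMl// ltr1n.
apply: (@le_trans _ _ (A * kap)); last first.
  rewrite /kap mulrBr mulr1 lerD2r ler_pM2l//.
  have -> : enorm x `^ (- q) = 2 `^ q.
    by rewrite x2 -powR_inv1// -powRrM mulN1r opprK.
  by rewrite ler_powR ?ler1n// qE; move: sk2; set kk := k; lra.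
have den : 0 < 2 * (q * (k - q)) by exact: mulr_gt0.
rewrite /A mulrAC ler_pdivlMr//.
apply: le_trans sc.
have -> : s * (4 * D * k) = 2 * D * (2 * (k * s)) by ring.
have -> : k - q = s by rewrite qE; ring.
by rewrite ler_pM2l ?mulr_gt0// ler_pM2l// ler_pM2r// ltW.
Qed.

End RadialSolutions.


(** * Removability of the singularity *)

Section Removability.
Variables (R : realType) (N : nat) (alpha beta p : R).
Hypotheses (hN : (3 <= N)%N) (hbeta : 0 < beta) (hp : 0 < p).
Implicit Types (u v : 'rV[R]_N -> R) (x y z e : 'rV[R]_N).

Local Notation sol := (positive_solution alpha beta p).
Local Notation wt := (weight alpha beta).
Local Notation k := (N%:R - 2 : R).

(** A bound near the origin is a global one, by monotonicity. *)
Lemma removable_bounded u : sol u -> removable_singularity_at_origin u ->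
  exists2 D : R, 0 < D & forall x, x != 0 -> u x <= D.
Proof.
move=> su [v [cv vpos vu]]; exists (v 0 + 1); first by rewrite addr_gt0.
have nv : nbhs (0 : 'rV[R]_N) [set y | v y < v 0 + 1].
  by apply: (cv 0 [set s | s < v 0 + 1]); apply: lt_nbhsl; rewrite ltrDl.
move/nbhs_ballP: nv => [d /= d0 Hd] x x0.
have rx0 : 0 < enorm x by rewrite enorm_gt0.
have m0 : 0 < Num.min (enorm x) (d / 2) by rewrite lt_min rx0 divr_gt0.
have [y ym] := @exists_enorm R N hN _ m0.
have y0 : y != 0 by rewrite -enorm_gt0 ym.
apply: (@le_trans _ _ (u y)).
  by apply: (solution_nonincreasing hN hbeta hp su) => //; rewrite ym ge_min lexx.
rewrite -vu// ltW//; apply: Hd; rewrite -ball_normE /= sub0r normrN.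
apply: le_lt_trans (norm_le_enorm y) _; rewrite ym gt_min; apply/orP; right.
by rewrite ltr_pdivrMr// ltr_pMr// ltr1n.
Qed.

(** If [alpha + beta <= -2], a bounded solution would have a source of the order
    of [|x|^-2] at least, hence dominate [(1 - |x|^q) / q] up to a constant
    factor, uniformly in [q]. *)
Lemma bounded_solution_exponent u (D : R) : sol u -> 0 < D ->
  (forall x, x != 0 -> u x <= D) -> - 2 < alpha + beta.
Proof.
move=> su D0 uD; rewrite ltNge; apply/negP => al.
have k0 := @codim_gt0 R N hN.
pose c := 2 `^ (- beta) * D `^ (- p).
have c0 : 0 < c by rewrite mulr_gt0 ?powR_gt0.
have gc y : y != 0 -> enorm y <= 1 ->
    c * enorm y `^ (- 2) <= wt (enorm y) * u y `^ (- p).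
  move=> y0 y1; have r0 : 0 < enorm y by rewrite enorm_gt0.
  rewrite /c mulrAC; apply: ler_pM; rewrite ?mulr_ge0 ?powR_ge0//; last first.
    by apply: ler_powRN => //; [exact: (solution_gt0 su)|exact: uD].
  apply: (@le_trans _ _ (2 `^ (- beta) * enorm y `^ (alpha + beta))).
    by rewrite ler_pM2l ?powR_gt0// ger_powR ?r0.
  by apply: weight_ge_near0; rewrite ?r0.
(* [A] is of the order of [1 / q], and the barrier takes the value [A / 2] on the
   sphere where [|x|^q = 1 / 2]. *)
pose q := Num.min 1 (c / (8 * D * (1 + k))).
have k1 : 0 < 1 + k by rewrite addr_gt0.
have Dk : 0 < 8 * D * (1 + k) by rewrite mulr_gt0// mulr_gt0.
have q0 : 0 < q by rewrite lt_min ltr01/=; exact: divr_gt0.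
have q1 : q <= 1 by rewrite ge_min lexx.
have qc : q * (8 * D * (1 + k)) <= c.
  by rewrite -ler_pdivlMr// ge_min lexx orbT.
have qk : 0 < q * (q + k) by rewrite mulr_gt0// addr_gt0.
pose A := c / (2 * (q * (q + k))).
have den : 0 < 2 * (q * (q + k)) by exact: mulr_gt0.
have A0 : 0 < A by rewrite divr_gt0.
have h0 : 0 < 2^-1 `^ q^-1 :> R by rewrite powR_gt0// invr_gt0.
have [x xE] := @exists_enorm R N hN _ h0.
have x0 : x != 0 by rewrite -enorm_gt0 xE.
have xq : enorm x `^ q = 2^-1.
  by rewrite xE -powRrM mulVf ?gt_eqF// powRr1// invr_ge0.
have x1 : enorm x <= 1.
  rewrite xE -[leRHS](powRr0 2^-1) ger_powR ?invr_ge0 ?(ltW q0)//.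
  by rewrite invr_gt0 ltr0n invf_le1// ler1n.
have H : - A * enorm x `^ q + A * enorm x `^ 0 <= u x.
  apply: (@inner_barrier R N alpha beta p u (- A) A q 0 1) => //.
  - by rewrite mul0r.
  - move=> t t0; have [d0 d00 Hd] := powR_small (A / t) k0.
    exists d0 => // d dd; have := Hd d dd; rewrite ler_pdivrMr// => H.
    apply: (@le_trans _ _ A); last by rewrite [leRHS]mulrC.
    by rewrite powRr0 mulr1 gerDr mulNr oppr_le0 mulr_ge0 ?powR_ge0// ltW.
  - move=> y y1; rewrite !powR1 !mulr1 addNr ltW// (solution_gt0 su)//.
    by rewrite -enorm_gt0 y1.
  - move=> y y0 /ltW y1; have r0 : 0 < enorm y by rewrite enorm_gt0.
    have E : A * (q * (q + k)) = c / 2.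
      by rewrite /A; field; rewrite !gt_eqF// addr_gt0.
    rewrite mulrA mulNr E mulNr addrC subr_gt0.
    apply: lt_le_trans (gc y y0 y1).
    apply: (@le_lt_trans _ _ (c / 2 * enorm y `^ (- 2))).
      by rewrite ler_pM2l ?divr_gt0// ger_powR ?r0// lerDr ltW.
    by rewrite ltr_pM2r ?powR_gt0// ltr_pdivrMr// ltr_pMr// ltr1n.
have := le_trans H (uD x x0); rewrite xq powRr0 mulr1 leNgt => /negP; apply.
apply: (@lt_le_trans _ _ (2 * D)); first by rewrite ltr_pMl// ltr1n.
have -> : - A * 2^-1 + A = A / 2 by field.
rewrite /A ler_pdivlMr// ler_pdivlMr//.
apply: le_trans qc.
have -> : 2 * D * 2 * (2 * (q * (q + k))) = q * (8 * D * (q + k)) by ring.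
rewrite ler_pM2l// ler_pM2l ?mulr_gt0// lerD2r; exact: q1.
Qed.

(** If [alpha + beta > -2], [C (2 - |x|^delta)] is a bounded supersolution near
    the origin, so a solution without singular part is bounded there. *)
Lemma nonsingular_bounded u (b : R) : sol u -> asymptotics u 0 b ->
  - 2 < alpha + beta -> exists D, forall x, x != 0 -> u x <= D.
Proof.
move=> su [ua _] ab; have k0 := @codim_gt0 R N hN.
have [z z1] := @exists_enorm R N hN 1 ltr01.
have z0 : z != 0 by rewrite -enorm_gt0 z1.
have uz := solution_gt0 su z0.
pose dl := Num.min 1 (alpha + beta + 2).
have dl0 : 0 < dl by rewrite lt_min ltr01/=; move: ab; lra.
have dlab : dl - 2 <= alpha + beta.
  by rewrite lerBlDr ge_min lexx orbT.
have dk : 0 < dl * (dl + k) by rewrite mulr_gt0// addr_gt0.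
pose C := 1 + u z + (dl * (dl + k))^-1.
have i0 : 0 < (dl * (dl + k))^-1 by rewrite invr_gt0.
have C1 : 1 < C by rewrite /C -addrA ltrDl addr_gt0.
have C0 : 0 < C by rewrite (lt_trans _ C1).
have Cz : u z <= C by rewrite /C -addrA addrCA lerDl addr_ge0// ltW.
have Cd : 1 < C * (dl * (dl + k)).
  by rewrite -ltr_pdivrMr// div1r /C ltrDr addr_gt0.
have Cp : C `^ (- p) <= 1.
  by rewrite -[leRHS](powRr0 C) ler_powR ?(ltW C1)// oppr_le0 ltW.
have inball x : x != 0 -> enorm x <= 1 -> u x <= C * 2.
  move=> x0 x1; have rx0 : 0 < enorm x by rewrite enorm_gt0.
  apply: (@le_of_eps _ _ _ (enorm x `^ (- k))); first exact: powR_ge0.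
  move=> t t0; have [d d0 Hd] := ua t t0.
  pose a := Num.min d (enorm x); have a0 : 0 < a by rewrite lt_min d0.
  pose w y := u y + C * enorm (y - 0) `^ dl - (C * 2 + t * enorm (y - 0) `^ (- k)).
  suff : w x <= 0.
    rewrite /w subr0 subr_le0; apply: le_trans.
    by rewrite lerDl mulr_ge0 ?powR_ge0// ltW.
  have ne y : a <= enorm y -> y != 0.
    by move=> ay; rewrite -enorm_gt0 (lt_le_trans a0).
  have pd y : enorm y <= 1 -> enorm y `^ dl <= 1.
    move=> y1; have E1 : (1 : R) `^ dl = 1 by rewrite powR1.
    rewrite -[leRHS]E1; apply: ge0_ler_powR => //.
    - exact: ltW.
    - exact: enorm_ge0.
    - exact: ler01.
  apply: (@max_principle_annulus _ _ w a 1).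
  - move=> y /andP[ay _]; have y0 := ne y ay.
    have cp (c q : R) := continuousM (@cst_continuous 'rV[R]_N R c y)
      (@enormB_powR_continuous _ _ 0 q y y0).
    exact: (continuousB (continuousD (solution_continuous su y0) (cp C dl))
      (continuousD (@cst_continuous 'rV[R]_N R (C * 2) y) (cp t (- k)))).
  - move=> y ya; have y0 : y != 0 by apply: ne; rewrite ya.
    have ry0 : 0 < enorm y by rewrite enorm_gt0.
    have yd : enorm y <= d by rewrite ya /a ge_min lexx.
    have := Hd y y0 yd; rewrite subr0 ler_norml => /andP[_ h].
    rewrite /w subr0 subr_le0 [leLHS]addrC lerD//.
      have y1 : enorm y <= 1 by rewrite ya (le_trans _ x1)// /a ge_min lexx orbT.
      by rewrite ler_pM2l// (le_trans (pd y y1))// ler1n.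
    by rewrite powRN ler_pdivlMr ?powR_gt0// mulrC.
  - move=> y y1; rewrite /w subr0 y1 !powR1 !mulr1 subr_le0.
    have -> : u y = u z.
      apply: (solution_radial hN hbeta hp su) => //; last by rewrite y1 z1.
      by rewrite -enorm_gt0 y1.
    have -> : C * 2 = C + C by ring.
    by rewrite -[leLHS]addr0 lerD ?(ltW t0)// lerD2r.
  - move=> y /andP[/ltW ay /ltW y1] wy; have y0 := ne y ay.
    have ry0 : 0 < enorm y by rewrite enorm_gt0.
    have [G jG] := solution_lap_at su y0.
    have jp c q := lap_at_scale c (@lap_at_enormB R N q 0 y y0).
    eexists; eexists; split.
      exact: (lap_at_sub (lap_at_add jG (jp C dl))
        (lap_at_add (lap_at_cst (C * 2) y) (jp t (- k)))).
    have -> : - k * (- k + N%:R - 2) = 0 by ring.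
    rewrite mul0r mulr0 addr0 subr0 addrC subr_gt0 subr0 -addrA mulrA.
    have Cu : C <= u y.
      move: wy; rewrite /w subr0 subr_gt0 => /ltW h.
      have h1 : C * enorm y `^ dl <= C by rewrite ler_piMr ?(ltW C0)// pd.
      have h2 : 0 <= t * enorm y `^ (- k) by rewrite mulr_ge0 ?powR_ge0// ltW.
      by move: h h1 h2; set X := _ * _ `^ dl; set Y := t * _; lra.
    apply: (@le_lt_trans _ _ (enorm y `^ (dl - 2))).
      rewrite -[leRHS]mulr1; apply: ler_pM; rewrite ?powR_ge0//.
      + by rewrite mulr_ge0// powR_ge0.
      + apply: le_trans (weight_le_near0 alpha hbeta ry0) _.
        by rewrite ger_powR ?ry0.
      + by apply: le_trans Cp; exact: ler_powRN.
    by rewrite -[ltLHS]mul1r ltr_pM2r ?powR_gt0.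
  - by rewrite x1 /a ge_min lexx orbT.
exists (C * 2) => x x0; have [x1|/ltW x1] := lerP (enorm x) 1; first exact: inball.
apply: (@le_trans _ _ (u z)).
  by apply: (solution_nonincreasing hN hbeta hp su) => //; rewrite z1.
by apply: inball; rewrite ?z1.
Qed.

(** A bounded solution tends to its supremum at the origin, by monotonicity. *)
Lemma nonsingular_removable u (b : R) : sol u -> asymptotics u 0 b ->
  - 2 < alpha + beta -> removable_singularity_at_origin u.
Proof.
move=> su ua ab; have [D uD] := nonsingular_bounded su ua ab.
pose E := u @` [set x | x != 0].
have ubE : ubound E D by move=> _ [x x0 <-]; exact: uD.
have [z z0] := @exists_neq0 R N hN.
have neE : E !=set0 by exists (u z), z.
have sE : has_sup E by split=> //; exists D.
have uS x : x != 0 -> u x <= sup E.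
  by move=> x0; apply: (sup_upper_bound sE); exists x.
exists (fun x => if x == 0 then sup E else u x); split.
- move=> x; have [->|x0] := eqVneq x 0; last first.
    have nx : \forall y \near x, u y = (if y == 0 then sup E else u y).
      have : open_nbhs x [set y : 'rV[R]_N | y != 0].
        by split; [exact: open_neq0|].
      by move/open_nbhs_nbhs; apply: filterS => y /= /negbTE ->.
    rewrite /continuous_at (negbTE x0).
    exact: (cvg_trans (near_eq_cvg nx) (solution_continuous su x0)).
  rewrite /continuous_at eqxx.
  apply/(@cvgrPdist_le R R 'rV[R]_N (nbhs (0 : 'rV[R]_N)) (nbhs_filter _)) => t t0.
  have [_ [y y0 <-] uy] := sup_adherent t0 sE.
  have ny : \forall x \near (0 : 'rV[R]_N), enorm x < enorm y.
    apply: (@enorm_continuous R N 0 [set s | s < enorm y]).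
    by apply: lt_nbhsl; rewrite enorm0 enorm_gt0.
  near=> x'; case: ifPn => [_|x'0]; first by rewrite subrr normr0 ltW.
  have xy : enorm x' < enorm y by near: x'.
  rewrite ger0_norm ?subr_ge0 ?uS// lerBlDl -lerBlDr (le_trans (ltW uy))//.
  by apply: (solution_nonincreasing hN hbeta hp su) => //; exact: ltW.
- move=> x; case: ifPn => [_|x0]; last exact: solution_gt0 su x0.
  by rewrite (lt_le_trans _ (uS z z0))// (solution_gt0 su).
- by move=> x /negbTE ->.
Unshelve. all: by end_near. Qed.

End Removability.


(** * Linear equations on the line *)

Section LinearODE.
Variable R : realType.
Implicit Types (f g W y : R -> R) (s t : R).

Lemma derive_ge0_le f (f' : R -> R) s t : (forall x : R, is_derive x 1 f (f' x)) ->
  (forall x, 0 <= f' x) -> s <= t -> f s <= f t.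
Proof.
move=> df f0 st; rewrite -subr_ge0.
have dfI x : x \in `]s, t[%R -> is_derive x 1 f (f' x) by move=> _; exact: df.
have cf : {within `[s, t], continuous f}.
  by apply: derivable_within_continuous => x _; have [] := df x.
have [c _ ->] := MVT_segment st dfI cf.
by rewrite mulr_ge0// subr_ge0.
Qed.

Lemma derive_continuous f (f' : R -> R) :
  (forall x : R, is_derive x 1 f (f' x)) -> continuous f.
Proof. by move=> df x; exact: (is_derive_continuous (df x)). Qed.

Let right_antiderivative g (a : R) : continuous g ->
  exists F : R -> R, forall s, a < s -> is_derive s 1 F (g s).
Proof.
move=> cg; pose F x := (\int[@lebesgue_measure R]_(t in `[a, x]) g t)%R.
exists F => s as_.
have ss1 : s < s + 1 by rewrite ltrDl.
have int : (@lebesgue_measure R).-integrable `[a, s + 1] (EFin \o g).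
  apply: continuous_compact_integrable; first exact: segment_compact.
  exact: continuous_subspaceT.
have [dF F's] := @continuous_FTC1_closed R g a s (s + 1) ss1 int as_ (cg s).
exact: (DeriveDef dF (etrans (esym (derive1E _ _)) F's)).
Qed.

(** The fundamental theorem of calculus gives antiderivatives on half lines;
    normalised at [0], they agree where they are both defined. *)
Lemma antiderivative g : continuous g ->
  exists P : R -> R, forall s : R, is_derive s 1 P (g s).
Proof.
move=> cg.
have /choice[F HF] (n : R) : exists F : R -> R,
    F 0 = 0 /\ forall s, - `|n| - 1 < s -> is_derive s 1 F (g s).
  have [F HF] := @right_antiderivative g (- `|n| - 1) cg.
  exists (fun s => F s + - F 0); split; first by rewrite subrr.
  move=> s /HF dF; have H := is_derive_addf dF (is_derive_cst (- F 0) s 1).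
  by apply: (is_derive_eq H); rewrite addr0.
have same (m n s : R) : - `|m| - 1 < s -> - `|n| - 1 < s -> F m s = F n s.
  move=> ms ns; have [Fm0 dFm] := HF m; have [Fn0 dFn] := HF n.
  pose D x := F m x + - F n x.
  have dD x : - `|m| - 1 < x -> - `|n| - 1 < x -> is_derive x 1 D 0.
    move=> mx nx; have H := is_derive_addf (dFm x mx) (is_derive_oppf (dFn x nx)).
    by apply: (is_derive_eq H); rewrite subrr.
  have neg (z : R) : - `|z| - 1 < 0.
    by rewrite -opprD oppr_lt0 ltr_wpDl.
  have Dc (x y : R) : x <= y -> - `|m| - 1 < x -> - `|n| - 1 < x -> D y - D x = 0.
    move=> xy mx nx.
    have dDI z : z \in `]x, y[%R -> is_derive z 1 D 0.
      by rewrite in_itv/= => /andP[xz _]; apply: dD; exact: lt_trans xz.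
    have cD : {within `[x, y], continuous D}.
      apply: derivable_within_continuous => z /[!in_itv]/= /andP[xz _].
      by have [] : is_derive z 1 D 0 by apply: dD; exact: lt_le_trans xz.
    by have [c _ ->] := MVT_segment xy dDI cD; rewrite mul0r.
  have D0 : D 0 = 0 by rewrite /D Fm0 Fn0 subrr.
  apply/eqP; rewrite -subr_eq0 -/(D s); apply/eqP.
  have [s0|/ltW s0] := lerP s 0.
    by have := Dc s 0 s0 ms ns; rewrite D0 sub0r => /eqP; rewrite oppr_eq0 => /eqP.
  by have := Dc 0 s s0 (neg m) (neg n); rewrite D0 subr0.
have below (s : R) : - `|s| - 1 < s.
  by have := ler_norm (- s); rewrite normrN; set a := `|s|; lra.
exists (fun s => F s s) => s.
have [_ dF] := HF s.
apply: near_eq_is_derive (dF s (below s)).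
near=> x; apply: same; last exact: below.
have : - `|s| - 1 < x; last by [].
by near: x; apply: lt_nbhsr; exact: below.
Unshelve. all: by end_near. Qed.

Lemma is_derive_expRM (c s : R) :
  is_derive s 1 (fun s => expR (c * s)) (c * expR (c * s)).
Proof.
have H := is_derive_compf (is_derive_expR (c * s))
  (is_derive_scalef c (is_derive_id s 1)).
by apply: (is_derive_eq H); rewrite mulr1 mulrC.
Qed.

(** The solution of [y' + mu y = g] that is the smallest at [-oo], obtained as
    [exp (- mu s) (P s - inf P)] where [P' = exp (mu s) g].  A supersolution [W]
    bounds it because [exp (mu s) W - P] is nondecreasing. *)
Lemma first_order_forward (mu : R) g W (W' : R -> R) : continuous g ->
  (forall s, 0 <= g s) -> (forall s : R, is_derive s 1 W (W' s)) ->
  (forall s, 0 <= W s) -> (forall s, g s <= W' s + mu * W s) ->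
  exists y : R -> R, (forall s : R, is_derive s 1 y (g s - mu * y s)) /\
    forall s, 0 <= y s <= W s.
Proof.
move=> cg g0 dW W0 gW.
have cE : continuous (fun s : R => expR (mu * s) * g s).
  move=> s.
  exact: (continuousM (is_derive_continuous (is_derive_expRM mu s)) (cg s)).
have [P dP] := antiderivative cE.
pose Q s := expR (mu * s) * W s - P s.
have Pmono s t : s <= t -> P s <= P t.
  by apply: (derive_ge0_le dP) => x; rewrite mulr_ge0// expR_ge0.
have Qmono s t : s <= t -> Q s <= Q t.
  apply: (@derive_ge0_le Q
      (fun s => expR (mu * s) * (W' s + mu * W s - g s))).
    move=> x; have H := is_derive_addf (is_derive_mulf (is_derive_expRM mu x)
      (dW x)) (is_derive_oppf (dP x)).
    by apply: (is_derive_eq H); ring.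
  by move=> x; rewrite mulr_ge0 ?expR_ge0// subr_ge0.
have lb t s : P t - expR (mu * t) * W t <= P s.
  have [st|/ltW ts] := lerP s t.
    have := Qmono s t st; rewrite /Q.
    have := mulr_ge0 (expR_ge0 (mu * s)) (W0 s).
    by set a := _ * W s; set b := _ * W t; lra.
  have := Pmono t s ts.
  have := mulr_ge0 (expR_ge0 (mu * t)) (W0 t).
  by set b := _ * W t; lra.
pose E := range P; pose l := inf E.
have hE : has_inf E.
  split; first by exists (P 0), 0.
  by exists (P 0 - expR (mu * 0) * W 0) => _ [s _ <-]; exact: lb.
have lP s : l <= P s by apply: (ge_inf hE.2); exists s.
have Pl t : P t - expR (mu * t) * W t <= l.
  by apply: lb_le_inf hE.1 _ => _ [s _ <-]; exact: lb.
exists (fun s => expR (- mu * s) * (P s + - l)); split=> s.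
  have H := is_derive_mulf (is_derive_expRM (- mu) s)
    (is_derive_addf (dP s) (is_derive_cst (- l) s 1)).
  apply: (is_derive_eq H) => /=.
  have EE : expR (mu * s) * expR (- mu * s) = 1 by rewrite mulNr expRxMexpNx_1.
  set a := expR (mu * s) in EE *; set b := expR (- mu * s) in EE *.
  transitivity (a * b * g s - mu * (b * (P s + - l))); first by ring.
  by rewrite EE mul1r.
rewrite mulr_ge0 ?expR_ge0 ?subr_ge0//=.
rewrite mulNr expRN ler_pdivrMl ?expR_gt0//.
by rewrite lerBlDl -lerBlDr.
Qed.

Lemma is_derive_reflect f (a s : R) : is_derive (- s) 1 f a ->
  is_derive s 1 (fun x => f (- x)) (- a).
Proof.
move=> df; have H := is_derive_compf (g := fun x => - x) df
  (is_derive_oppf (is_derive_id s 1)).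
by apply: (is_derive_eq H); rewrite mulrN1.
Qed.

Lemma first_order_backward (mu : R) g W (W' : R -> R) : continuous g ->
  (forall s, 0 <= g s) -> (forall s : R, is_derive s 1 W (W' s)) ->
  (forall s, 0 <= W s) -> (forall s, g s <= - W' s + mu * W s) ->
  exists y : R -> R, (forall s : R, is_derive s 1 y (mu * y s - g s)) /\
    forall s, 0 <= y s <= W s.
Proof.
move=> cg g0 dW W0 gW.
have [||||| y [dy yW]] := @first_order_forward mu (fun s => g (- s))
  (fun s => W (- s)) (fun s => - W' (- s)).
- move=> s; apply: (@continuous_comp _ _ _ (fun s : R => - s) g); last exact: cg.
  exact: opp_continuous.
- by move=> s; exact: g0.
- by move=> s; exact: is_derive_reflect.
- by move=> s; exact: W0.
- by move=> s; exact: gW.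
exists (fun s => y (- s)); split=> s.
  have H := is_derive_reflect (dy (- s)).
  by apply: (is_derive_eq H); rewrite opprK opprB.
by have := yW (- s); rewrite opprK.
Qed.

Definition C2_with f (f1 f2 : R -> R) : Prop :=
  forall s : R, is_derive s 1 f (f1 s) /\ is_derive s 1 f1 (f2 s).

Lemma C2_with_add f (f1 f2 : R -> R) g (g1 g2 : R -> R) :
  C2_with f f1 f2 -> C2_with g g1 g2 ->
  C2_with (fun s => f s + g s) (fun s => f1 s + g1 s) (fun s => f2 s + g2 s).
Proof.
by move=> Hf Hg s; have [? ?] := Hf s; have [? ?] := Hg s; split;
  exact: is_derive_addf.
Qed.

Lemma C2_with_scale (c : R) f (f1 f2 : R -> R) : C2_with f f1 f2 ->
  C2_with (fun s => c * f s) (fun s => c * f1 s) (fun s => c * f2 s).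
Proof.
by move=> Hf s; have [? ?] := Hf s; split; exact: is_derive_scalef.
Qed.

Lemma C2_with_sub f (f1 f2 : R -> R) g (g1 g2 : R -> R) :
  C2_with f f1 f2 -> C2_with g g1 g2 ->
  C2_with (fun s => f s - g s) (fun s => f1 s - g1 s) (fun s => f2 s - g2 s).
Proof.
move=> Hf Hg s; have [? ?] := Hf s; have [? ?] := Hg s.
by split; apply: is_derive_addf => //; exact: is_derive_oppf.
Qed.

Lemma C2_with_expR (c : R) : C2_with (fun s => expR (c * s))
  (fun s => c * expR (c * s)) (fun s => c * (c * expR (c * s))).
Proof.
move=> s; split; first exact: is_derive_expRM.
exact: is_derive_scalef (is_derive_expRM c s).
Qed.

Lemma C2_with_cst (c : R) : C2_with (fun=> c) (fun=> 0) (fun=> 0).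
Proof. by move=> s; split; exact: is_derive_cst. Qed.

Variables (k nu : R).
Hypotheses (k0 : 0 < k) (nu0 : 0 < nu).

Let c := nu * (nu + k).

(** In the variable [s = ln |x|] the radial Laplacian is [D^2 + k D] up to the
    factor [|x|^-2].  [coercive] is [c] minus this operator, with [c] chosen so
    that it factors as [(nu + k + D) (nu - D)]; [growth] bounds the kernel of
    [D^2 + k D]. *)
Definition coercive f (f1 f2 : R -> R) s : R := - f2 s - k * f1 s + c * f s.

Definition growth s : R := 1 + expR (- k * s).

Lemma growth_ge0 s : 0 <= growth s.
Proof. by rewrite addr_ge0// expR_ge0. Qed.

(** By the factorisation, two first order equations are to be solved: one with
    the factor [nu - D], backward, then one with [nu + k + D], forward.  Multiples
    of [growth] are supersolutions of both. *)
Lemma coercive_solve g (C : R) : continuous g ->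
  (forall s, 0 <= g s <= C * growth s) ->
  exists f f1 f2, [/\ C2_with f f1 f2,
    forall s, coercive f f1 f2 s = g s &
    exists C', forall s, 0 <= f s <= C' * growth s].
Proof.
move=> cg gC.
have C0 : 0 <= C.
  have /andP[h1 h2] := gC 0; have := le_trans h1 h2.
  by rewrite /growth mulr0 expR0 pmulr_lge0// addr_gt0.
have dH s : is_derive s 1 growth (- k * expR (- k * s)).
  have H := is_derive_addf (is_derive_cst (1 : R) s 1) (is_derive_expRM (- k) s).
  by apply: (is_derive_eq H); rewrite add0r.
pose W (a : R) s := a * growth s.
have dW a s : is_derive s 1 (W a) (a * (- k * expR (- k * s))).
  exact: is_derive_scalef.
have W0 a s : 0 <= a -> 0 <= W a s by move=> a0; rewrite mulr_ge0 ?growth_ge0.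
have g0 s : 0 <= g s by have /andP[] := gC s.
have gW s : g s <= - (C / nu * (- k * expR (- k * s))) + nu * W (C / nu) s.
  have /andP[_ h] := gC s; apply: le_trans h _; rewrite /W /growth.
  set e := expR _; have e0 : 0 <= e by exact: expR_ge0.
  have -> : - (C / nu * (- k * e)) + nu * (C / nu * (1 + e)) =
      C * (1 + e) + C / nu * (k * e) by field; rewrite gt_eqF.
  by rewrite lerDl mulr_ge0 ?divr_ge0 ?mulr_ge0 ?(ltW nu0) ?(ltW k0).
have C1 : 0 <= C / nu by rewrite divr_ge0// ltW.
have [y [dy yW]] := first_order_backward cg g0 (dW _) (fun s => W0 _ s C1) gW.
have cy : continuous y by exact: derive_continuous dy.
have y0 s : 0 <= y s by have /andP[] := yW s.
have yW2 s : y s <= C / nu ^+ 2 * (- k * expR (- k * s)) +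
    (nu + k) * W (C / nu ^+ 2) s.
  have /andP[_ h] := yW s; apply: le_trans h _; rewrite /W /growth.
  set e := expR _; have e0 : 0 <= e by exact: expR_ge0.
  have -> : C / nu ^+ 2 * (- k * e) + (nu + k) * (C / nu ^+ 2 * (1 + e)) =
      C / nu * (1 + e) + C / nu ^+ 2 * k by field; rewrite gt_eqF.
  by rewrite lerDl mulr_ge0 ?divr_ge0 ?exprn_ge0 ?(ltW nu0) ?(ltW k0).
have C2 : 0 <= C / nu ^+ 2 by rewrite divr_ge0// exprn_ge0// ltW.
have [f [df fW]] := first_order_forward cy y0 (dW _) (fun s => W0 _ s C2) yW2.
exists f, (fun s => y s - (nu + k) * f s).
exists (fun s => (nu * y s - g s) - (nu + k) * (y s - (nu + k) * f s)).
split.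
- move=> s; split; first exact: df.
  exact: is_derive_addf (dy s) (is_derive_oppf (is_derive_scalef (nu + k) (df s))).
- by move=> s; rewrite /coercive /c; ring.
- by exists (C / nu ^+ 2).
Qed.

(** Maximum principle on the whole line, for functions that grow at most like
    the kernel of [D^2 + k D]. *)
Lemma coercive_le0 f (f1 f2 : R -> R) (C : R) : C2_with f f1 f2 ->
  (forall s, coercive f f1 f2 s <= 0) -> (forall s, f s <= C * growth s) ->
  forall s, f s <= 0.
Proof.
move=> Hf opf fC s.
(* Any exponent [0 < m < nu] would do: [b] grows faster than [growth] at both
   ends, and [coercive] remains nonnegative on it. *)
pose m := nu / 2; have m0 : 0 < m by rewrite divr_gt0.
pose b := fun s => expR (m * s) + expR (- (k + m) * s).
have Hb := C2_with_add (C2_with_expR m) (C2_with_expR (- (k + m))).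
have b0 t : 0 < b t by rewrite addr_gt0// expR_gt0.
apply: (@le_of_eps _ _ _ (b s)); first exact: ltW.
move=> e e0; rewrite add0r -subr_le0.
pose D := Num.max C 0.
have D0 : 0 <= D by rewrite le_max lexx orbT.
pose S := Num.max `|s| (2 * D / e / m + 1).
have S1 : 2 * D / e / m < S.
  by rewrite lt_max; apply/orP; right; rewrite ltrDl.
have sS : `|s| <= S by rewrite le_max lexx.
have S0 : 0 <= S by exact: le_trans sS.
have big t : S <= `|t| -> f t <= e * b t.
  move=> St; apply: le_trans (fC t) _.
  have g0 := growth_ge0 t.
  apply: (@le_trans _ _ (D * growth t)); first by rewrite ler_wpM2r// le_max lexx.
  have De : 2 * D <= e * expR (m * `|t|).
    have h1 : 2 * D / e <= m * `|t|.
      by rewrite [leRHS]mulrC -ler_pdivrMr//; exact: le_trans (ltW S1) St.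
    rewrite -ler_pdivrMl// [leLHS]mulrC (le_trans h1)//.
    by rewrite (le_trans _ (expR_ge1Dx _))// lerDr.
  rewrite /growth /b mulrDr [leRHS]mulrDr.
  have [t0|/ltW t0] := lerP 0 t.
    apply: (@le_trans _ _ (e * expR (m * t))); last by rewrite lerDl mulr_ge0 ?expR_ge0// ltW.
    rewrite (ger0_norm t0) in De; apply: le_trans De.
    have : expR (- k * t) <= 1.
      by rewrite expR_le1 mulNr oppr_le0 mulr_ge0// ltW.
    by move=> /(ler_wpM2l D0); set X := D * expR _; lra.
  apply: (@le_trans _ _ (e * expR (- (k + m) * t))); last by rewrite lerDr mulr_ge0 ?expR_ge0// ltW.
  rewrite (ler0_norm t0) in De.
  have -> : - (k + m) * t = - k * t + m * - t by ring.
  rewrite expRD mulrCA.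
  have h : 1 <= expR (- k * t).
    by rewrite -(expR0 R) ler_expR mulNr -mulrN mulr_ge0 ?oppr_ge0// ltW.
  apply: (@le_trans _ _ (expR (- k * t) * (2 * D))); last first.
    by rewrite ler_pM2l ?expR_gt0.
  have := ler_wpM2l D0 h; set X := expR _; lra.
pose w t := f t - e * b t.
have Hw := C2_with_sub Hf (C2_with_scale e Hb).
rewrite -/(w s) leNgt; apply/negP => ws.
have cw : continuous w.
  by move=> t; have [d _] := Hw t; exact: (is_derive_continuous d).
have SS : - S <= S by rewrite ge0_cp.
have [z zI maxz] := EVT_max SS (continuous_subspaceT cw).
have sI : s \in `[- S, S] by rewrite in_itv/= -ler_norml.
have wz : 0 < w z := lt_le_trans ws (maxz s sI).
have zS : `|z| < S.
  rewrite ltNge; apply/negP => /big; rewrite -subr_le0 -/(w z).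
  by rewrite leNgt wz.
pose w1 t := f1 t - e * (m * expR (m * t) + - (k + m) * expR (- (k + m) * t)).
pose w2 t := f2 t - e * (m * (m * expR (m * t)) +
  - (k + m) * (- (k + m) * expR (- (k + m) * t))).
have jw : jet2 (fun h : R => w (1 * h + z)) (w1 z) (w2 z).
  exists (fun h => w1 (1 * h + z)); split.
  - near=> h; have [d _] := Hw (1 * h + z).
    by apply: (is_derive_eq (is_derive_affine_arg d)); rewrite mulr1.
  - by rewrite mulr0 add0r.
  - have [_ d] := Hw (1 * 0 + z).
    by apply: (is_derive_eq (is_derive_affine_arg d)); rewrite mulr1 mulr0 add0r.
have [w10 w20] : w1 z = 0 /\ w2 z <= 0.
  apply: (jet2_max jw); rewrite mulr0 add0r.
  have nz : \forall h \near (0 : R), `|h| < S - `|z|.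
    apply/nbhs_ballP; exists (S - `|z|); first by rewrite /= subr_gt0.
    by move=> h; rewrite /ball/= sub0r normrN.
  apply: filterS nz => h hS; apply: maxz.
  rewrite in_itv/= -ler_norml mul1r (le_trans (ler_normD _ _))//.
  by rewrite -lerBrDr ltW.
have : 0 < - w2 z - k * w1 z + c * w z.
  rewrite w10 mulr0 subr0 ltr_wpDl ?oppr_ge0//.
  by rewrite mulr_gt0// mulr_gt0// addr_gt0.
apply/negP; rewrite -leNgt.
have -> : - w2 z - k * w1 z + c * w z = coercive f f1 f2 z -
    e * (b z * (c - m * (m + k))).
  by rewrite /w2 /w1 /w /coercive /b; ring.
rewrite subr_le0 (le_trans (opf z))// mulr_ge0 ?(ltW e0)// mulr_ge0 ?(ltW (b0 _))//.
rewrite subr_ge0 /c; have mn : m <= nu by rewrite ler_pdivrMr// ler_pMr// ler1n.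
by apply: ler_pM; rewrite ?addr_ge0 ?(ltW m0) ?(ltW k0)// lerD2r.
Unshelve. all: by end_near. Qed.

End LinearODE.


(** * Monotone iteration *)

Section MonotoneIteration.
Variables (R : realType) (k nu p : R) (G psi psi1 psi2 Z Z1 Z2 H H1 H2 : R -> R).
Variables (sigma CZ : R).
Implicit Types (f g : R -> R) (s : R).

Let c := nu * (nu + k).

(* [psi] is a subsolution along which the slope of the nonlinearity is at most
   [c]; [Z] is a supersolution, with the gap [sigma] that will make the iteration
   contract; [H] carries the prescribed behaviour at both ends. *)
Hypotheses (k0 : 0 < k) (nu0 : 0 < nu) (p0 : 0 < p).
Hypotheses (cG : continuous G) (G0 : forall s, 0 < G s).
Hypotheses (psiC2 : C2_with psi psi1 psi2) (psi0 : forall s, 0 < psi s)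
  (psi_sub : forall s, - psi2 s - k * psi1 s <= G s * psi s `^ (- p))
  (psi_slope : forall s, p * (G s * psi s `^ (- p - 1)) <= c).
Hypotheses (ZC2 : C2_with Z Z1 Z2) (Z0 : forall s, 0 < Z s)
  (Z_super : forall s, G s * Z s `^ (- p) <= - Z2 s - k * Z1 s)
  (sigma0 : 0 < sigma) (Z_gap : forall s, sigma * Z s <= - Z2 s - k * Z1 s).
Hypotheses (HC2 : C2_with H H1 H2) (H_ge0 : forall s, 0 <= H s)
  (H_harm : forall s, - H2 s - k * H1 s = 0).
Hypotheses (H_growth : forall s, H s <= CZ * growth k s)
  (Z_growth : forall s, Z s <= CZ * growth k s)
  (psi_le_Z : forall s, psi s <= Z s).

Let rhs f s := G s * f s `^ (- p) + c * f s.

Let c0 : 0 < c. Proof. by rewrite mulr_gt0// addr_gt0. Qed.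

(** Convexity of [x^-p], from [1 + z <= exp z] and [ln (1 + t) <= t]. *)
Lemma powRN_tangent (x y : R) : 0 < x -> x <= y ->
  x `^ (- p) - y `^ (- p) <= p * x `^ (- p - 1) * (y - x).
Proof.
move=> x0 xy; have y0 : 0 < y := lt_le_trans x0 xy.
pose t := y / x - 1.
have t0 : 0 <= t by rewrite subr_ge0 ler_pdivlMr// mul1r.
have yE : y = x * (1 + t) by rewrite /t addrC subrK mulrC divfK// gt_eqF.
have -> : y - x = x * t by rewrite yE; ring.
have t1 : 0 < 1 + t by rewrite ltr_pwDl.
rewrite yE (powRM _ (ltW x0) (ltW t1)).
rewrite powR_addr// powR_inv1 ?(ltW x0)//.
set X := x `^ (- p); have X0 : 0 < X by rewrite powR_gt0.
have -> : p * (X / x) * (x * t) = X * (p * t) by field; rewrite gt_eqF.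
rewrite -[X in X - _]mulr1 -mulrBr ler_pM2l//.
rewrite lerBlDr -lerBlDl.
rewrite (powR_expR _ t1); apply: le_trans (expR_ge1Dx _).
rewrite lerD2l mulNr lerN2 ler_pM2l// le_ln1Dx//.
by rewrite (lt_le_trans _ t0)// oppr_lt0.
Qed.

Let rhs_mono (x y s : R) : psi s <= x -> x <= y ->
  0 <= (G s * y `^ (- p) + c * y) - (G s * x `^ (- p) + c * x) <= c * (y - x).
Proof.
move=> px xy; have x0 : 0 < x := lt_le_trans (psi0 s) px.
have h1 : G s * y `^ (- p) <= G s * x `^ (- p).
  by rewrite ler_pM2l// ler_powRN.
have h2 : G s * (x `^ (- p) - y `^ (- p)) <= c * (y - x).
  apply: (@le_trans _ _ (G s * (p * x `^ (- p - 1) * (y - x)))).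
    by rewrite ler_pM2l// powRN_tangent.
  rewrite mulrA ler_wpM2r ?subr_ge0//; apply: le_trans (psi_slope s).
  rewrite mulrCA ler_pM2l// ler_pM2l//.
  have -> : - p - 1 = - (p + 1) by ring.
  by apply: ler_powRN => //; rewrite addr_gt0.
move: h1 h2; rewrite !mulrBr; set a := G s * _; set b := G s * _.
by set d := c * _; set e := c * _; move=> h1 h2; apply/andP; split; lra.
Qed.

Let admissible f :=
  continuous f /\ forall s, [/\ psi s <= f s, H s <= f s & f s <= H s + Z s].

Let CZ0 : 0 <= CZ.
Proof.
have := le_trans (ltW (Z0 0)) (Z_growth 0).
by rewrite /growth mulr0 expR0 pmulr_lge0// addr_gt0.
Qed.

Let adm_growth f : admissible f -> forall s, f s <= 2 * CZ * growth k s.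
Proof.
move=> [_ af] s; have [_ _ h] := af s; apply: le_trans h _.
have := lerD (H_growth s) (Z_growth s).
by set a := CZ * _ => h; rewrite -mulrA -/a; move: h; lra.
Qed.

Let rhs_continuous f : admissible f -> continuous (rhs f).
Proof.
move=> [cf af] s; have [h _ _] := af s; have fs0 := lt_le_trans (psi0 s) h.
have c1 : {for s, continuous (fun s => f s `^ (- p))}.
  apply: (@continuous_comp _ _ _ f (fun t => t `^ (- p))); first exact: cf.
  exact: (is_derive_continuous (is_derive1_powR (- p) fs0)).
exact: (continuousD (continuousM (@cG s) c1)
  (continuousM (@cst_continuous R R c s) (cf s))).
Qed.

Let rhs_bound f : admissible f ->
  forall s, 0 <= rhs f s <= (c / p * CZ + c * (2 * CZ)) * growth k s.
Proof.
move=> af s; have [cf hf] := af; have [h _ _] := hf s.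
have fs0 := lt_le_trans (psi0 s) h.
apply/andP; split.
  by rewrite addr_ge0// mulr_ge0 ?powR_ge0// ltW.
rewrite mulrDl lerD//; last first.
  by rewrite -mulrA ler_pM2l//; exact: adm_growth.
apply: (@le_trans _ _ (G s * psi s `^ (- p))).
  by rewrite ler_pM2l// ler_powRN.
apply: (@le_trans _ _ (c / p * psi s)); last first.
  rewrite -[leRHS]mulrA ler_pM2l ?divr_gt0//.
  exact: le_trans (psi_le_Z s) (Z_growth s).
have -> : G s * psi s `^ (- p) = p * (G s * psi s `^ (- p - 1)) / p * psi s.
  rewrite powR_addr// powR_inv1 ?(ltW (psi0 s))//.
  by field; rewrite !gt_eqF.
by rewrite ler_pM2r// ler_pM2r ?invr_gt0.
Qed.

Let solve_ex f : exists t : (R -> R) * (R -> R) * (R -> R), admissible f ->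
  [/\ C2_with t.1.1 t.1.2 t.2, forall s, coercive k nu t.1.1 t.1.2 t.2 s = rhs f s &
   exists C', forall s, 0 <= t.1.1 s <= C' * growth k s].
Proof.
have [af|naf] := pselect (admissible f); last by exists (f, f, f).
have [g [g1 [g2 [h1 h2 h3]]]] :=
  coercive_solve k0 nu0 (rhs_continuous af) (rhs_bound af).
by exists (g, g1, g2).
Qed.

(** Comparison for two functions known through their images by [coercive]. *)
Let compare f (f1 f2 : R -> R) g (g1 g2 : R -> R) (C : R) :
  C2_with f f1 f2 -> C2_with g g1 g2 ->
  (forall s, coercive k nu f f1 f2 s <= coercive k nu g g1 g2 s) ->
  (forall s, f s - g s <= C * growth k s) -> forall s, f s <= g s.
Proof.
move=> Hf Hg le_op fg s; rewrite -subr_le0.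
apply: (coercive_le0 k0 nu0 (C2_with_sub Hf Hg)) fg s => s.
have -> : coercive k nu (fun s => f s - g s) (fun s => f1 s - g1 s)
    (fun s => f2 s - g2 s) s = coercive k nu f f1 f2 s - coercive k nu g g1 g2 s.
  by rewrite /coercive; ring.
by rewrite subr_le0.
Qed.

Let theta := c / (c + sigma).

Let theta0 : 0 < theta.
Proof. by rewrite divr_gt0// addr_gt0. Qed.

Let theta1 : theta < 1.
Proof. by rewrite ltr_pdivrMr ?addr_gt0// mul1r ltrDl. Qed.

(** The equation is solved by iterating
    [f |-> coercive^-1 (G f^-p + c f)] from the supersolution [H + Z].  Above the
    subsolution [psi] the map in the parentheses is nondecreasing and [c]-Lipschitz
    in [f]; hence the iterates decrease, and since [coercive (theta Z) >= c Z] they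
    do so geometrically with respect to [Z]. *)
Theorem monotone_iteration : exists f f1 f2, [/\ C2_with f f1 f2,
  forall s, 0 < f s, forall s, - f2 s - k * f1 s = G s * f s `^ (- p) &
  forall s, H s <= f s <= H s + Z s].
Proof.
have [T HT] := choice solve_ex.
pose S f := (T f).1.1.
have SC2 f : admissible f -> C2_with (S f) (T f).1.2 (T f).2.
  by move=> /HT[].
have Sop f s : admissible f -> coercive k nu (S f) (T f).1.2 (T f).2 s = rhs f s.
  by move=> /HT[].
have Sgr f : admissible f -> exists C', forall s, 0 <= S f s <= C' * growth k s.
  by move=> /HT[].
have HZC2 := C2_with_add HC2 ZC2.
have Sadm f : admissible f -> admissible (S f).
  move=> af; have [cf hf] := af; have [C' SC'] := Sgr f af.
  split; first by apply: (derive_continuous (f' := (T f).1.2)) => s; have [] := SC2 f af s.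
  move=> s; have cop := Sop f _ af; split; move: s.
  - apply: (compare (C := CZ) psiC2 (SC2 f af)) => s.
      rewrite cop /coercive /rhs; have [h _ _] := hf s.
      have /andP[h1 _] := rhs_mono (lexx _) h.
      apply: le_trans (_ : G s * psi s `^ (- p) + c * psi s <= _); last by rewrite -subr_ge0.
      by rewrite lerD2r.
    have /andP[h _] := SC' s.
    rewrite lerBlDr (le_trans (psi_le_Z s))// (le_trans (Z_growth s))//.
    by rewrite lerDl.
  - apply: (compare (C := CZ) HC2 (SC2 f af)) => s.
      rewrite cop /coercive H_harm add0r /rhs; have [_ h _] := hf s.
      by rewrite ler_wpDl ?mulr_ge0 ?powR_ge0 ?(ltW (G0 s))// ler_pM2l.
    have /andP[h _] := SC' s.
    by rewrite lerBlDr (le_trans (H_growth s))// lerDl.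
  - apply: (compare (C := C') (SC2 f af) HZC2) => s.
      rewrite cop; have [h1 h2 h3] := hf s.
      have /andP[h4 _] := rhs_mono h1 h3.
      rewrite /rhs; apply: le_trans (_ : G s * (H s + Z s) `^ (- p) + c * (H s + Z s) <= _).
        by rewrite -subr_ge0.
      rewrite /coercive.
      have -> : - (H2 s + Z2 s) - k * (H1 s + Z1 s) =
         (- H2 s - k * H1 s) + (- Z2 s - k * Z1 s) by ring.
      rewrite H_harm add0r lerD2r (le_trans _ (Z_super s))// ler_pM2l//.
      by apply: ler_powRN => //; rewrite lerDr.
    have /andP[_ h] := SC' s.
    by rewrite lerBlDr (le_trans h)// lerDl addr_ge0// ltW.
have Scontr f g (m : R) : admissible f -> admissible g -> 0 <= m ->
    (forall s, 0 <= f s - g s <= m * Z s) ->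
    forall s, 0 <= S f s - S g s <= m * theta * Z s.
  move=> af ag m0 fg s; have [_ hf] := af; have [_ hg] := ag.
  have Sf0 t : 0 <= S f t by have [C' /(_ t)/andP[]] := Sgr f af.
  have Sg0 t : 0 <= S g t by have [C' /(_ t)/andP[]] := Sgr g ag.
  have dg t : 0 <= rhs f t - rhs g t <= c * (m * Z t).
    have /andP[h1 h2] := fg t; have [h3 _ _] := hg t.
    have gf : g t <= f t by rewrite -subr_ge0.
    have /andP[-> h4] := rhs_mono h3 gf.
    by rewrite (le_trans h4)// ler_pM2l.
  apply/andP; split.
    rewrite subr_ge0; move: s.
    apply: (compare (C := 2 * CZ) (SC2 g ag) (SC2 f af)) => s.
      by rewrite !Sop// -subr_ge0; have /andP[] := dg s.
    by rewrite lerBlDr (le_trans (adm_growth (Sadm g ag) s))// lerDl.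
  move: s; apply: (compare (C := 2 * CZ) (C2_with_sub (SC2 f af) (SC2 g ag))
    (C2_with_scale (m * theta) ZC2)) => s.
    have -> : coercive k nu (fun s => S f s - S g s) (fun s => (T f).1.2 s - (T g).1.2 s)
        (fun s => (T f).2 s - (T g).2 s) s = rhs f s - rhs g s.
      rewrite -(Sop f s af) -(Sop g s ag) /coercive.
      by move: (S f s) (S g s) => x y; ring.
    have /andP[_ h] := dg s; apply: le_trans h _.
    have -> : coercive k nu (fun s => m * theta * Z s) (fun s => m * theta * Z1 s)
      (fun s => m * theta * Z2 s) s =
      m * theta * ((- Z2 s - k * Z1 s) + c * Z s).
      by rewrite /coercive /c; move: theta => th; ring.
    have -> : c * (m * Z s) = m * theta * (sigma * Z s + c * Z s).
      by rewrite /theta; field; rewrite gt_eqF// addr_gt0.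
    apply: ler_wpM2l; first by rewrite mulr_ge0// ltW.
    by rewrite lerD2r.
  have mZ := mulr_ge0 (mulr_ge0 m0 (ltW theta0)) (ltW (Z0 s)).
  have := adm_growth (Sadm f af) s; have := Sg0 s; move: mZ.
  by set a := _ * Z s; set b := _ * growth k s; lra.
(* By [Scontr], [F n - F n.+1] is at most [theta ^+ n * Z]. *)
pose F n := iter n S (fun s => H s + Z s).
have aF n : admissible (F n).
  elim: n => [|n IH]; last exact: Sadm.
  split; first by apply: (derive_continuous (f' := fun s => H1 s + Z1 s)) => s;
    have [] := HZC2 s.
  move=> s; rewrite /F /=; split=> //.
  - by rewrite (le_trans (psi_le_Z s))// lerDr.
  - by rewrite lerDl ltW.
have dF n s : 0 <= F n s - F n.+1 s <= theta ^+ n * Z s.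
  elim: n s => [|n IH] s; last first.
    rewrite exprSr; apply: (Scontr _ _ _ (aF n) (aF n.+1)); last exact: IH.
    by rewrite exprn_ge0// ltW.
  have [_ /(_ s)[_ h1 h2]] := aF 1%N; rewrite expr0 mul1r.
  by rewrite subr_ge0 h2 /= lerBlDr [leRHS]addrC lerD2r.
have F_le m n s : (m <= n)%N -> F n s <= F m s.
  elim: n => [|n IH]; first by rewrite leqn0 => /eqP->.
  rewrite leq_eqVlt => /predU1P[->//|]; rewrite ltnS => /IH; apply: le_trans.
  by have /andP[h _] := dF n s; rewrite -subr_ge0.
pose K := (1 - theta)^-1.
have K0 : 0 < K by rewrite invr_gt0 subr_gt0.
have F_ge m n s : (m <= n)%N ->
    F m s - K * theta ^+ m * Z s <= F n s - K * theta ^+ n * Z s.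
  elim: n => [|n IH]; first by rewrite leqn0 => /eqP->.
  rewrite leq_eqVlt => /predU1P[->//|]; rewrite ltnS => /IH h; apply: le_trans h _.
  have /andP[_ h] := dF n s.
  have E : K * theta ^+ n * Z s - K * theta ^+ n.+1 * Z s = theta ^+ n * Z s.
    rewrite exprS; set q := theta ^+ n; rewrite /K.
    by field; rewrite subr_eq0 gt_eqF.
  move: h E; set a := K * _ * Z s; set b := K * _ * Z s; set d := _ ^+ _ * Z s.
  by move: (F n s) (F n.+1 s) => x y; lra.
have KZ0 n s : 0 <= K * theta ^+ n * Z s.
  by rewrite !mulr_ge0 ?exprn_ge0 ?(ltW K0) ?(ltW theta0) ?(ltW (Z0 s)).
have F_lb n m s : F n s - K * theta ^+ n * Z s <= F m s.
  have [nm|/ltnW mn] := leqP n m.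
    by apply: le_trans (F_ge n m s nm) _; rewrite gerBl.
  by apply: le_trans (F_le m n s mn); rewrite gerBl.
pose phi s := inf (range (fun n => F n s)).
have hi s : has_inf (range (fun n => F n s)).
  split; first by exists (F 0%N s), 0%N.
  by exists (F 0%N s - K * theta ^+ 0 * Z s) => _ [m _ <-]; exact: F_lb.
have phi_le n s : phi s <= F n s by apply: (ge_inf (hi s).2); exists n.
have phi_glb s (x : R) : (forall n, x <= F n s) -> x <= phi s.
  by move=> h; apply: lb_le_inf (hi s).1 _ => _ [n _ <-].
have close n s : 0 <= F n s - phi s <= K * theta ^+ n * Z s.
  rewrite subr_ge0 phi_le/= lerBlDr addrC -lerBlDr.
  by apply: phi_glb => m; exact: F_lb.
have small (M t : R) : 0 <= M -> 0 < t -> exists n, K * theta ^+ n * M <= t.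
  move=> M0 t0; have tn : `|theta| < 1 by rewrite gtr0_norm.
  have t1 : 0 < t / (K * (M + 1)).
    by rewrite divr_gt0// mulr_gt0// ltr_wpDl.
  have /cvgrPdist_lt/(_ _ t1)[n _ /(_ n (leqnn n)) /= h] := cvg_expr tn.
  exists n; move: h.
  rewrite sub0r normrN ger0_norm ?exprn_ge0 ?(ltW theta0)// => /ltW.
  rewrite ler_pdivlMr ?mulr_gt0 ?ltr_wpDl// => h; apply: le_trans h.
  by rewrite mulrAC mulrC ler_pM2l ?exprn_gt0// ler_pM2l// lerDl ler01.
have cphi : continuous phi.
  move=> s; apply/cvgrPdist_le => t t0.
  have t3 : 0 < t / 3 by rewrite divr_gt0.
  have Zs1 : 0 <= Z s + 1 by rewrite addr_ge0// ltW.
  have [n Hn] := small _ _ Zs1 t3.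
  have cZ : {for s, continuous Z} by have [d _] := ZC2 s; exact: is_derive_continuous d.
  have [cF _] := aF n.
  have nZ : \forall x \near s, Z x < Z s + 1.
    by apply: (cZ [set y | y < Z s + 1]); apply: lt_nbhsl; rewrite ltrDl.
  have nF : \forall x \near s, `|F n s - F n x| <= t / 3.
    by move/cvgrPdist_le : (cF s) => /(_ _ t3).
  near=> x.
  have hZ : Z x < Z s + 1 by near: x.
  have hF : `|F n s - F n x| <= t / 3 by near: x.
  have Kn0 : 0 <= K * theta ^+ n by rewrite mulr_ge0 ?exprn_ge0 ?(ltW K0) ?(ltW theta0).
  have b1 : K * theta ^+ n * Z s <= t / 3.
    by apply: le_trans Hn; rewrite ler_wpM2l// lerDl ler01.
  have b2 : K * theta ^+ n * Z x <= t / 3.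
    by apply: le_trans Hn; rewrite ler_wpM2l// ltW.
  have := close n s; have := close n x; move: hF b1 b2; rewrite !ler_norml.
  set u := K * _ * _; set v := K * _ * _.
  move: (F n s) (F n x) (phi s) (phi x) => a b d e.
  move=> /andP[? ?] ? ? /andP[? ?] /andP[? ?]; apply/andP; split; lra.
have aphi : admissible phi.
  split=> // s; split; last exact: (phi_le 0%N).
  - by apply: phi_glb => n; have [_ /(_ s)[]] := aF n.
  - by apply: phi_glb => n; have [_ /(_ s)[]] := aF n.
have fixed : S phi = phi.
  apply/funext => s.
  have cl n : 0 <= F n.+1 s - S phi s <= K * theta ^+ n * theta * Z s.
    apply: (Scontr _ _ _ (aF n) aphi) => //.
    by rewrite mulr_ge0 ?exprn_ge0 ?(ltW K0) ?(ltW theta0).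
  have Zs := ltW (Z0 s).
  apply/le_anti/andP; split; apply/ler_addgt0Pr => t t0;
    have [n Hn] := small _ _ Zs t0;
    have /andP[h1 h2] := cl n; have /andP[h3 h4] := close n.+1 s.
  - move: h1 h3 h4; rewrite exprS; have : K * (theta * theta ^+ n) * Z s <= t.
      apply: le_trans Hn; move: (KZ0 n s) (ltW theta1) => u0 v1.
      have -> : K * (theta * theta ^+ n) * Z s = theta * (K * theta ^+ n * Z s).
        by set q := theta ^+ n; ring.
      by rewrite ler_piMl.
    set u := K * _ * _; move: (F n.+1 s) (S phi s) (phi s) => a b d; lra.
  - move: h1 h2 h3; have : K * theta ^+ n * theta * Z s <= t.
      apply: le_trans Hn; move: (KZ0 n s) (ltW theta1) => u0 v1.
      have -> : K * theta ^+ n * theta * Z s = theta * (K * theta ^+ n * Z s).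
        by set q := theta ^+ n; ring.
      by rewrite ler_piMl.
    set u := K * _ * _ * _; move: (F n.+1 s) (S phi s) (phi s) => a b d; lra.
have C2phi := SC2 phi aphi; have opphi := Sop phi ^~ aphi.
rewrite fixed in C2phi opphi; have [_ bphi] := aphi.
exists phi, (T phi).1.2, (T phi).2; split=> // s.
- by have [h _ _] := bphi s; rewrite (lt_le_trans _ h).
- have := opphi s; rewrite /coercive /rhs => h.
  by move/addIr: h.
- by have [_ h1 h2] := bphi s; rewrite h1.
Unshelve. all: by end_near. Qed.

End MonotoneIteration.


(** * Radial profiles *)

Section RadialProfile.
Variables (R : realType) (k alpha beta p : R).
Hypotheses (k0 : 0 < k) (beta0 : 0 < beta) (p0 : 0 < p).
Hypotheses (Halpha : alpha < - 2) (Hexp : 0 < 2 + alpha + beta + k * (1 + p)).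
Implicit Types (s : R).

(** The weight times [|x|^2], in the variable [s = ln |x|]. *)
Definition source s : R := expR ((2 + alpha) * s) * ln (1 + expR s) `^ beta.

Let ell s : R := ln (1 + expR s).

Let ell_gt0 s : 0 < ell s.
Proof. by rewrite /ell ln1D_gt0// expR_gt0. Qed.

Let source_pos s : 0 < source s.
Proof. by rewrite mulr_gt0 ?expR_gt0// powR_gt0// ell_gt0. Qed.

Let p1 : 0 < 1 + p. Proof. by rewrite addr_gt0. Qed.

Let eta s : R := expR s / (1 + expR s).

Let e1_gt0 s : 0 < 1 + expR s. Proof. by rewrite addr_gt0// expR_gt0. Qed.

Let eta01 s : 0 < eta s < 1.
Proof.
by rewrite divr_gt0 ?expR_gt0//= ltr_pdivrMr// mul1r ltrDr.
Qed.

Let omega s : R := eta s / ell s.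

Let omega01 s : 0 < omega s <= 1.
Proof.
have /andP[h _] := eta01 s.
rewrite divr_gt0//= ler_pdivrMr// mul1r.
by apply: ln1D_ge; exact: expR_gt0.
Qed.

Let is_derive_ell s : is_derive s 1 ell (eta s).
Proof.
have H := is_derive_compf (g := fun s => 1 + expR s) (is_derive1_ln (e1_gt0 s))
  (is_derive_addf (is_derive_cst (1 : R) s 1) (is_derive_expR s)).
by apply: (is_derive_eq H); rewrite add0r mulrC.
Qed.

Let is_derive_eta s : is_derive s 1 eta (eta s * (1 - eta s)).
Proof.
have n0 : 1 + expR s != 0 by rewrite gt_eqF.
have H := is_derive_mulf (is_derive_expR s)
  (is_derive_invf (is_derive_addf (is_derive_cst (1 : R) s 1) (is_derive_expR s))
    n0).
apply: (is_derive_eq H).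
rewrite /eta /cst add0r; set e := expR s in n0 *.
by field.
Qed.

Let is_derive_omega s :
  is_derive s 1 omega (omega s * (1 - eta s) - omega s ^+ 2).
Proof.
have n0 : ell s != 0 by rewrite gt_eqF.
have H := is_derive_mulf (is_derive_eta s) (is_derive_invf (is_derive_ell s) n0).
apply: (is_derive_eq H).
rewrite /omega; move: (eta s) (ell s) n0 => a b n0.
by field.
Qed.

(* [root] is [source] to the power [1 / (1 + p)], written as an exponential with
   a view to differentiating it; [slope] is its logarithmic derivative. *)
Let a1 := (2 + alpha) / (1 + p).
Let b1 := beta / (1 + p).

Let root s : R := expR (a1 * s + b1 * ln (ell s)).
Let slope s : R := a1 + b1 * omega s.
Let slope' s : R := b1 * (omega s * (1 - eta s) - omega s ^+ 2).

Let b1_gt0 : 0 < b1. Proof. exact: divr_gt0. Qed.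

Let rootE s : root s `^ (1 + p) = source s.
Proof.
rewrite /root -expRM /source (powR_expR _ (ell_gt0 s)) -expRD; congr expR.
by rewrite /a1 /b1; set l := ln (ell s); field; rewrite gt_eqF.
Qed.

Let root_C2 : C2_with root (fun s => slope s * root s)
  (fun s => (slope s ^+ 2 + slope' s) * root s).
Proof.
have dL s : is_derive s 1 (fun s => a1 * s + b1 * ln (ell s)) (slope s).
  have H := is_derive_addf (is_derive_scalef a1 (is_derive_id s 1))
    (is_derive_scalef b1 (is_derive_compf (is_derive1_ln (ell_gt0 s))
       (is_derive_ell s))).
  apply: (is_derive_eq H).
  by rewrite mulr1 /slope /omega; congr (_ + b1 * _); rewrite mulrC.
have dr s : is_derive s 1 root (slope s * root s).
  have H := is_derive_compf (is_derive_expR _) (dL s).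
  by apply: (is_derive_eq H); rewrite mulrC.
move=> s; split; first exact: dr.
have ds : is_derive s 1 slope (slope' s).
  have H := is_derive_addf (is_derive_cst a1 s 1)
    (is_derive_scalef b1 (is_derive_omega s)).
  by apply: (is_derive_eq H); rewrite add0r.
have H := is_derive_mulf ds (dr s).
by apply: (is_derive_eq H); ring.
Qed.

Let C0 : R := b1 + k * (`|a1| + b1).

Let C0_gt0 : 0 < C0.
Proof. by rewrite ltr_wpDr// mulr_ge0 ?addr_ge0// ltW. Qed.

Let root_gt0 s : 0 < root s. Proof. exact: expR_gt0. Qed.

(** The logarithmic derivatives of the source are bounded, because
    [x / (1 + x) <= ln (1 + x)]. *)
Let root_bound s : - ((slope s ^+ 2 + slope' s) * root s) -
  k * (slope s * root s) <= C0 * root s.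
Proof.
have -> : - ((slope s ^+ 2 + slope' s) * root s) - k * (slope s * root s) =
  (- (slope s ^+ 2) + - slope' s + k * - slope s) * root s by ring.
rewrite ler_pM2r//.
have /andP[om0 om1] := omega01 s; have /andP[/ltW e0 /ltW e1] := eta01 s.
have h1 : - slope' s <= b1.
  rewrite /slope' -mulrN -[leRHS]mulr1 ler_pM2l// opprB.
  apply: (@le_trans _ _ (omega s ^+ 2)).
    by rewrite gerBl mulr_ge0 ?(ltW om0)// subr_ge0.
  by rewrite expr_le1// ltW.
have h2 : - slope s <= `|a1| + b1.
  rewrite /slope opprD lerD//; first by rewrite -normrN ler_norm.
  apply: (@le_trans _ _ 0); last exact: ltW.
  by rewrite oppr_le0 mulr_ge0 ?(ltW b1_gt0) ?(ltW om0).
have h3 : - (slope s ^+ 2) <= 0 by rewrite oppr_le0 sqr_ge0.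
have h4 : k * - slope s <= k * (`|a1| + b1) by rewrite ler_pM2l.
rewrite /C0; move: h1 h3 h4; set x := - (_ ^+ 2); set y := - slope' s.
by set z := k * - _; set w := k * _; lra.
Qed.

(* The exponents of the supersolution at infinity, [qi], and at the origin,
   [q0].  The conditions on [alpha], [beta] and [p] are what makes room for them
   in the open interval from [0] to [k]. *)
Let qi := Num.min (k / 2) (- (2 + alpha) / (2 * (1 + p))).
Let q0 := Num.max (k / 2) (- (2 + alpha + beta) / (1 + p)).

Let k2 : 0 < k / 2. Proof. exact: divr_gt0. Qed.
Let k2k : k / 2 < k. Proof. by rewrite ltr_pdivrMr// ltr_pMr// ltr1n. Qed.

Let al2 : 0 < - (2 + alpha). Proof. by move: Halpha; lra. Qed.

Let qi_itv : 0 < qi < k.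
Proof.
rewrite /qi lt_min k2/= gt_min k2k/= andbT divr_gt0//.
by rewrite mulr_gt0.
Qed.

Let q0_itv : 0 < q0 < k.
Proof.
rewrite /q0 lt_max k2/= gt_max k2k/= ltr_pdivrMr//.
by move: Hexp; set w := k * _; lra.
Qed.

Let power_ge s : 0 <= s -> forall x y : R, x <= y -> expR (x * s) <= expR (y * s).
Proof. by move=> s0 x y xy; rewrite ler_expR ler_wpM2r. Qed.

(* A small power absorbs the logarithm. *)
Let source_le_pos : exists2 C, 1 <= C & forall s, 0 <= s ->
  source s <= C * expR (- qi * (1 + p) * s).
Proof.
pose e := Num.min 1 (- (2 + alpha) / (2 * beta)).
have e0 : 0 < e by rewrite lt_min ltr01/= divr_gt0// mulr_gt0.
have e1 : e <= 1 by rewrite ge_min lexx.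
exists (e^-1 `^ beta).
  have E1 : (1 : R) `^ beta = 1 by rewrite powR1.
  rewrite -[leLHS]E1; apply: ge0_ler_powR; rewrite ?nnegrE ?invr_ge0 ?(ltW beta0) ?(ltW e0)//.
  by rewrite invf_ge1.
move=> s s0; rewrite /source.
have l1 : ell s <= e^-1 * expR (e * s).
  apply: (@le_trans _ _ (1 + s)).
    rewrite /ell -ler_expR lnK ?posrE//.
    rewrite expRD; apply: (@le_trans _ _ (2 * expR s)).
      by rewrite mulr_natl mulr2n lerD2r -(expR0 R) ler_expR.
    rewrite ler_pM2r ?expR_gt0//; exact: (expR_ge1Dx (1 : R)).
  rewrite ler_pdivlMl//; apply: le_trans (expR_ge1Dx _).
  by rewrite mulrDr mulr1 lerD2r.
have lb : ell s `^ beta <= e^-1 `^ beta * expR (e * beta * s).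
  apply: (@le_trans _ _ ((e^-1 * expR (e * s)) `^ beta)).
    apply: ge0_ler_powR; rewrite ?nnegrE ?(ltW beta0) ?(ltW (ell_gt0 s))//.
    by rewrite mulr_ge0 ?expR_ge0// invr_ge0 ltW.
  by rewrite powRM ?expR_ge0 ?invr_ge0 ?(ltW e0)// -expRM mulrAC.
apply: (@le_trans _ _ (expR ((2 + alpha) * s) * (e^-1 `^ beta * expR (e * beta * s)))).
  by rewrite ler_pM2l ?expR_gt0.
rewrite mulrCA -expRD ler_pM2l; last by rewrite powR_gt0// invr_gt0.
rewrite -mulrDl; apply: power_ge => //.
have eb : e * beta <= - (2 + alpha) / 2.
  rewrite ler_pdivlMr// -mulrA [beta * 2]mulrC -ler_pdivlMr ?mulr_gt0//.
  by rewrite ge_min lexx orbT.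
have qp : qi * (1 + p) <= - (2 + alpha) / 2.
  rewrite ler_pdivlMr// -mulrA [(1 + p) * 2]mulrC -ler_pdivlMr ?mulr_gt0//.
  by rewrite ge_min lexx orbT.
rewrite [leRHS]mulNr.
by move: eb qp; set x := e * _; set y := qi * _; lra.
Qed.

Let source_le_neg s : s <= 0 -> source s <= expR (- q0 * (1 + p) * s).
Proof.
move=> s0; rewrite /source.
apply: (@le_trans _ _ (expR ((2 + alpha) * s) * expR (beta * s))).
  rewrite ler_pM2l ?expR_gt0// mulrC expRM.
  apply: ge0_ler_powR; rewrite ?nnegrE ?(ltW beta0) ?expR_ge0 ?(ltW (ell_gt0 s))//.
  by rewrite le_ln1Dx// (lt_trans _ (expR_gt0 s))// oppr_lt0.
rewrite -expRD -mulrDl ler_expR ler_wnM2r//.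
have : - (2 + alpha + beta) / (1 + p) <= q0 by rewrite le_max lexx orbT.
by rewrite ler_pdivrMr// [- q0 * _]mulNr; set x := q0 * _; lra.
Qed.

Let expo q s : R := expR (- q * s).

Let source_le_expo : exists2 C, 1 <= C & forall s, exists2 q, q = q0 \/ q = qi &
  source s <= C * expo q s `^ (1 + p).
Proof.
have [C C1 HC] := source_le_pos; exists C => // s.
have [s0|/ltW s0] := lerP 0 s.
  exists qi; first by right.
  by rewrite /expo -expRM mulrAC; exact: HC.
exists q0; first by left.
rewrite /expo -expRM mulrAC; apply: le_trans (source_le_neg s0) _.
by rewrite ler_peMl// expR_ge0.
Qed.

Let expo_growth q s : 0 < q < k -> expo q s <= growth k s.
Proof.
move=> /andP[/ltW q_ge0 /ltW qk]; rewrite /growth /expo.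
have [s0|/ltW s0] := lerP 0 s.
  by rewrite ler_wpDr ?expR_ge0// expR_le1 mulNr oppr_le0 mulr_ge0.
by rewrite ler_wpDl// ler_expR ler_wnM2r// lerN2.
Qed.

(** Existence of the radial solutions in the variable [s = ln |x|].  The
    supersolution is the fundamental one plus a sum of two powers of [|x|], one
    for each end; the subsolution is the multiple of [(|x|^2 f)^(1 / (1 + p))]
    that the slope of the nonlinearity allows. *)
Theorem radial_profile (a b : R) : 0 <= a -> 0 <= b ->
  exists f f1 f2, [/\ C2_with f f1 f2, forall s, 0 < f s,
    forall s, - f2 s - k * f1 s = source s * f s `^ (- p) &
    exists A q q', [/\ 0 < q < k, 0 < q' < k & forall s,
      b + a * expR (- k * s) <= f s <=
      b + a * expR (- k * s) + A * (expR (- q * s) + expR (- q' * s))]].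
Proof.
move=> a0 b0; have [C C1 HC] := source_le_expo.
have C_gt0 : 0 < C by rewrite (lt_le_trans ltr01).
have /andP[qi0 qik] := qi_itv; have /andP[q00 q0k] := q0_itv.
pose sigma := Num.min (qi * (k - qi)) (q0 * (k - q0)).
have sigma0 : 0 < sigma by rewrite lt_min !mulr_gt0// subr_gt0.
have i1 : (1 + p)^-1 * (1 + p) = 1 by rewrite mulVf// gt_eqF.
(* [A^(1 + p) sigma = C] is what turns [source_le_expo] into [Z_super]. *)
pose A := (C / sigma) `^ (1 + p)^-1.
have A0 : 0 < A by rewrite powR_gt0// divr_gt0.
have AE : A `^ (1 + p) * sigma = C.
  by rewrite /A -powRrM i1 powRr1 ?divfK ?gt_eqF// divr_ge0// ltW.
pose Z s := A * (expo q0 s + expo qi s).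
have ZC2 := C2_with_scale A (C2_with_add (C2_with_expR (- q0)) (C2_with_expR (- qi))).
have eq_ge q s : q = q0 \/ q = qi -> expo q s <= expo q0 s + expo qi s.
  by case=> ->; rewrite ?lerDl ?lerDr expR_ge0.
have Z0 s : 0 < Z s by rewrite mulr_gt0// addr_gt0// expR_gt0.
have opZ s : sigma * Z s <= - (A * (- q0 * (- q0 * expo q0 s) +
    - qi * (- qi * expo qi s))) - k * (A * (- q0 * expo q0 s + - qi * expo qi s)).
  have -> : - (A * (- q0 * (- q0 * expo q0 s) + - qi * (- qi * expo qi s))) -
      k * (A * (- q0 * expo q0 s + - qi * expo qi s)) =
      A * (q0 * (k - q0) * expo q0 s + qi * (k - qi) * expo qi s).
    by move: (expo q0 s) (expo qi s) (q0) (qi) => x y q q'; ring.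
  rewrite /Z mulrCA ler_pM2l// mulrDr lerD// ler_pM2r ?expR_gt0//.
    by rewrite ge_min lexx orbT.
  by rewrite ge_min lexx.
have Z_super s : source s * Z s `^ (- p) <= sigma * Z s.
  have [q qq Hq] := HC s.
  have E0 : 0 < expo q s by exact: expR_gt0.
  have ZE : A * expo q s <= Z s by rewrite ler_pM2l// eq_ge.
  apply: (@le_trans _ _ (C * expo q s `^ (1 + p) * (A * expo q s) `^ (- p))).
    apply: ler_pM; rewrite ?powR_ge0 ?(ltW (source_pos s))//.
    by apply: ler_powRN => //; exact: mulr_gt0.
  apply: (@le_trans _ _ (sigma * (A * expo q s))); last by rewrite ler_pM2l.
  rewrite le_eqVlt; apply/orP; left; apply/eqP.
  rewrite -AE !powR_addr// !powRr1 ?(ltW A0) ?(ltW E0)//.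
  rewrite powRM ?(ltW A0) ?(ltW E0)//.
  have := powR_opp_mul p A0; have := powR_opp_mul p E0.
  move: (A `^ p) (A `^ (- p)) (expo q s `^ p) (expo q s `^ (- p)) => x x' y y' yy xx.
  transitivity (A * sigma * expo q s * (x' * x) * (y' * y)); first by ring.
  by rewrite xx yy; ring.
pose D := C `^ (1 + p)^-1; have D0 : 0 < D by rewrite powR_gt0.
have root_le s : root s <= D / A * Z s.
  have [q qq Hq] := HC s; have E0 : 0 < expo q s by exact: expR_gt0.
  have -> : root s = source s `^ (1 + p)^-1.
    by rewrite -rootE -powRrM mulrC i1 powRr1// ltW.
  apply: (@le_trans _ _ ((C * expo q s `^ (1 + p)) `^ (1 + p)^-1)).
    apply: ge0_ler_powR => //; rewrite ?nnegrE ?invr_ge0 ?(ltW p1) ?(ltW (source_pos s))//.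
    by rewrite mulr_ge0 ?powR_ge0// ltW.
  rewrite powRM ?powR_ge0 ?(ltW C_gt0)// -powRrM [(1 + p) * _]mulrC i1 powRr1 ?(ltW E0)//.
  rewrite /Z mulrA divfK ?gt_eqF// ler_pM2l//; exact: eq_ge.
(* Small enough for [psi] to lie below [Z], and for the source to outweigh the
   bound [root_bound]. *)
pose kap := Num.min (A / D) (C0^-1 `^ (1 + p)^-1).
have kap0 : 0 < kap by rewrite lt_min divr_gt0//= powR_gt0// invr_gt0.
have kapC : C0 <= kap `^ (- (1 + p)).
  rewrite powRN -[leLHS]invrK lef_pV2 ?posrE ?invr_gt0 ?powR_gt0//.
  apply: (@le_trans _ _ ((C0^-1 `^ (1 + p)^-1) `^ (1 + p))).
    apply: ge0_ler_powR; rewrite ?nnegrE ?powR_ge0 ?(ltW p1) ?(ltW kap0)//.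
    by rewrite ge_min lexx orbT.
  by rewrite -powRrM i1 powRr1// invr_ge0 ltW.
pose psi s := kap * root s.
have psi0 s : 0 < psi s by rewrite mulr_gt0.
have psiC2 := C2_with_scale kap root_C2.
have slopeE s : source s * psi s `^ (- p - 1) = kap `^ (- (1 + p)).
  have -> : - p - 1 = - (1 + p) by ring.
  rewrite powRM ?(ltW kap0) ?(ltW (root_gt0 s))// mulrCA -rootE.
  by rewrite [X in _ * X]mulrC powR_opp_mul// mulr1.
have psi_sub s : - (kap * ((slope s ^+ 2 + slope' s) * root s)) -
    k * (kap * (slope s * root s)) <= source s * psi s `^ (- p).
  have -> : psi s `^ (- p) = psi s `^ (- p - 1) * psi s.
    rewrite powR_addr// powR_inv1 ?(ltW (psi0 s))//.
    by rewrite divfK// gt_eqF.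
  rewrite mulrA slopeE /psi.
  apply: (@le_trans _ _ (C0 * (kap * root s))); last by rewrite ler_pM2r// mulr_gt0.
  have := root_bound s; rewrite -(ler_pM2l kap0);
  set x := _ * root s; set y := slope s * root s; set z := root s.
  have -> : kap * (- x - k * y) = - (kap * x) - k * (kap * y) by ring.
  by have -> : kap * (C0 * z) = C0 * (kap * z) by ring.
(* The slope of the nonlinearity along [psi] is a constant, which
   [c = nu (nu + k)] has to dominate. *)
pose nu := 1 + p * kap `^ (- (1 + p)) / k.
have K0 : 0 < kap `^ (- (1 + p)) by rewrite powR_gt0.
have nu0 : 0 < nu by rewrite addr_gt0// divr_gt0// mulr_gt0.
have psi_slope s : p * (source s * psi s `^ (- p - 1)) <= nu * (nu + k).
  rewrite slopeE; apply: (@le_trans _ _ (nu * k)).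
    by rewrite /nu mulrDl mul1r divfK ?gt_eqF// lerDr ltW.
  by rewrite ler_pM2l// lerDr ltW.
have psi_Z s : psi s <= Z s.
  apply: (@le_trans _ _ (A / D * (D / A * Z s))).
    apply: ler_pM; rewrite ?(ltW kap0) ?(ltW (root_gt0 s))//.
    by rewrite ge_min lexx.
  rewrite le_eqVlt; apply/orP; left; apply/eqP.
  by move: (Z s) => z; field; rewrite !gt_eqF.
pose H s := b + a * expR (- k * s).
have HC2 := C2_with_add (C2_with_cst b) (C2_with_scale a (C2_with_expR (- k))).
have H_ge0 s : 0 <= H s by rewrite addr_ge0// mulr_ge0// expR_ge0.
have H_harm s : - (0 + a * (- k * (- k * expR (- k * s)))) -
    k * (0 + a * (- k * expR (- k * s))) = 0.
  by set e := expR _; ring.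
pose CZ := a + b + 2 * A.
have H_growth s : H s <= CZ * growth k s.
  apply: (@le_trans _ _ ((a + b) * growth k s)); last first.
    by rewrite ler_wpM2r ?growth_ge0// lerDl mulr_ge0// ltW.
  rewrite /H /growth; set e := expR _; have e0 : 0 <= e by exact: expR_ge0.
  have -> : (a + b) * (1 + e) = b + a * e + (a + b * e) by ring.
  by rewrite lerDl addr_ge0// mulr_ge0.
have Z_growth s : Z s <= CZ * growth k s.
  apply: (@le_trans _ _ (2 * A * growth k s)); last first.
    by rewrite ler_wpM2r ?growth_ge0// lerDr addr_ge0.
  rewrite /Z [2 * A]mulrC -mulrA ler_pM2l// mulr_natl mulr2n.
  by rewrite lerD// expo_growth.
have csource : continuous source.
  have -> : source = fun s => root s `^ (1 + p) by apply/funext => s; rewrite rootE.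
  move=> s; apply: (@continuous_comp _ _ _ root (fun t => t `^ (1 + p))).
    by have [d _] := root_C2 s; exact: (is_derive_continuous d).
  exact: (is_derive_continuous (is_derive1_powR (1 + p) (root_gt0 s))).
have [f [f1 [f2 [fC2 f0 fE fb]]]] := @monotone_iteration R k nu p source psi _ _
  Z _ _ H _ _ sigma CZ k0 nu0 p0 csource source_pos psiC2 psi0 psi_sub psi_slope
  ZC2 Z0 (fun s => le_trans (Z_super s) (opZ s)) sigma0 opZ HC2 H_ge0 H_harm
  H_growth Z_growth psi_Z.
by exists f, f1, f2; split=> //; exists A, q0, qi.
Qed.

End RadialProfile.


(** * Radial functions *)

Section RadialFunctions.
Variables (R : realType) (N : nat).
Implicit Types (w : 'rV[R]_N -> R) (x y : 'rV[R]_N).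

Lemma jet2_is_derive (g : R -> R) (g1 g2 : R) :
  jet2 g g1 g2 -> is_derive (0 : R) 1 g g1.
Proof. by move=> [g' [/nbhs_singleton dg <- _]]. Qed.

Lemma is_derive_jet2 w x v (g1 g2 : R) :
  jet2 (fun h : R => w (h *: v + x)) g1 g2 -> is_derive x v w g1.
Proof.
move=> /jet2_is_derive H; have := (is_derive_line w x v 0 g1).2 H.
by rewrite scale0r add0r.
Qed.

Lemma is_derive_chain w x v (psi : R -> R) (a b : R) :
  is_derive (w x) 1 psi a -> is_derive x v w b ->
  is_derive x v (fun y => psi (w y)) (a * b).
Proof.
move=> dpsi dw.
have line (f : 'rV[R]_N -> R) (c : R) : is_derive x v f c <->
    is_derive (0 : R) 1 (fun h : R => f (h *: v + x)) c.
  by have := is_derive_line f x v 0 c; rewrite scale0r add0r.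
apply: (line (fun y => psi (w y)) _).2.
apply: (@is_derive_compf R psi (fun h : R => w (h *: v + x))).
  by rewrite scale0r add0r.
exact: (line w b).1.
Qed.

Lemma near_eq_continuous (f g : 'rV[R]_N -> R) x :
  (\forall y \near x, f y = g y) -> {for x, continuous g} ->
  {for x, continuous f}.
Proof.
move=> fg cg; rewrite /prop_for /continuous_at (nbhs_singleton fg).
have gf : \forall y \near x, g y = f y by apply: (filterS _ fg) => y.
exact: (cvg_trans (near_eq_cvg gf) cg).
Qed.

Local Notation Q := (@sqdist R N 0).
Local Notation k := (N%:R - 2 : R).

Lemma sqdist0_gt0 x : x != 0 -> 0 < Q x.
Proof.
by move=> x0; rewrite -enorm_sqdist exprn_gt0// enorm_gt0 subr0.
Qed.

Lemma is_derive_sqdist0 x i : is_derive x (delta_mx ord0 i) Q (2 * x ord0 i).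
Proof.
have [l jl _] := lap_at_sqdist 0 x.
apply: (is_derive_eq (is_derive_jet2 (jl i))).
by rewrite mxE subr0.
Qed.

Lemma is_derive_coord x i j :
  is_derive x (delta_mx ord0 j) (fun y => y ord0 i) ((i == j)%:R).
Proof.
apply: (@is_derive_jet2 _ _ _ _ 0).
rewrite (_ : (fun h : R => _) = fun h => h * (i == j)%:R + x ord0 i).
  exact: jet2_id.
by apply/funext => h; rewrite line_coord.
Qed.

Lemma ln_enorm x : x != 0 -> ln (enorm x) = 2^-1 * ln (Q x).
Proof.
move=> x0; have r0 : 0 < enorm x by rewrite enorm_gt0.
rewrite -enorm_sqdist subr0 lnXn// -[X in _ = _ * X]mulr_natl.
by rewrite mulKf// pnatr_eq0.
Qed.

Variables (f f1 f2 : R -> R).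
Hypotheses (fC2 : C2_with f f1 f2) (cf2 : continuous f2).

(* [s] is [ln (enorm x)] off the origin; the square of the norm is preferred
   because its partial derivatives are linear. *)
Let s x := 2^-1 * ln (Q x).

Let d1 i x := f1 (s x) * (x ord0 i * (Q x)^-1).

Let d2 i j x := (f2 (s x) * (x ord0 j * (Q x)^-1)) * (x ord0 i * (Q x)^-1) +
  f1 (s x) * ((i == j)%:R * (Q x)^-1 +
    x ord0 i * (- (Q x) ^- 2 * (2 * x ord0 j))).

Let is_derive_s i x : x != 0 ->
  is_derive x (delta_mx ord0 i) s (x ord0 i * (Q x)^-1).
Proof.
move=> x0; have q0 := sqdist0_gt0 x0.
have H := is_derive_scalef 2^-1 (is_derive_chain (is_derive1_ln q0)
  (is_derive_sqdist0 x i)).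
by apply: (is_derive_eq H); field; rewrite gt_eqF.
Qed.

Let is_derive_f_s (g g1 : R -> R) i x : (forall t : R, is_derive t 1 g (g1 t)) ->
  x != 0 -> is_derive x (delta_mx ord0 i) (fun y => g (s y))
    (g1 (s x) * (x ord0 i * (Q x)^-1)).
Proof. by move=> dg x0; exact: (is_derive_chain (dg _) (is_derive_s i x0)). Qed.

Let is_derive_d1 i j x : x != 0 ->
  is_derive x (delta_mx ord0 j) (d1 i) (d2 i j x).
Proof.
move=> x0; have q0 : Q x != 0 by rewrite gt_eqF// sqdist0_gt0.
have df1 (t : R) : is_derive t 1 f1 (f2 t) by have [_ d] := fC2 t.
have dV : is_derive x (delta_mx ord0 j) (fun y => (Q y)^-1)
    (- (Q x) ^- 2 * (2 * x ord0 j)).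
  have H := is_derive_chain (is_derive_invf (is_derive_id (Q x) 1) q0)
    (is_derive_sqdist0 x j).
  by apply: (is_derive_eq H); rewrite mulr1.
exact: (is_derive_mulf (is_derive_f_s j df1 x0)
  (is_derive_mulf (is_derive_coord x i j) dV)).
Qed.

Let s_continuous x : x != 0 -> {for x, continuous s}.
Proof.
move=> x0; have q0 := sqdist0_gt0 x0.
apply: (continuousM (@cst_continuous _ _ (2^-1 : R) x)).
apply: (@continuous_comp _ _ _ Q (fun t : R => ln t)); first exact: sqdist_continuous.
exact: continuous_ln.
Qed.

Let cQV x : x != 0 -> {for x, continuous (fun y => (Q y)^-1)}.
Proof.
move=> x0; apply: continuousV; first by rewrite gt_eqF// sqdist0_gt0.
exact: sqdist_continuous.
Qed.

Let comp_continuous (g : R -> R) x : continuous g -> x != 0 ->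
  {for x, continuous (fun y => g (s y))}.
Proof.
move=> cg x0; apply: (@continuous_comp _ _ _ s g); last exact: cg.
exact: s_continuous.
Qed.

Let cd1 i x : x != 0 -> {for x, continuous (d1 i)}.
Proof.
move=> x0; have cf1 : continuous f1.
  by move=> t; have [_ d] := fC2 t; exact: (is_derive_continuous d).
exact: (continuousM (comp_continuous cf1 x0)
  (continuousM (@coord_continuous1 _ _ i x) (cQV x0))).
Qed.

Let cd2 i j x : x != 0 -> {for x, continuous (d2 i j)}.
Proof.
move=> x0; have cf1 : continuous f1.
  by move=> t; have [_ d] := fC2 t; exact: (is_derive_continuous d).
have cc (c : R) := @cst_continuous 'rV[R]_N R c x.
have ci l := @coord_continuous1 R N l x.
have cV := cQV x0.
have e1 := continuousM (continuousM (comp_continuous cf2 x0)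
  (continuousM (ci j) cV)) (continuousM (ci i) cV).
have eN : {for x, continuous (fun y => - (Q y) ^- 2)}.
  rewrite (_ : (fun _ => _) = fun y => - ((Q y)^-1 * (Q y)^-1)).
    exact: continuousN (continuousM cV cV).
  by apply/funext => y; rewrite -exprVn expr2.
have e2 := continuousM (comp_continuous cf1 x0) (continuousD
  (continuousM (cc (i == j)%:R) cV)
  (continuousM (ci i) (continuousM eN (continuousM (cc 2) (ci j))))).
exact: (continuousD e1 e2).
Qed.

Let near_neq0 x : x != 0 -> \forall y \near x, y != 0.
Proof.
move=> x0; apply: (@open_nbhs_nbhs _ x [set y : 'rV[R]_N | y != 0]).
by split; [exact: open_neq0|].
Qed.

Variables (u : 'rV[R]_N -> R).
Hypothesis uE : forall x, x != 0 -> u x = f (ln (enorm x)).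

Let u_s x : x != 0 -> u x = f (s x).
Proof. by move=> x0; rewrite uE// ln_enorm. Qed.

Let near_u x : x != 0 -> \forall y \near x, f (s y) = u y.
Proof. by move=> x0; apply: filterS (near_neq0 x0) => y /u_s. Qed.

Let d1P i x : x != 0 -> is_derive x (delta_mx ord0 i) u (d1 i x).
Proof.
move=> x0; apply: near_eq_is_derive (near_u x0) _.
by apply: is_derive_f_s => // t; have [] := fC2 t.
Qed.

Let near_d1 i x : x != 0 -> \forall y \near x, d1 i y = partial i u y.
Proof.
move=> x0; apply: (filterS _ (near_neq0 x0)) => y y0.
by have [_ <-] := d1P i y0.
Qed.

Let d2P i j x : x != 0 ->
  is_derive x (delta_mx ord0 j) (partial i u) (d2 i j x).
Proof.
move=> x0; apply: near_eq_is_derive (near_d1 i x0) _.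
exact: is_derive_d1.
Qed.

Lemma radial_C2_on : C2_on [set x | x != 0] u.
Proof.
move=> x /= x0.
have sym (g h : 'rV[R]_N -> R) : (\forall y \near x, g y = h y) ->
    \forall y \near x, h y = g y by move=> gh; apply: (filterS _ gh) => y.
split.
- apply: near_eq_continuous (sym _ _ (near_u x0)) _.
  apply: comp_continuous => // t; have [d _] := fC2 t.
  exact: (is_derive_continuous d).
- move=> i; split; first by have [] := d1P i x0.
  apply: (near_eq_continuous (g := d1 i)); last exact: cd1.
  exact: (sym _ _ (near_d1 i x0)).
- move=> i j; split; first by have [] := d2P i j x0.
  apply: (near_eq_continuous (g := d2 i j)); last exact: cd2.
  apply: (filterS _ (near_neq0 x0)) => y y0.
  by have [_ <-] := d2P i j y0.
Qed.

Lemma radial_laplacian x : x != 0 -> laplacian u x =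
  (f2 (ln (enorm x)) + k * f1 (ln (enorm x))) / enorm x ^+ 2.
Proof.
move=> x0; have q0 : Q x != 0 by rewrite gt_eqF// sqdist0_gt0.
have -> : enorm x ^+ 2 = Q x by rewrite -enorm_sqdist subr0.
rewrite ln_enorm// -/(s x) /laplacian.
under eq_bigr => i _.
  have -> : partial i (partial i u) x =
      (f2 (s x) * (Q x)^-1 ^+ 2 - 2 * f1 (s x) * (Q x)^-1 ^+ 2) * x ord0 i ^+ 2 +
      f1 (s x) * (Q x)^-1.
    have E : partial i (partial i u) x = d2 i i x by have [_ E'] := d2P i i x0.
    rewrite E /d2 [(i == i)%:R](_ : _ = 1) ?eqxx// -exprVn.
    by move: (Q x)^-1 (x ord0 i) (f1 (s x)) (f2 (s x)) => a b c d; ring.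
  over.
rewrite big_split/= -mulr_sumr sumr_const card_ord.
have -> : \sum_(i < N) x ord0 i ^+ 2 = Q x.
  by apply: eq_bigr => i _; rewrite mxE subr0.
rewrite -mulr_natr; field; exact: q0.
Qed.

End RadialFunctions.

(** * Existence of solutions *)

Section Existence.
Variables (R : realType) (N : nat) (alpha beta p : R).
Hypotheses (hN : (3 <= N)%N) (hbeta : 0 < beta) (hp : 0 < p).
Implicit Types (u v : 'rV[R]_N -> R) (x y z : 'rV[R]_N).

Local Notation sol := (positive_solution alpha beta p).
Local Notation k := (N%:R - 2 : R).

Let power_small (M q t : R) : 0 <= M -> 0 < q -> 0 < t ->
  exists2 d : R, 0 < d & forall r, 0 < r <= d -> M * r `^ q <= t.
Proof.
move=> M0 q0 t0; have [d d0 Hd] := powR_small (M / t) q0.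
exists d => // r rd; have := Hd r rd; rewrite ler_pdivrMr// => h.
have /andP[r0 _] := rd.
apply: (@le_trans _ _ (r `^ (- q) * t * r `^ q)).
  by rewrite ler_wpM2r// powR_ge0.
by rewrite mulrAC powR_opp_mul// mul1r.
Qed.

Let power_large (M q t : R) : 0 <= M -> 0 < q -> 0 < t ->
  exists r0 : R, forall r, r0 <= r -> 0 < r -> M * r `^ (- q) <= t.
Proof.
move=> M0 q0 t0; have [r0 _ Hr] := powR_large (M / t) q0.
exists r0 => r /Hr; rewrite ler_pdivrMr// => h rr.
by rewrite powRN ler_pdivrMr ?powR_gt0// mulrC.
Qed.

(** The two bounds of [radial_profile] differ by powers of [|x|] strictly between
    [0] and [2 - N], negligible against the parameters at both ends. *)
Lemma solution_exists (a b : R) :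
  0 < N%:R + alpha + beta + p * k -> alpha < - 2 -> 0 <= a -> 0 <= b ->
  exists u, [/\ sol u, radially_symmetric u & asymptotics u a b].
Proof.
move=> Hexp Hal a0 b0; have k0 := @codim_gt0 R N hN.
have Hexp' : 0 < 2 + alpha + beta + k * (1 + p).
  rewrite (_ : _ + _ = N%:R + alpha + beta + p * k)//; ring.
have [f [f1 [f2 [fC2 f0 fE [A [q [q' [/andP[q0 qk] /andP[q'0 q'k] fb]]]]]]]] :=
  radial_profile k0 hbeta hp Hal Hexp' a0 b0.
pose u x := f (ln (enorm x)).
have uE x : x != 0 -> u x = f (ln (enorm x)) by [].
have cf : continuous f by move=> t; have [d _] := fC2 t; exact: is_derive_continuous d.
have cf1 : continuous f1 by move=> t; have [_ d] := fC2 t; exact: is_derive_continuous d.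
have cf2 : continuous f2.
  have -> : f2 = fun s => - (k * f1 s) - (source alpha beta s * f s `^ (- p)).
    by apply/funext => s; rewrite -fE; ring.
  move=> s.
  have cs : {for s, continuous (source alpha beta)}.
    have c1 : {for s, continuous (fun s : R => ln (1 + expR s))}.
      apply: (@continuous_comp _ _ _ (fun s : R => 1 + expR s) (fun t : R => ln t)).
        exact: (continuousD (@cst_continuous R R 1 s) (@continuous_expR R s)).
      exact: continuous_ln.
    have c2 : {for s, continuous (fun s : R => ln (1 + expR s) `^ beta)}.
      apply: (@continuous_comp _ _ _ (fun s : R => ln (1 + expR s))
        (fun t : R => t `^ beta)) => //.
      apply: (is_derive_continuous (is_derive1_powR beta _)).
      by rewrite ln1D_gt0// expR_gt0.
    exact: (continuousM (is_derive_continuous (is_derive_expRM (2 + alpha) s)) c2).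
  have cp : {for s, continuous (fun s => f s `^ (- p))}.
    apply: (@continuous_comp _ _ _ f (fun t : R => t `^ (- p))); first exact: cf.
    exact: (is_derive_continuous (is_derive1_powR (- p) (f0 s))).
  exact: (continuousB (continuousN (continuousM (@cst_continuous R R k s) (cf1 s)))
    (continuousM cs cp)).
exists u; split.
- split; first exact: (radial_C2_on fC2 cf2 uE).
  + by move=> x _; exact: f0.
  + move=> x x0; have r0 : 0 < enorm x by rewrite enorm_gt0.
    rewrite (radial_laplacian fC2 uE x0) -mulNr opprD fE /u.
    rewrite /source expRM !lnK ?posrE//.
    have -> : expR (2 + alpha) `^ ln (enorm x) = enorm x ^+ 2 * enorm x `^ alpha.
      rewrite -expRM mulrC; transitivity (enorm x `^ (2 + alpha)).
        by rewrite powR_expR// mulrC.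
      by rewrite powR_addr// powR_sqr// ltW.
    by set P := enorm x `^ alpha; field; rewrite gt_eqF.
- by move=> x y _ _ xy; rewrite /u xy.
have ub x : x != 0 -> b + a * enorm x `^ (- k) <= u x <= b + a * enorm x `^ (- k) +
    A * (enorm x `^ (- q) + enorm x `^ (- q')).
  move=> x0; have r0 : 0 < enorm x by rewrite enorm_gt0.
  by rewrite !powR_expR//; exact: fb.
have [A_ge0|A_lt0] := lerP 0 A; last first.
  have [z z0] := @exists_neq0 R N hN; have := ub z z0 => /andP[h1 h2].
  have := le_trans h1 h2; rewrite lerDl leNgt pmulr_llt0 ?A_lt0//.
  by rewrite addr_gt0// powR_gt0// enorm_gt0.
split=> t t0; have t3 : 0 < t / 3 by rewrite divr_gt0.
  have [d1 d10 H1] := power_small b0 k0 t3.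
  have kq : 0 < k - q by rewrite subr_gt0.
  have kq' : 0 < k - q' by rewrite subr_gt0.
  have [d2 d20 H2] := power_small A_ge0 kq t3.
  have [d3 d30 H3] := power_small A_ge0 kq' t3.
  exists (Num.min d1 (Num.min d2 d3)); first by rewrite !lt_min d10 d20.
  move=> x x0; rewrite !le_min => /and3P[x1 x2 x3].
  have r0 : 0 < enorm x by rewrite enorm_gt0.
  have K0 : 0 < enorm x `^ k by rewrite powR_gt0.
  have h1 : b * enorm x `^ k <= t / 3 by apply: H1; rewrite r0.
  have h2 : A * enorm x `^ (k - q) <= t / 3 by apply: H2; rewrite r0.
  have h3 : A * enorm x `^ (k - q') <= t / 3 by apply: H3; rewrite r0.
  have /andP[l1 l2] := ub x x0.
  move: l1 l2; rewrite -(ler_pM2l K0) -[in X in _ -> X -> _](ler_pM2l K0).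
  have kk := powR_opp_mul k r0.
  rewrite (powR_addr k (- q) r0) in h2; rewrite (powR_addr k (- q') r0) in h3.
  move: kk K0 h1 h2 h3; move: (enorm x `^ k) (enorm x `^ (- k)) => K K'.
  move: (enorm x `^ (- q)) (enorm x `^ (- q')) (u x) => E E' U kk K0 h1 h2 h3 l1 l2.
  have bK : 0 <= b * K by rewrite mulr_ge0// ltW.
  have e1 : K * (b + a * K') = b * K + a * (K' * K) by ring.
  have e2 : K * (b + a * K' + A * (E + E')) = b * K + a * (K' * K) +
    A * (K * E) + A * (K * E') by ring.
  rewrite e1 kk mulr1 in l1; rewrite e2 kk mulr1 in l2.
  move: l1 l2 h1 h2 h3 bK; rewrite ler_norml.
  move: (K * U) (b * K) (A * _) (A * _) => v1 v2 v3 v4 ? ? ? ? ? ?.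
  by apply/andP; split; lra.
have [r1 H1] := power_large a0 k0 t3.
have [r2 H2] := power_large A_ge0 q0 t3.
have [r3 H3] := power_large A_ge0 q'0 t3.
exists (Num.max r1 (Num.max r2 r3)) => x x0; rewrite !ge_max => /and3P[x1 x2 x3].
have r0 : 0 < enorm x by rewrite enorm_gt0.
have := H1 _ x1 r0; have := H2 _ x2 r0; have := H3 _ x3 r0.
have /andP[l1 l2] := ub x x0.
have aK : 0 <= a * enorm x `^ (- k) by rewrite mulr_ge0// powR_ge0.
move: l1 l2 aK; rewrite ler_norml mulrDr.
move: (u x) (a * _) (A * _) (A * _) => v1 v2 v3 v4 ? ? ? ? ? ?.
by apply/andP; split; lra.
Qed.

Lemma asymptotics_cvg0 u (a b : R) : asymptotics u a b ->
  enorm x ^+ (N - 2) * u x @[x --> (0 : 'rV[R]_N)^'] --> a.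
Proof.
move=> [H _]; apply/cvgrPdist_le => t t0; have [d d0 Hd] := H t t0.
near=> x.
have x0 : x != 0 by near: x; exact: nbhs_dnbhs_neq.
rewrite -powR_codim ?enorm_ge0// distrC; apply: Hd => //.
near: x; apply: nbhs_dnbhs.
apply: (@enorm_continuous R N 0 [set s | s <= d]).
by apply: filterS (_ : nbhs _ [set s | s < d]) => [y /ltW//|];
  apply: lt_nbhsl; rewrite enorm0.
Unshelve. all: by end_near. Qed.

Lemma asymptotics_cvg_infty u (a b : R) : asymptotics u a b ->
  u x @[x --> @enorm_infty R N] --> b.
Proof.
move=> [_ H]; apply/cvgrPdist_le => t t0; have [r Hr] := H t t0.
exists (Num.max r 0) => // x /=; rewrite gt_max => /andP[rx x0].
by rewrite distrC; apply: Hr; [rewrite -enorm_gt0|exact: ltW].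
Qed.

End Existence.


(** * The classification *)

Theorem corollary1p8 (R : realType) (N : nat) (alpha beta p : R)
    (hN : (3 <= N)%N) (hbeta : 0 < beta) (hp : 0 < p) :
  ((exists u : 'rV[R]_N -> R, positive_solution alpha beta p u) <->
   (0 < N%:R + alpha + beta + p * (N%:R - 2) /\ alpha < - 2)) /\
  (0 < N%:R + alpha + beta + p * (N%:R - 2) /\ alpha < - 2 ->
   (exists U : R -> R -> 'rV[R]_N -> R,
      (forall a b : R, 0 <= a -> 0 <= b ->
         [/\ positive_solution alpha beta p (U a b),
             radially_symmetric (U a b),
             enorm x ^+ (N - 2) * U a b x @[x --> (0 : 'rV[R]_N)^'] --> a
           & U a b x @[x --> @enorm_infty R N] --> b]) /\
      (forall u : 'rV[R]_N -> R, positive_solution alpha beta p u ->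
         exists a b : R,
           [/\ 0 <= a, 0 <= b & forall x, x != 0 -> u x = U a b x])) /\
   ((exists xi : 'rV[R]_N -> R, minimal_solution alpha beta p xi) /\
    (forall xi : 'rV[R]_N -> R, minimal_solution alpha beta p xi ->
       (removable_singularity_at_origin xi <-> - 2 < alpha + beta)))).
Proof.
split.
  split=> [[u su]|[hexp hal]]; last first.
    have [u [su _ _]] :=
      solution_exists hN hbeta hp hexp hal (lexx 0) (lexx 0).
    by exists u.
  split; first exact: (solution_exponent hN hbeta hp su).
  exact: (solution_alpha hN hbeta hp su).
move=> [hexp hal].
have /choice[U HU] (ab : R * R) : exists u : 'rV[R]_N -> R,
    0 <= ab.1 -> 0 <= ab.2 -> [/\ positive_solution alpha beta p u,
      radially_symmetric u & asymptotics u ab.1 ab.2].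
  have [a0|a0] := pselect (0 <= ab.1); last by exists (fun=> 0).
  have [b0|b0] := pselect (0 <= ab.2); last by exists (fun=> 0).
  by have [u hu] := solution_exists hN hbeta hp hexp hal a0 b0; exists u.
have U_le a b u a' b' : 0 <= a -> 0 <= b -> positive_solution alpha beta p u ->
    asymptotics u a' b' -> a <= a' -> b <= b' ->
    forall x, x != 0 -> U (a, b) x <= u x.
  move=> a0 b0 su ua aa bb; have [sU _ Ua] := HU (a, b) a0 b0.
  exact: (asymptotics_le hp sU su Ua ua).
have [s0 _ as0] := HU (0, 0) (lexx 0) (lexx 0).
split; first exists (fun a b => U (a, b)).
  split=> [a b a0 b0|u su].
    have [sU rU aU] := HU (a, b) a0 b0; split=> //.
      exact: (asymptotics_cvg0 hN aU).
    exact: (asymptotics_cvg_infty aU).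
  have [a [b [a0 b0 ua]]] := solution_asymptotics hN hbeta hp su.
  exists a, b; split=> // x x0; have [sU _ Ua] := HU (a, b) a0 b0.
  apply/le_anti/andP; split; last exact: (U_le _ _ u a b).
  exact: (asymptotics_le hp su sU ua Ua).
have minU u : positive_solution alpha beta p u ->
    forall x, x != 0 -> U (0, 0) x <= u x.
  move=> su; have [a [b [a0 b0 ua]]] := solution_asymptotics hN hbeta hp su.
  exact: (U_le _ _ u a b).
split; first by exists (U (0, 0)).
move=> xi [sxi minxi].
have xiE x : x != 0 -> xi x = U (0, 0) x.
  by move=> x0; apply/le_anti; rewrite minxi// minU.
split=> [rem|hab].
  have [D D0 HD] := removable_bounded hN hbeta hp sxi rem.
  exact: (bounded_solution_exponent hN hbeta hp sxi D0 HD).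
have [v [cv v0 vU]] := nonsingular_removable hN hbeta hp s0 as0 hab.
by exists v; split=> // x x0; rewrite vU// xiE.
Qed.
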